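(* Let $d,m\ge 1$, $N=d+m$, and let $B^{(l)}=(b^{(l)}_{p,q})_{1\le p,q\le d}$, $1\le l\le m$, be linearly independent skew-symmetric real $d\times d$ matrices. Let $(\mathbf{X}_t)_{t\ge0}=(\mathbf{X}^{(1)}_t,\dots,\mathbf{X}^{(d)}_t)_{t\ge0}$ be a standard Brownian motion on $\mathbb{R}^d$ started from the origin, let $\mathbf{Z}_t=(\mathbf{Z}^{(1)}_t,\dots,\mathbf{Z}^{(m)}_t)$ be its generalized Lévy area associated with the matrices $B^{(l)}$, \[ \mathbf{Z}^{(l)}_t=\sum_{1\le p<q\le d} b^{(l)}_{p,q}\,\mathbf{A}^{(p,q)}_t,\qquad \mathbf{A}^{(p,q)}_t=\int_0^t\mathbf{X}^{(p)}_s\,\mathrm{d}\mathbf{X}^{(q)}_s-\int_0^t\mathbf{X}^{(q)}_s\,\mathrm{d}\mathbf{X}^{(p)}_s , \] and let $\gamma$ be the law of $(\mathbf{X}_1,\mathbf{Z}_1)$ on $\mathbb{R}^N=\mathbb{R}^d\times\mathbb{R}^m$. Then for every Schwartz function $f:\mathbb{R}^N\to\mathbb{R}$, \[ \mathbf{Ent}_\gamma(f^2)\le 2\sum_{p=1}^d\int_0^1\mathbb{E}\left[\left(\partial_pf(\mathbf{X}_1,\mathbf{Z}_1)+\sum_{l=1}^m\Bigl(\sum_{q=1}^d b^{(l)}_{p,q}\bigl(\mathbf{X}^{(q)}_1-2\mathbf{X}^{(q)}_s\bigr)\Bigr)\partial_{d+l}f(\mathbf{X}_1,\mathbf{Z}_1)\right)^2\right]\mathrm{d}s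 . \]
   Context: Stochastic integrals are Itô integrals. $\partial_i f$ denotes the partial derivative of $f$ with respect to its $i$-th coordinate in $\mathbb{R}^N$, so $\partial_p$ for $1\le p\le d$ are derivatives in the $\mathbb{R}^d$ variables and $\partial_{d+l}$ for $1\le l\le m$ are derivatives in the $\mathbb{R}^m$ variables. For a probability measure $\mu$ and a nonnegative function $u$, $\mathbf{Ent}_\mu(u)=\int u\log u\,\mathrm{d}\mu-\bigl(\int u\,\mathrm{d}\mu\bigr)\log\bigl(\int u\,\mathrm{d}\mu\bigr)$, with $0\log0=0$. *)

(* Defs.v *)
From HB Require Import structures.
From mathcomp Require Import all_boot all_order all_algebra.
From mathcomp Require Import all_classical all_reals all_analysis.
From mathcomp Require Import measurable_realfun.

Set Implicit Arguments.
Unset Strict Implicit.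
Unset Printing Implicit Defensive.

Import Order.TTheory GRing.Theory Num.Theory.
Import numFieldNormedType.Exports.

Local Open Scope classical_set_scope.
Local Open Scope ring_scope.

Definition borel_rV (R : realType) (n : nat) :=
  g_sigma_algebraType (@open 'rV[R]_n).

Section measurable_fun_rV.
Context disp (T : measurableType disp) (R : realType).

Let rat_box n (x : 'rV[rat]_n * nat) : set 'rV[R]_n :=
  [set y | forall i, `|y 0 i - ratr (x.1 0 i)| < x.2.+1%:R^-1].

Lemma measurable_fun_rV n (Y : T -> 'rV[R]_n) :
  (forall i, measurable_fun setT (fun w => Y w 0 i)) ->
  measurable_fun setT (Y : T -> borel_rV R n).
Proof.
move=> mY; apply: (@measurability _ _ _ (borel_rV R n) _ _ (@open _)) => //.
move=> _ [U oU <-].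
rewrite setTI.
have -> : U = \bigcup_(x in [set x | rat_box x `<=` U]) rat_box x.
  apply/seteqP; split=> [y Uy|y [x /= xU /xU//]].
  have /nbhs_ballP[e /= e0 yeU] := open_nbhs_nbhs (conj oU Uy).
  have [k ke] : exists k, k.+1%:R^-1 < e / 2 :> R.
    have e20 : 0 < e / 2 by rewrite divr_gt0.
    have [k _ /(_ k (leqnn _)) /= ke] := near_infty_natSinv_lt (PosNum e20).
    by exists k.
  have k0 : 0 < k.+1%:R^-1 :> R by rewrite invr_gt0.
  have /choice[q qP] : forall i, exists r : rat, `|y 0 i - ratr r| < k.+1%:R^-1.
    move=> i; have /rat_in_itvoo[r] : y 0 i - k.+1%:R^-1 < y 0 i + k.+1%:R^-1.
      by rewrite ltrD2l gtrN.
    by rewrite in_itv/= => rP; exists r; rewrite distrC ltr_distl.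
  exists (\row_i q i, k) => /=; last by move=> i; rewrite mxE.
  move=> z /= zq; apply: yeU; split=> // i j; rewrite (ord1 i) /ball /=.
  rewrite -(subrKA (ratr (q j))) (le_lt_trans (ler_normD _ _))//.
  rewrite [ltRHS]splitr ltrD//; first exact: lt_trans ke.
  by rewrite distrC (lt_trans _ ke)//; have := zq j; rewrite mxE.
rewrite preimage_bigcup bigcup_mkcond.
apply: countable_bigcupT_measurable; first exact: countableP.
move=> x; case: ifPn => // _.
have -> : Y @^-1` rat_box x = \bigcap_(i in [set: 'I_n])
    ((fun w => Y w 0 i) @^-1` ball (ratr (x.1 0 i) : R) x.2.+1%:R^-1).
  apply/seteqP; split=> w /= Yw i; first by move=> _; rewrite /ball /= distrC.
  by have := Yw i I; rewrite /ball /= distrC.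
apply: fin_bigcap_measurable => // i _; rewrite -[X in measurable X]setTI.
by apply: mY => //; exact: measurable_ball.
Qed.

End measurable_fun_rV.

Section independence.
Context disp (T : measurableType disp) (R : realType) (P : probability T R).

Definition mutually_independent (I : finType) (S : I -> set (set T)) :=
  forall (J : {set I}) (A : I -> set T), (forall i, i \in J -> S i (A i)) ->
    P (\bigcap_(i in [set` J]) A i) = (\prod_(i in J) P (A i))%E.

Definition sigma_of (K : Type) (Y : K -> T -> R) : set (set T) :=
  <<s \bigcup_k preimage_set_system setT (Y k) measurable >>.

End independence.

Section brownian_motion.
Context disp (T : measurableType disp) (R : realType) (P : probability T R).
Context (d : nat).

(* A process indexed by time t >= 0; its values at t < 0 are irrelevant. The
   last two fields say that X t - X s is N(0, (t - s) I_d) for s < t;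
   normal_prob takes the mean and the standard deviation. *)
Record standard_brownian_motion (X : R -> 'I_d -> {RV P >-> R}) : Prop := {
  bm_start : {ae P, forall w, forall p, X 0 p w = 0};
  bm_continuous : {ae P, forall w, forall p,
    {within [set t : R | 0 <= t], continuous (fun t => X t p w)}};
  bm_independent_increments : forall (n : nat) (t : nat -> R),
    0 <= t 0%N -> {homo t : i j / (i <= j)%N >-> i <= j} ->
    mutually_independent P (fun i : 'I_n =>
      sigma_of (fun p : 'I_d => X (t i.+1) p \- X (t i) p));
  bm_gaussian_coordinates : forall s t : R, 0 <= s -> s < t ->
    forall (p : 'I_d) (A : set R), measurable A ->
      P ((X t p \- X s p) @^-1` A) = normal_prob 0 (Num.sqrt (t - s)) A;
  bm_independent_coordinates : forall s t : R, 0 <= s -> s < t ->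
    mutually_independent P (fun p : 'I_d =>
      sigma_of (fun _ : unit => X t p \- X s p))
}.

Definition natural_filtration (X : R -> 'I_d -> {RV P >-> R}) (t : R) :
    set (set T) :=
  sigma_of (fun sp : {s : R | 0 <= s <= t} * 'I_d => X (sval sp.1) sp.2).

End brownian_motion.

Section ito_integral.
Context disp (T : measurableType disp) (R : realType) (P : probability T R).
Context (F : R -> set (set T)).

Record simple_process := SimpleProcess {
  sp_size : nat;
  sp_time : nat -> R;
  sp_coef : nat -> T -> R;
  sp_time_ge0 : 0 <= sp_time 0%N;
  sp_time_homo : {homo sp_time : i j / (i <= j)%N >-> i <= j};
  sp_coef_bounded : forall i, exists M, forall w, `|sp_coef i w| <= M;
  sp_coef_adapted : forall i (A : set R), measurable A ->
    F (sp_time i) (sp_coef i @^-1` A)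
}.

Definition sp_value (H : simple_process) (s : R) (w : T) : R :=
  \sum_(i < sp_size H)
    sp_coef H i w * \1_(`]sp_time H i, sp_time H i.+1]) s.

Definition sp_integral (H : simple_process) (W : R -> T -> R) (t : R) (w : T) :
    R :=
  \sum_(i < sp_size H) sp_coef H i w *
    (W (Num.min (sp_time H i.+1) t) w - W (Num.min (sp_time H i) t) w).

(* J is (a version of) the Ito integral of H against the F-Brownian motion W
   over [0, t]: the L^2(P) limit of the elementary integrals of simple
   F-adapted processes that converge to H in L^2([0, t] x T, ds (x) P). By the
   Ito isometry J does not depend, up to a null set, on the approximation. *)
Definition is_ito_integral (H W : R -> T -> R) (t : R) (J : {RV P >-> R}) :=
  exists Hn : nat -> simple_process,
    ((fun n => \int[lebesgue_measure]_(s in `[0%R, t])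
        'E_P[fun w => ((sp_value (Hn n) s w - H s w) ^+ 2)%R]) @ \oo --> 0)%E /\
    ((fun n => 'E_P[fun w => ((sp_integral (Hn n) W t w - J w) ^+ 2)%R])
        @ \oo --> 0)%E.

End ito_integral.

Section levy_area.
Context disp (T : measurableType disp) (R : realType) (P : probability T R).
Context (d m : nat).

(* J p q t stands for the Ito integral of X^(p) against X^(q) over [0, t]. *)
Definition levy_area (J : 'I_d -> 'I_d -> R -> {RV P >-> R})
    (p q : 'I_d) (t : R) (w : T) : R :=
  J p q t w - J q p t w.

Definition generalized_levy_area (B : 'I_m -> 'M[R]_d)
    (J : 'I_d -> 'I_d -> R -> {RV P >-> R}) (t : R) (l : 'I_m) (w : T) : R :=
  \sum_(p < d) \sum_(q < d | (p < q)%N) B l p q * levy_area J p q t w.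

(* The pair (X_t, Z_t) as a random vector of R^(d + m). *)
Definition bm_levy_area (X : R -> 'I_d -> {RV P >-> R}) (B : 'I_m -> 'M[R]_d)
    (J : 'I_d -> 'I_d -> R -> {RV P >-> R}) (t : R) (w : T) :
    borel_rV R (d + m) :=
  row_mx (\row_p X t p w) (\row_l generalized_levy_area B J t l w).

Lemma measurable_bm_levy_area X B J t :
  measurable_fun setT (bm_levy_area X B J t).
Proof.
apply: measurable_fun_rV => i; case: (split_ordP i) => [p ->|l ->].
  by under eq_fun do rewrite row_mxEl mxE; exact: measurable_funPT.
under eq_fun do rewrite row_mxEr mxE /generalized_levy_area.
apply: measurable_sum => p.
rewrite (_ : (fun _ => _) = fun w => \sum_(q < d)
    if (p < q)%N then B l p q * levy_area J p q t w else 0); last first.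
  by apply/funext => w; rewrite big_mkcond.
apply: measurable_sum => q; case: (p < q)%N => //.
apply: measurable_funM; first exact: measurable_cst.
by apply: measurable_funB; exact: measurable_funPT.
Qed.

HB.instance Definition _ X B J t := @isMeasurableFun.Build _ _ _ _
  (bm_levy_area X B J t) (measurable_bm_levy_area X B J t).

End levy_area.

Section schwartz.
Context (R : realType) (n : nat).

Definition partial (i : 'I_n) (f : 'rV[R]_n -> R) : 'rV[R]_n -> R :=
  'D_('e_i) f.

Definition iter_partial (s : seq 'I_n) (f : 'rV[R]_n -> R) : 'rV[R]_n -> R :=
  foldr partial f s.

Definition schwartz (f : 'rV[R]_n -> R) :=
  (forall s x, differentiable (iter_partial s f) x) /\
  (forall (a : 'I_n -> nat) (s : seq 'I_n), exists C : R,
     forall x : 'rV[R]_n, `|(\prod_i x 0 i ^+ a i) * iter_partial s f x| <= C).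

End schwartz.

(* ln 0 = 0 and lne 0 = -oo with 0 * -oo = 0, so that 0 log 0 = 0 in both
   terms. *)
Definition entropy disp (U : measurableType disp) (R : realType)
    (mu : probability U R) (u : U -> R) : \bar R :=
  (\int[mu]_x (u x * ln (u x))%:E
   - (\int[mu]_x (u x)%:E) * lne (\int[mu]_x (u x)%:E))%E.

(* Main.v *)
(* Replace the Brownian path by its independent increments [x (i, p)] over the
   grid of step 1/N. The Ito integrals are L^2 limits of Riemann sums, so
   (X_1, Z_1) is the limit of a point [area_point] of R^(d + m) that depends
   affinely on each single increment [x k], with a slope [area_dir k] that does
   not involve [x k]. Tensorisation bounds the entropy of f^2 + eps at this point
   by a sum over k of one-variable entropies, and since [x k] has variance 1/N, a
   Taylor expansion bounds the k-th one by 2/N E[(derivative of f along the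
   slope)^2] up to O(1/N^2): no logarithmic Sobolev inequality for Gaussian
   measures is needed. By skew-symmetry, the slope for k = (i, p) tends to
   e_p + sum_l (sum_q b^(l)_(p,q) (X_1 - 2 X_s)^(q)) e_(d+l) when s is in the
   i-th cell, so that the sum over k becomes the integral over s. *)
Require Import Defs.
From HB Require Import structures.
From mathcomp Require Import all_boot all_order all_algebra.
From mathcomp Require Import all_classical all_reals all_analysis.
From mathcomp Require Import measurable_realfun.
From mathcomp Require Import ring lra.

Set Implicit Arguments.
Unset Strict Implicit.
Unset Printing Implicit Defensive.

Import Order.TTheory GRing.Theory Num.Theory.
Import numFieldNormedType.Exports.

Local Open Scope classical_set_scope.
Local Open Scope ring_scope.

(** The factor 2 has a scalar origin. With [ent_fun a b = a ln (a / b) - a + b], the values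
    [a = F^2 + eps] and [b = G^2 + eps] give about [(a - b)^2 / (2 b)], hence at most about
    [2 (F - G)^2] when [F] is close to [G]. In the tensorised inequality the comparison value for
    one increment is the value of [f^2 + eps] with that increment set to 0, not the conditional
    mean: it is explicit, and the derivative and slope taken there are independent of the increment.
    The regularisation keeps the argument of the logarithm away from 0. The constants of the quartic
    errors blow up when [eps] or the parameter [del] of Young's inequality tends to 0, so N goes to
    infinity first, then [del] to 0, and [eps] last. Three facts shape the details. The Ito
    integrals are known only as mean square limits of integrals of arbitrary simple processes, so
    Riemann sums are compared with those by an isometry for overlapping intervals. Integrals over
    [s] of expectations are compared by monotonicity and step functions, so that measurability in
    [s] is proved for elementary integrands only. The path starts at 0 only almost surely, so [X 0]
    is carried along as an error term. *)

(** * Random variables with finite moments of every order, and real expectations *)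

Section moments.
Context d (T : measurableType d) (R : realType) (P : probability T R).
Implicit Types X Y : T -> R.

(** These variables form an algebra containing the bounded measurable functions and the Brownian
    increments, so the integrability of polynomial expressions follows from closure lemmas, gathered
    in the tactic [mom]. *)
Definition mom X :=
  measurable_fun setT X /\
  forall k, (\int[P]_w (`|X w| ^+ k)%:E < +oo)%E.

(** Domination criterion behind closure under sums and products. It concludes for a first absolute
    moment only, since a power of a variable can itself be taken as [X]. *)
Lemma mom_dom (I : finType) (C : I -> R) (Y : I -> T -> R) (k : I -> nat) X :
  measurable_fun setT X -> (forall i, 0 <= C i) -> (forall i, mom (Y i)) ->
  (forall w, `|X w| <= \sum_i C i * `|Y i w| ^+ k i) ->
  (\int[P]_w (`|X w|)%:E < +oo)%E.
Proof.
move=> mX C0 mY XY.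
apply: (@le_lt_trans _ _ (\int[P]_w (\sum_i C i * `|Y i w| ^+ k i)%:E)%E).
  apply: ge0_le_integral => //.
  - by apply/measurable_EFinP; apply: measurableT_comp.
  - apply/measurable_EFinP; apply: measurable_sum => i.
    apply: measurable_funM => //; apply: measurable_funX.
    by apply: measurableT_comp => //; case: (mY i).
  - by move=> w _; rewrite lee_fin.
under eq_integral do rewrite -sumEFin.
rewrite ge0_integral_sum //; last 2 first.
  - move=> i; apply/measurable_EFinP.
    apply: measurable_funM => //; apply: measurable_funX.
    by apply: measurableT_comp => //; case: (mY i).
  - by move=> i w _; rewrite lee_fin mulr_ge0 // exprn_ge0.
apply: lte_sum_pinfty => i _.
under eq_integral do rewrite EFinM.
rewrite ge0_integralZl_EFin //; last first.
  - apply/measurable_EFinP; apply: measurable_funX.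
    by apply: measurableT_comp => //; case: (mY i).
by apply: lte_mul_pinfty; rewrite ?lee_fin //; exact: (mY i).2.
Qed.

Lemma mom_integrable X : mom X -> P.-integrable setT (EFin \o X).
Proof.
case=> mX /(_ 1%N) iX; apply/integrableP; split; first exact/measurable_EFinP.
by under eq_integral do rewrite /= -[`|_|]expr1.
Qed.

Lemma mom_cst c : mom (cst c).
Proof.
split=> // k; have := integral_cst P measurableT ((`|c| ^+ k)%:E); rewrite /cst => ->.
by rewrite [X in (_ * X)%E](@probability_setT _ _ _ P) mule1 ltry.
Qed.

Lemma exprD_le (a b : R) k : 0 <= a -> 0 <= b ->
  (a + b) ^+ k <= 2 ^+ k * a ^+ k + 2 ^+ k * b ^+ k.
Proof.
move=> a0 b0; rewrite -!exprMn.
have [ab|/ltW ba] := leP a b.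
  apply: (@le_trans _ _ ((2 * b) ^+ k)); last by rewrite lerDr exprn_ge0 // mulr_ge0.
  by rewrite lerXn2r ?nnegrE ?addr_ge0 ?mulr_ge0 //; lra.
apply: (@le_trans _ _ ((2 * a) ^+ k)); last by rewrite lerDl exprn_ge0 // mulr_ge0.
by rewrite lerXn2r ?nnegrE ?addr_ge0 ?mulr_ge0 //; lra.
Qed.

Lemma momD X Y : mom X -> mom Y -> mom (fun w => X w + Y w).
Proof.
move=> mX mY; split; first by apply: measurable_funD; [case: mX|case: mY].
move=> k; under eq_integral do rewrite -normrX.
apply: (@mom_dom bool (fun=> 2 ^+ k) (fun b => if b then X else Y) (fun=> k)).
- by apply: measurable_funX; apply: measurable_funD; [case: mX|case: mY].
- by move=> _; rewrite exprn_ge0.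
- by case.
- move=> w; rewrite big_bool /= normrX (le_trans _ (exprD_le _ _ _)) //.
  by rewrite lerXn2r ?nnegrE ?addr_ge0 // ler_normD.
Qed.

Lemma momM X Y : mom X -> mom Y -> mom (fun w => X w * Y w).
Proof.
move=> mX mY; split; first by apply: measurable_funM; [case: mX|case: mY].
move=> k; under eq_integral do rewrite -normrX.
apply: (@mom_dom bool (fun=> 1) (fun b => if b then X else Y) (fun=> (k * 2)%N)).
- by apply: measurable_funX; apply: measurable_funM; [case: mX|case: mY].
- by [].
- by case.
- move=> w; rewrite big_bool /= normrX normrM exprMn !mul1r !exprM.
  (* The product of two k-th powers is at most the sum of the two 2k-th powers, whence the doubled
     exponent given to [mom_dom]. *)
  have := sqr_ge0 (`|X w| ^+ k - `|Y w| ^+ k).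
  have := exprn_ge0 k (normr_ge0 (X w)); have := exprn_ge0 k (normr_ge0 (Y w)).
  set a := `|X w| ^+ k; set b := `|Y w| ^+ k => b0 a0; nra.
Qed.

Lemma mom_ext X Y : X =1 Y -> mom X -> mom Y.
Proof. by move=> /funext ->. Qed.

Lemma momZ c X : mom X -> mom (fun w => c * X w).
Proof. by move=> mX; apply: momM => //; exact: mom_cst. Qed.

Lemma momN X : mom X -> mom (fun w => - X w).
Proof. by move/(momZ (-1)); apply: mom_ext => w; rewrite mulN1r. Qed.

Lemma momB X Y : mom X -> mom Y -> mom (fun w => X w - Y w).
Proof. by move=> mX mY; apply: momD => //; exact: momN. Qed.

Lemma momX X n : mom X -> mom (fun w => X w ^+ n).
Proof.
move=> mX; elim: n => [|n IH]; first exact: (mom_cst 1).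
by apply: (mom_ext (X := fun w => X w * X w ^+ n)); [move=> w; rewrite exprS|exact: momM].
Qed.

Lemma mom_norm X : mom X -> mom (fun w => `|X w|).
Proof.
move=> mX; split; first by apply: measurableT_comp => //; case: mX.
by move=> k; under eq_integral do rewrite normr_id; exact: mX.2.
Qed.

Lemma mom_sum (I : Type) (s : seq I) (Q : pred I) (F : I -> T -> R) :
  (forall i, Q i -> mom (F i)) -> mom (fun w => \sum_(i <- s | Q i) F i w).
Proof.
move=> mF; elim: s => [|i s IH].
  by apply: (mom_ext (X := cst 0)); [move=> w; rewrite big_nil|exact: mom_cst].
case Qi : (Q i).
  apply: (mom_ext (X := fun w => F i w + \sum_(j <- s | Q j) F j w)).
    by move=> w; rewrite big_cons Qi.
  by apply: momD => //; exact: mF.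
by apply: mom_ext IH => w; rewrite big_cons Qi.
Qed.

Lemma mom_bounded X M : measurable_fun setT X -> (forall w, `|X w| <= M) -> mom X.
Proof.
move=> mX XM; split=> // k; under eq_integral do rewrite -normrX.
apply: (@mom_dom unit (fun=> 1) (fun=> cst M) (fun=> k)) => //.
- exact: measurable_funX.
- by move=> _; exact: mom_cst.
- move=> w; rewrite big_const card_unit /= addr0 mul1r normrX lerXn2r ?nnegrE //.
  by rewrite (le_trans (XM w)) // ler_norm.
Qed.

(** Real-valued, so that [lra] and [ring] apply to expectations. As [fine] sends an infinite
    integral to 0, [ExE] with a [mom] hypothesis is the bridge back to integrals. *)
Definition Ex X : R := fine (\int[P]_w (X w)%:E).

Lemma ExE X : mom X -> (\int[P]_w (X w)%:E)%E = (Ex X)%:E.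
Proof.
move=> mX; rewrite /Ex fineK //; apply: integrable_fin_num => //.
exact: mom_integrable.
Qed.

Lemma eq_Ex X Y : X =1 Y -> Ex X = Ex Y.
Proof. by move=> /funext ->. Qed.

Lemma Ex_cst c : Ex (cst c) = c.
Proof. have := integral_cst P measurableT c%:E; rewrite /Ex /cst => ->.
by rewrite [X in (_ * X)%E](@probability_setT _ _ _ P) mule1. Qed.

Lemma ExD X Y : mom X -> mom Y -> Ex (fun w => X w + Y w) = Ex X + Ex Y.
Proof.
by move=> mX mY; apply: RintegralD => //; exact: mom_integrable.
Qed.

Lemma ExZ c X : mom X -> Ex (fun w => c * X w) = c * Ex X.
Proof.
by move=> mX; apply: RintegralZl => //; exact: mom_integrable.
Qed.

Lemma ExN X : mom X -> Ex (fun w => - X w) = - Ex X.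
Proof.
by move=> mX; rewrite -[RHS]mulN1r -ExZ //; apply: eq_Ex => w; rewrite mulN1r.
Qed.

Lemma ExB X Y : mom X -> mom Y -> Ex (fun w => X w - Y w) = Ex X - Ex Y.
Proof. by move=> mX mY; rewrite ExD ?ExN //; exact: momN. Qed.

Lemma Ex_sum (I : Type) (s : seq I) (Q : pred I) (F : I -> T -> R) :
  (forall i, Q i -> mom (F i)) ->
  Ex (fun w => \sum_(i <- s | Q i) F i w) = \sum_(i <- s | Q i) Ex (F i).
Proof.
move=> mF; elim: s => [|i s IH].
  by rewrite big_nil (eq_Ex (Y := cst 0)) ?Ex_cst // => w; rewrite big_nil.
rewrite big_cons -IH; case Qi : (Q i); last first.
  by apply: eq_Ex => w; rewrite big_cons Qi.
rewrite -ExD; [|exact: mF|exact: mom_sum].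
by apply: eq_Ex => w; rewrite big_cons Qi.
Qed.

Lemma Ex_le X Y : mom X -> mom Y -> (forall w, X w <= Y w) -> Ex X <= Ex Y.
Proof.
by move=> mX mY XY; apply: le_Rintegral => //; exact: mom_integrable.
Qed.

Lemma Ex_ge0 X : (forall w, 0 <= X w) -> 0 <= Ex X.
Proof. by move=> X0; apply: fine_ge0; apply: integral_ge0 => w _; rewrite lee_fin. Qed.

End moments.

Ltac mom := repeat first [assumption | apply: mom_cst | apply: momD |
  apply: momB | apply: momN | apply: momX | apply: mom_norm | apply: momM |
  (apply: mom_sum => ? ?)].

(** * Scalar inequalities for the integrand of the entropy *)

Section entropy_inequalities.
Context (R : realType).
Implicit Types a b t u v : R.

(** The difference of the two sides vanishes at 1 and has derivative [(1 - 1/x)^2 / 2]. *)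
Lemma ln_le_half_subV t : 1 <= t -> ln t <= (t - t^-1) / 2.
Proof.
rewrite le_eqVlt => /predU1P[<-|t1]; first by rewrite ln1 invr1 subrr mul0r.
pose F (x : R) := (x - x^-1) / 2 - ln x.
pose dF (x : R) := (1 + x ^- 2) / 2 - x^-1.
have dFE (x : R) : 0 < x -> is_derive x 1 F (dF x).
  move=> x0; have x1 : x != 0 by rewrite gt_eqF.
  have dl := is_derive1_ln x0.
  have dV : is_derive x 1 (fun y : R => y^-1) (- x ^- 2).
    by have := @is_deriveV R id x 1 1 x1 (is_derive_id _ _); rewrite /GRing.scale /= mulr1.
  apply: is_derive_eq.
  rewrite /dF /GRing.scale /=; field.
  by [].
have [||c] := @MVT _ F dF 1 t t1.
- by move=> x; rewrite in_itv /= => /andP[x1 _]; apply: dFE; lra.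
- apply: derivable_within_continuous => x; rewrite in_itv /= => /andP[x1 _].
  have x0 : 0 < x by lra.
  by have [] := dFE x x0.
rewrite in_itv /= => /andP[c1 _].
rewrite {2}/F invr1 subrr mul0r ln1 subrr subr0 => Ft.
have : 0 <= F t.
  rewrite Ft; apply: mulr_ge0; last by lra.
  rewrite /dF.
  have := sqr_ge0 (c^-1 - 1).
  by rewrite -[c ^- 2]exprVn; move: (c^-1) => u; lra.
by rewrite /F subr_ge0.
Qed.

(** The difference of the two sides vanishes at 0 and has derivative [x^2 / (1 - x)]. *)
Lemma ln_1sub_le t : 0 <= t < 1 -> ln (1 - t) <= - t - t ^+ 2 / 2.
Proof.
case/andP; rewrite le_eqVlt => /predU1P[<- _|t0 t1].
  by rewrite subr0 ln1 expr0n /= mul0r subr0 oppr0.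
pose F (x : R) := - x - x ^+ 2 / 2 - ln (1 - x).
pose dF (x : R) := - 1 - x + (1 - x)^-1.
have dFE (x : R) : x < 1 -> is_derive x 1 F (dF x).
  move=> x1; have x0 : 0 < 1 - x by lra.
  have dl := is_derive1_ln x0.
  have dl2 : is_derive x 1 (fun y : R => ln (1 - y)) (- (1 - x)^-1).
    have h : is_derive x 1 (fun y : R => 1 - y) (-1).
      by apply: is_derive_eq; rewrite add0r mul1r.
    by have := @is_derive1_comp _ (@ln R) (fun y : R => 1 - y) _ _ _ dl h; rewrite /GRing.scale /= mulrN1.
  apply: is_derive_eq.
  rewrite /dF /GRing.scale /= ; field.
  by rewrite gt_eqF.
have [||c] := @MVT _ F dF 0 t t0.
- by move=> x; rewrite in_itv /= => /andP[x1 x2]; apply: dFE; lra.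
- apply: derivable_within_continuous => x; rewrite in_itv /= => /andP[_ x1].
  have x0 : x < 1 by lra.
  by have [] := dFE x x0.
rewrite in_itv /= => /andP[c0 ct].
have -> : F 0 = 0 by rewrite /F subr0 ln1 expr0n /=; lra.
rewrite !subr0 => Ft.
have : 0 <= F t.
  rewrite Ft; apply: mulr_ge0; last by lra.
  rewrite /dF.
  have c1 : 0 < 1 - c by lra.
  have -> : - 1 - c + (1 - c)^-1 = c ^+ 2 / (1 - c) by field; rewrite gt_eqF.
  by rewrite divr_ge0 ?sqr_ge0 ?ltW.
by rewrite /F subr_ge0.
Qed.

(** The Bregman divergence of [x ln x]: the entropy of [u] is at most the mean of [ent_fun u b] for
    every constant [b > 0], with equality when [b] is the mean of [u]. *)
Definition ent_fun a b := a * ln (a / b) - a + b.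

(** By homogeneity only [t = a / b] matters. For [t >= 1] the quadratic term suffices; for [t < 1]
    the bound on [ln (1 - (1 - t))] gives exactly [(1 - t)^2 / 2 + (1 - t)^3 / 2]. *)
Lemma ent_fun_le a b : 0 < a -> 0 < b ->
  ent_fun a b <= (a - b) ^+ 2 / (2 * b) + `|a - b| ^+ 3 / (2 * b ^+ 2).
Proof.
move=> a0 b0; have bn0 : b != 0 by rewrite gt_eqF.
pose t := a / b; have t0 : 0 < t by rewrite divr_gt0.
have -> : a = t * b by rewrite /t divfK.
rewrite /ent_fun mulfK //.
have -> : t * b - b = (t - 1) * b by ring.
rewrite normrM (gtr0_norm b0) !exprMn.
have -> : (t - 1) ^+ 2 * b ^+ 2 / (2 * b) + `|t - 1| ^+ 3 * b ^+ 3 / (2 * b ^+ 2)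
  = b * ((t - 1) ^+ 2 / 2 + `|t - 1| ^+ 3 / 2) by field.
have -> : t * b * ln t - t * b + b = b * (t * ln t - t + 1) by ring.
rewrite ler_pM2l //.
have [t1|t1] := leP 1 t.
  have : t * ln t <= (t ^+ 2 - 1) / 2.
    have -> : (t ^+ 2 - 1) / 2 = t * ((t - t^-1) / 2) by field; rewrite gt_eqF.
    by rewrite ler_pM2l // ln_le_half_subV.
  have : 0 <= `|t - 1| ^+ 3 by rewrite exprn_ge0.
  by nra.
have : ln (1 - (1 - t)) <= - (1 - t) - (1 - t) ^+ 2 / 2 by apply: ln_1sub_le; lra.
rewrite subKr => lt.
have : t * ln t <= t * (- (1 - t) - (1 - t) ^+ 2 / 2) by rewrite ler_pM2l.
rewrite ltr0_norm; last by lra.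
move=> h; apply: (@le_trans _ _ (t * (- (1 - t) - (1 - t) ^+ 2 / 2) - t + 1)); first lra.
by rewrite le_eqVlt; apply/orP; left; apply/eqP; field.
Qed.

(* Duality: [a * u] is maximised over [u] against [b * exp u] at [u = ln (a/b)]. *)
Lemma ent_fun_dual a b u : 0 < a -> 0 < b ->
  a * u <= ent_fun a b + b * expR u - b.
Proof.
move=> a0 b0; rewrite /ent_fun.
have e0 : 0 < b / a * expR u by rewrite mulr_gt0 ?divr_gt0 ?expR_gt0.
have : ln (1 + (b / a * expR u - 1)) <= b / a * expR u - 1 by apply: le_ln1Dx; lra.
rewrite addrC subrK lnM ?posrE ?expR_gt0 ?divr_gt0 // expRK => h.
have -> : ln (a / b) = - ln (b / a) by rewrite -lnV ?posrE ?divr_gt0 // invf_div.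
have : a * (ln (b / a) + u) <= a * (b / a * expR u - 1) by rewrite ler_pM2l.
have -> : a * (b / a * expR u - 1) = b * expR u - a by field; rewrite gt_eqF.
lra.
Qed.

End entropy_inequalities.

(** * Independence as a product formula, and integration of one variable with the other frozen *)

Section freezing.
Context d (T : measurableType d) (R : realType) (P : probability T R).
Context d' (S : measurableType d').
Variables (U : T -> S) (V : T -> R) (mu : probability R R).
Hypotheses (mU : measurable_fun setT U) (mV : measurable_fun setT V).
Local Open Scope ereal_scope.

(** Two facts in one formula: [U] and [V] are independent, and (with [A] the whole space) [mu] is
    the law of [V]. *)
Definition indep_law :=
  forall (A : set S) (B : set R), measurable A -> measurable B ->
    P (U @^-1` A `&` V @^-1` B) = P (U @^-1` A) * mu B.

(** For fixed [B] both sides are finite measures in [A], so agreement on a generating pi-system is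
    enough. *)
Lemma indep_law_pi (G : set (set S)) :
  measurable = <<s G >> -> setI_closed G -> G setT ->
  (forall A B, G A -> measurable B ->
    P (U @^-1` A `&` V @^-1` B) = P (U @^-1` A) * mu B) ->
  indep_law.
Proof.
move=> mG GI GT PG A B mA mB.
have mVB : measurable (V @^-1` B) by rewrite -[X in measurable X]setTI; exact: mV.
pose U' : {mfun T >-> S} := HB.pack U (isMeasurableFun.Build _ _ _ _ U mU).
have b0 : (0 <= fine (mu B))%R by rewrite fine_ge0.
pose m1_ := pushforward (mrestr P mVB) U : {measure set S -> \bar R}.
pose m1 := m1_ mU.
pose m2 := mscale (NngNum b0) (distribution P U').
have muBE : (fine (mu B))%:E = mu B by rewrite fineK // fin_num_measure.
have m1E C : m1 C = P (U @^-1` C `&` V @^-1` B) by [].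
have m2E C : m2 C = P (U @^-1` C) * mu B by rewrite muleC -[in RHS]muBE.
suff : m1 A = m2 A by move=> h; exact: etrans h (m2E A).
apply: (measure_unique G (fun=> setT)) => //.
- by rewrite bigcup_const //; exists 0%N.
- by move=> C GC; exact: etrans (PG C B GC mB) (esym (m2E C)).
- move=> _; rewrite [X in X < _]m1E preimage_setT setTI.
  by rewrite (@le_lt_trans _ _ 1) ?ltry // probability_le1.
Qed.

(** The joint law is the product of the law of [U] and [mu]; Tonelli then integrates over [v]
    first. *)
Lemma freezing : indep_law ->
  forall F : S * R -> \bar R, measurable_fun setT F -> (forall x, 0 <= F x) ->
  \int[P]_w F (U w, V w) = \int[P]_w \int[mu]_v F (U w, v).
Proof.
move=> HI F mF F0.
pose U' : {mfun T >-> S} := HB.pack U (isMeasurableFun.Build _ _ _ _ U mU).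
have mUV : measurable_fun setT (fun w => (U w, V w)) by exact/measurable_fun_pair.
pose W : {mfun T >-> (S * R)%type} :=
  HB.pack (fun w => (U w, V w)) (isMeasurableFun.Build _ _ _ _ _ mUV).
have <- := @ge0_integral_distribution _ _ _ _ _ P W F mF F0.
rewrite (eq_measure_integral (distribution P U' \x mu)); last first.
  by move=> A mA _; apply/esym/product_measure_unique => // B C mB mC; exact: HI.
rewrite fubini_tonelli1 //.
rewrite (@ge0_integral_distribution _ _ _ _ _ P U') //.
- exact: measurable_fun_fubini_tonelli_F.
- by move=> y; apply: integral_ge0.
Qed.

End freezing.

(** * Finite families of independent real coordinates, and resampling of one of them *)

Section boxes.
Context (K : finType) (R : realType).

Definition boxes : set (set (K -> R)) :=
  [set A | exists2 B : K -> set R, (forall k, measurable (B k)) &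
     A = [set x | forall k, B k (x k)]].

Definition coords := g_sigma_algebraType boxes.

Lemma boxes_setI : setI_closed boxes.
Proof.
move=> _ _ [B mB ->] [C mC ->]; exists (fun k => B k `&` C k).
  by move=> k; exact: measurableI.
apply/seteqP; split => x /=.
  by move=> [xB xC] k; split.
by move=> h; split => k; have [] := h k.
Qed.

Lemma boxes_setT : boxes setT.
Proof. by exists (fun=> setT) => //; apply/seteqP; split. Qed.

Lemma measurable_coord (k : K) : measurable_fun setT (fun x : coords => x k).
Proof.
move=> _ B mB; rewrite setTI; apply: sub_sigma_algebra.
exists (fun j => if j == k then B else setT).
  by move=> j; case: ifP.
apply/seteqP; split => x /=; last by move/(_ k); rewrite eqxx.
by move=> xB j; case: eqP => [->|].
Qed.

Lemma measurable_coords d (T : measurableType d) (xi : T -> coords) :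
  (forall k, measurable_fun setT (fun w => xi w k)) -> measurable_fun setT xi.
Proof.
move=> mxi; apply: (@measurability _ _ T coords setT xi boxes) => //.
move=> _ [_ [B mB ->] <-]; rewrite setTI.
rewrite (_ : _ @^-1` _ = \bigcap_(k in [set: K]) ((fun w => xi w k) @^-1` B k)).
  apply: fin_bigcap_measurable => // k _.
  by rewrite -[X in measurable X]setTI; exact: mxi.
by apply/seteqP; split => w /= h k; [move=> _; exact: h|exact: (h k Logic.I)].
Qed.

Definition upd (k : K) (x : coords) (v : R) : coords :=
  fun j => if j == k then v else x j.

Lemma upd_upd k x u v : upd k (upd k x u) v = upd k x v.
Proof. by apply/funext => j; rewrite /upd; case: eqP. Qed.

Lemma upd_same k x : upd k x (x k) = x.
Proof. by apply/funext => j; rewrite /upd; case: eqP => [->|]. Qed.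

Lemma updE k x v : upd k x v k = v.
Proof. by rewrite /upd eqxx. Qed.

Lemma measurable_upd k :
  measurable_fun setT (fun p : coords * R => upd k p.1 p.2).
Proof.
apply: measurable_coords => j; rewrite /upd; case: eqP => _.
  exact: measurable_snd.
exact: (measurableT_comp (measurable_coord j) measurable_fst).
Qed.

Lemma measurable_updl k v : measurable_fun setT (fun x : coords => upd k x v).
Proof.
apply: measurable_coords => j; rewrite /upd; case: eqP => _ //.
exact: measurable_coord.
Qed.

End boxes.

Section resampling.
Context d (T : measurableType d) (R : realType) (P : probability T R).
Context (K : finType) (mu : K -> probability R R).
Variable xi : T -> coords K R.
Hypothesis mxi : forall k, measurable_fun setT (fun w => xi w k).
Local Open Scope ereal_scope.

Definition indep_coords := forall B : K -> set R, (forall k, measurable (B k)) ->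
  P [set w | forall k, B k (xi w k)] = \prod_k mu k (B k).

Hypothesis Pxi : indep_coords.

Let m_xi : measurable_fun setT xi. Proof. exact: measurable_coords. Qed.

(** Setting coordinate [k] to 0 encodes the family of the other coordinates without changing the
    index type. *)
Lemma indep_coords_upd k :
  indep_law P (fun w => upd k (xi w) 0%R) (fun w => xi w k) (mu k).
Proof.
apply: (@indep_law_pi _ T R P _ (coords K R) _ _ (mu k)
  (measurableT_comp (measurable_updl k 0%R) m_xi) (mxi k) (@boxes K R) erefl
  (@boxes_setI K R) (@boxes_setT K R)).
move=> _ B [C mC ->] mB.
have [C0|C0] := pselect (C k 0%R); last first.
  rewrite (_ : _ @^-1` _ = set0) ?set0I ?measure0 ?mul0e //.
  by apply/seteqP; split => // w /= /(_ k); rewrite updE.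
pose D B := fun j => if j == k then B else C j.
have mD B' : measurable B' -> forall j, measurable (D B' j).
  by move=> mB' j; rewrite /D; case: ifP.
have DP B' : measurable B' ->
    P [set w | forall j, D B' j (xi w j)] = mu k B' * \prod_(j | j != k) mu j (C j).
  move=> mB'; rewrite Pxi; last exact: mD.
  rewrite (bigD1 k) //= /D eqxx; congr (_ * _).
  by apply: eq_bigr => j /negbTE ->.
have -> : (fun w => upd k (xi w) 0%R) @^-1` [set x | forall k0, C k0 (x k0)] =
    [set w | forall j, D setT j (xi w j)].
  apply/seteqP; split => w /= h j; rewrite /D; move: (h j); rewrite /upd /D;
    by case: eqP => // ->.
have -> : [set w | forall j, D setT j (xi w j)] `&` (fun w => xi w k) @^-1` B =
    [set w | forall j, D B j (xi w j)].
  apply/seteqP; split => w /=.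
    by move=> [h hB] j; move: (h j); rewrite /D; case: eqP => [->|].
  move=> h; split; last by move: (h k); rewrite /D eqxx.
  by move=> j; move: (h j); rewrite /D; case: eqP.
rewrite !DP // probability_setT mul1e muleC //.
Qed.

(** [freezing] with the other coordinates as first variable: redrawing coordinate [k] from [mu k]
    leaves the joint law unchanged. *)
Lemma resampling k (F : coords K R -> \bar R) :
  measurable_fun setT F -> (forall x, 0 <= F x) ->
  \int[P]_w F (xi w) = \int[P]_w \int[mu k]_v F (upd k (xi w) v).
Proof.
move=> mF F0.
have := @freezing _ T R P _ (coords K R) _ _ (mu k)
  (measurableT_comp (measurable_updl k 0%R) m_xi) (mxi k) (indep_coords_upd k)
  (fun p => F (upd k p.1 p.2)) (measurableT_comp mF (measurable_upd k)).
move=> H.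
transitivity (\int[P]_w F (upd k (upd k (xi w) 0%R) (xi w k))).
  by apply: eq_integral => w _; rewrite upd_upd upd_same.
rewrite H //.
by apply: eq_integral => w _; apply: eq_integral => v _; rewrite upd_upd.
Qed.

End resampling.

(** * Averaging out coordinates, and tensorisation of the entropy *)

Section integrate_out.
Context (R : realType) (K : finType) (mu : K -> probability R R).
Implicit Types (F G : coords K R -> R).

(** A positive lower bound and an upper bound keep logarithms and inverses bounded, and both bounds
    survive averaging, so integrability is automatic throughout the entropy argument. *)
Definition between (a b : R) F := measurable_fun setT F /\ forall x, a <= F x <= b.

(** The conditional expectation given the coordinates other than [k], as an everywhere defined
    function. *)
Definition avg (k : K) F : coords K R -> R := fun x => Ex (mu k) (fun v => F (upd k x v)).

Lemma measurable_upd_section k F x : measurable_fun setT F ->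
  measurable_fun setT (fun v => F (upd k x v)).
Proof.
move=> mF.
exact: (measurable_fun_pair2 x (measurableT_comp mF (measurable_upd k))).
Qed.

Lemma between_norm a b F x : 0 <= a -> between a b F -> `|F x| <= b.
Proof. by move=> a0 [_ /(_ x)/andP[h1 h2]]; rewrite ger0_norm // (le_trans a0). Qed.

Lemma mom_section a b k F x : 0 <= a -> between a b F ->
  mom (mu k) (fun v => F (upd k x v)).
Proof.
move=> a0 abF; apply: (@mom_bounded _ _ _ _ _ b).
  by apply: measurable_upd_section; case: abF.
by move=> v; exact: between_norm abF.
Qed.

Lemma between_avg a b k F : 0 <= a -> between a b F -> between a b (avg k F).
Proof.
move=> a0 abF; split.
  apply/measurable_EFinP.
  rewrite (_ : EFin \o _ = fun x => (\int[mu k]_v (F (upd k x v))%:E)%E); last first.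
    by apply/funext => x; rewrite /= /avg ExE //; exact: mom_section abF.
  apply: (measurable_fun_fubini_tonelli_F (m2 := mu k)
    (fun p : coords K R * R => (F (upd k p.1 p.2))%:E)) => //.
    apply/measurable_EFinP.
    by apply: measurableT_comp (measurable_upd k); case: abF.
  by move=> p; rewrite lee_fin (le_trans a0) //; have /andP[] := abF.2 (upd k p.1 p.2).
move=> x; have mF := mom_section k x a0 abF.
rewrite -(Ex_cst (mu k) a) -(Ex_cst (mu k) b) /avg; apply/andP; split;
  apply: Ex_le => //; try exact: mom_cst.
  by move=> v; have /andP[] := abF.2 (upd k x v).
by move=> v; have /andP[] := abF.2 (upd k x v).
Qed.

Lemma avg_upd k F x v : avg k F (upd k x v) = avg k F x.
Proof. by rewrite /avg; apply: eq_Ex => u; rewrite upd_upd. Qed.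

(** When [s] enumerates all of [K] the hypothesis is empty, so the full average is a constant. *)
Lemma foldr_avg_eq F (s : seq K) x y : (forall k, k \notin s -> x k = y k) ->
  foldr avg F s x = foldr avg F s y.
Proof.
elim: s x y => [|k s IH] x y xy /=.
  by congr F; apply/funext => k; exact: xy.
apply: eq_Ex => v; apply: IH => j js.
by rewrite /upd; case: eqP => // /eqP jk; apply: xy; rewrite inE negb_or jk.
Qed.

Lemma between_foldr_avg a b F s : 0 <= a -> between a b F ->
  between a b (foldr avg F s).
Proof. by move=> a0 abF; elim: s => //= k s IH; exact: between_avg. Qed.

End integrate_out.

Section tensorisation.
Context d (T : measurableType d) (R : realType) (P : probability T R).
Context (K : finType) (mu : K -> probability R R).
Variable xi : T -> coords K R.
Hypothesis mxi : forall k, measurable_fun setT (fun w => xi w k).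
Hypothesis Pxi : indep_coords P mu xi.

Lemma mom_coords (F : coords K R -> R) b : measurable_fun setT F ->
  (forall x, `|F x| <= b) -> mom P (fun w => F (xi w)).
Proof.
move=> mF Fb; apply: (@mom_bounded _ _ _ _ _ b) => [|w]; last exact: Fb.
exact: measurableT_comp mF (measurable_coords mxi).
Qed.

Lemma mom_between a b (F : coords K R -> R) : 0 <= a -> between a b F ->
  mom P (fun w => F (xi w)).
Proof.
move=> a0 abF; apply: (mom_coords (b := b)); first by case: abF.
by move=> x; exact: between_norm abF.
Qed.

Lemma Ex_avg a b k (F : coords K R -> R) : 0 <= a -> between a b F ->
  Ex P (fun w => avg mu k F (xi w)) = Ex P (fun w => F (xi w)).
Proof.
move=> a0 abF; apply/EFin_inj.
have abI := between_avg mu k a0 abF.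
rewrite -!ExE; [|exact: mom_between abF|exact: mom_between abI].
rewrite (resampling mxi Pxi k (F := fun x => (F x)%:E)).
- by apply: eq_integral => w _; rewrite ExE //; exact: mom_section abF.
- by apply/measurable_EFinP; case: abF.
- by move=> x; rewrite lee_fin (le_trans a0) //; have /andP[] := abF.2 x.
Qed.

Lemma Ex_foldr_avg a b (F : coords K R -> R) s : 0 <= a -> between a b F ->
  Ex P (fun w => foldr (avg mu) F s (xi w)) = Ex P (fun w => F (xi w)).
Proof.
move=> a0 abF; elim: s => //= k s <-.
exact: (Ex_avg k a0 (between_foldr_avg mu s a0 abF)).
Qed.

Variables (e M : R).
Hypothesis e0 : 0 < e.

Lemma between_mul a b a' b' (F G : coords K R -> R) : 0 <= a -> 0 <= a' ->
  between a b F -> between a' b' G -> between (a * a') (b * b') (fun x => F x * G x).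
Proof.
move=> a0 a'0 [mF hF] [mG hG]; split; first exact: measurable_funM.
move=> x; have /andP[? ?] := hF x; have /andP[? ?] := hG x.
by rewrite !ler_pM //; [exact: (le_trans a0)|exact: (le_trans a'0)].
Qed.

Lemma between_pos (F : coords K R -> R) x : between e M F -> 0 < F x.
Proof. by move=> [_ /(_ x)/andP[h _]]; exact: lt_le_trans h. Qed.

Lemma between_inv (F : coords K R -> R) :
  between e M F -> between M^-1 e^-1 (fun x => (F x)^-1).
Proof.
move=> eF; split.
  rewrite (_ : (fun _ => _) = fun x => expR (- ln (F x))); last first.
    by apply/funext => x; rewrite expRN lnK // posrE; exact: between_pos eF.
  apply: measurableT_comp; first exact: measurable_expR.
  apply: measurable_funN; apply: measurableT_comp; first exact: measurable_ln.
  by case: eF.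
move=> x; have := between_pos x eF; have /andP[h1 h2] := eF.2 x => h.
by rewrite !lef_pV2 ?posrE ?h1 ?h2 //; exact: lt_le_trans h2.
Qed.

Lemma mom_ln (F : coords K R -> R) : between e M F ->
  mom P (fun w => ln (F (xi w))).
Proof.
move=> eF; apply: (mom_coords (F := fun x => ln (F x)) (b := `|ln e| + `|ln M|)).
  by apply: measurableT_comp; [exact: measurable_ln|case: eF].
move=> x; have F0 := between_pos x eF; have /andP[h1 h2] := eF.2 x.
have l1 : ln e <= ln (F x) by rewrite ler_ln ?posrE.
have l2 : ln (F x) <= ln M by rewrite ler_ln ?posrE // (lt_le_trans F0).
rewrite ler_norml; apply/andP; split.
  by have := normr_ge0 (ln M); have := ler_norm (- ln e); rewrite normrN; lra.
by have := normr_ge0 (ln e); have := ler_norm (ln M); lra.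
Qed.

Lemma mom_ent_fun (F G : coords K R -> R) : between e M F -> between e M G ->
  mom P (fun w => ent_fun (F (xi w)) (G (xi w))).
Proof.
move=> eF eG.
have mF := mom_between (ltW e0) eF; have mG := mom_between (ltW e0) eG.
apply: (mom_ext (X := fun w => F (xi w) * (ln (F (xi w)) - ln (G (xi w)))
    - F (xi w) + G (xi w))).
  move=> w; rewrite /ent_fun ln_div ?posrE //; exact: between_pos.
have := mom_ln eF; have := mom_ln eG => mlF mlG.
by mom.
Qed.

(** Duality with [u = ln (G / avg G)] bounds the left integrand by [ent_fun g a + a G / avg G - a].
    As [a] ignores coordinate [k], averaging over it turns [a G / avg G] into [a], and the last two
    terms cancel in expectation. *)
Lemma tensorisation_step k (g G a : coords K R -> R) :
  between e M g -> between e M G -> between e M a ->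
  (forall x v, a (upd k x v) = a x) ->
  Ex P (fun w => g (xi w) * (ln (G (xi w)) - ln (avg mu k G (xi w)))) <=
  Ex P (fun w => ent_fun (g (xi w)) (a (xi w))).
Proof.
move=> eg eG ea ak; have e0' := ltW e0.
have eI := between_avg mu k e0' eG.
pose r x := a x * (G x * (avg mu k G x)^-1).
have M0 : 0 <= M.
  have /andP[h1 h2] := eg.2 (fun=> 0); exact: (le_trans (le_trans e0' h1) h2).
have br : between (e * (e * M^-1)) (M * (M * e^-1)) r.
  apply: between_mul => //; first by rewrite mulr_ge0 ?invr_ge0.
  by apply: between_mul; rewrite ?invr_ge0 //; exact: between_inv.
have er0 : 0 <= e * (e * M^-1) by rewrite !mulr_ge0 ?invr_ge0.
have Er : Ex P (fun w => r (xi w)) = Ex P (fun w => a (xi w)).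
  rewrite -(Ex_avg k er0 br); apply: eq_Ex => w; rewrite /avg /r.
  under [LHS]eq_Ex do rewrite ak avg_upd mulrA mulrC mulrA.
  rewrite ExZ; last exact: mom_section eG.
  rewrite mulrAC -/(avg mu k G (xi w)) mulVf ?mul1r // gt_eqF //.
  exact: between_pos eI.
have mg := mom_between e0' eg; have ma := mom_between e0' ea.
have mr := mom_between er0 br.
have me := mom_ent_fun eg ea.
have mlG := mom_ln eG; have mlI := mom_ln eI.
have -> : Ex P (fun w => ent_fun (g (xi w)) (a (xi w))) =
    Ex P (fun w => ent_fun (g (xi w)) (a (xi w)) + r (xi w) - a (xi w)).
  by rewrite (ExB (momD me mr) ma) (ExD me mr) Er addrK.
apply: Ex_le; [by mom|by mom|move=> w].
have gp := between_pos (xi w) eg; have ap := between_pos (xi w) ea.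
have Gp := between_pos (xi w) eG; have Ip := between_pos (xi w) eI.
apply: (le_trans (ent_fun_dual _ gp ap)).
by rewrite /r expRB !lnK ?posrE.
Qed.

(* [a k] stands for any function of the other coordinates: the conditional mean
   given those would minimise the right-hand side. *)
Lemma entropy_tensorisation (g : coords K R -> R) (a : K -> coords K R -> R) :
  between e M g -> (forall k, between e M (a k)) ->
  (forall k x v, a k (upd k x v) = a k x) ->
  Ex P (fun w => g (xi w) * ln (g (xi w)))
    - Ex P (fun w => g (xi w)) * ln (Ex P (fun w => g (xi w))) <=
  \sum_k Ex P (fun w => ent_fun (g (xi w)) (a k (xi w))).
Proof.
move=> eg ea ak; have e0' := ltW e0.
set m := Ex P (fun w => g (xi w)).
pose G s := foldr (avg mu) g s.
have eG s : between e M (G s) := between_foldr_avg mu s e0' eg.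
have mg := mom_between e0' eg.
have mlG s := mom_ln (eG s).
(* Telescoping: averaging one more coordinate replaces [ln (G s)] by [ln (G (k :: s))], and each
   difference is one [tensorisation_step]. *)
have key s : Ex P (fun w => g (xi w) * (ln (g (xi w)) - ln (G s (xi w)))) <=
    \sum_(k <- s) Ex P (fun w => ent_fun (g (xi w)) (a k (xi w))).
  elim: s => [|k s IH].
    rewrite big_nil (eq_Ex _ (Y := cst 0)) ?Ex_cst // => w.
    by rewrite /G /= subrr mulr0.
  rewrite big_cons addrC.
  have := lerD IH (tensorisation_step eg (eG s) (ea k) (ak k)).
  have mlg := mlG [::]; rewrite /G /= in mlg.
  have mks := mlG (k :: s); have ms := mlG s; rewrite /= in mks.
  have mA : mom P (fun w => g (xi w) * (ln (g (xi w)) - ln (G s (xi w)))) by mom.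
  have mB : mom P (fun w =>
    g (xi w) * (ln (G s (xi w)) - ln (avg mu k (G s) (xi w)))) by mom.
  rewrite -(ExD mA mB).
  by apply: le_trans; rewrite le_eqVlt; apply/orP; left; apply/eqP;
    apply: eq_Ex => w; rewrite -mulrDr addrA subrK.
(* With all coordinates averaged out, the function is constant, hence equal to its own expectation,
   which is that of [g]. *)
have Gm x : G (enum K) x = m.
  rewrite /m -(Ex_foldr_avg (enum K) e0' eg) -[LHS](Ex_cst P).
  by apply: eq_Ex => w; apply: foldr_avg_eq => k; rewrite mem_enum.
have := key (enum K); rewrite big_enum /=; apply: le_trans.
have mlg := mlG [::]; rewrite /G /= in mlg.
rewrite [leRHS](eq_Ex _ (Y := fun w => g (xi w) * ln (g (xi w)) - ln m * g (xi w))); last first.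
  by move=> w; rewrite Gm mulrBr [ln m * _]mulrC.
have mgl : mom P (fun w => g (xi w) * ln (g (xi w))) by mom.
by rewrite (ExB mgl (momZ _ mg)) ExZ // [ln m * _]mulrC.
Qed.

End tensorisation.

(** * Differential calculus along lines for Schwartz functions *)

Section schwartz_calculus.
Context (R : realType) (n : nat).
Implicit Types (f g : 'rV[R]_n -> R) (x v : 'rV[R]_n).

(** The l^1 norm pairs with a bound on each single partial derivative, so no dimension factor enters
    the Lipschitz estimates. *)
Definition norm1 v : R := \sum_i `|v 0 i|.

Lemma norm1_ge0 v : 0 <= norm1 v.
Proof. exact: sumr_ge0. Qed.

(** The difference quotients along the line are those of [g] in direction [v]; linearity of the
    differential then splits [v] over the canonical basis. *)
Lemma is_derive_line g x v (t : R) : differentiable g (x + t *: v) ->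
  is_derive t 1 (fun s : R => g (x + s *: v)) (\sum_i v 0 i * partial i g (x + t *: v)).
Proof.
move=> dg.
have E : (fun k : R => k^-1 *: (((fun s : R => g (x + s *: v)) \o shift t) (k *: 1)
      - g (x + t *: v))) =
    (fun k : R => k^-1 *: ((g \o shift (x + t *: v)) (k *: v) - g (x + t *: v))).
  apply/funext => k /=; congr (_ *: (g _ - _)).
  have -> : k *: (1 : R) = k by rewrite /GRing.scale /= mulr1.
  by rewrite scalerDl addrCA.
have dv : derivable g (x + t *: v) v := diff_derivable dg.
have DE : 'D_1 (fun s : R => g (x + s *: v)) t = 'D_v g (x + t *: v).
  by rewrite /derive E.
apply: DeriveDef; first by rewrite /derivable E.
rewrite DE deriveE //; move: {E dv DE} (x + t *: v) dg => a dg.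
rewrite [in LHS](row_sum_delta v) linear_sum.
by apply: eq_bigr => i _; rewrite linearZ /partial deriveE.
Qed.

Lemma mvt_line g x v : (forall y, differentiable g y) ->
  exists2 t : R, 0 <= t <= 1 &
    g (x + v) - g x = \sum_i v 0 i * partial i g (x + t *: v).
Proof.
move=> dg.
have dl t := @is_derive_line g x v t (dg _).
have [|t] := @MVT_segment _ (fun s : R => g (x + s *: v)) _ 0 1 ler01
  (fun s _ => dl s).
  apply: derivable_within_continuous => s _; by have [] := dl s.
rewrite in_itv /= => t01; rewrite scale1r scale0r addr0 subr0 mulr1 => ->.
by exists t.
Qed.

Lemma norm1_mvt g (L : R) : (forall y, differentiable g y) ->
  (forall i y, `|partial i g y| <= L) ->
  forall x y, `|g y - g x| <= L * norm1 (y - x).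
Proof.
move=> dg gL x y.
have [t _] := mvt_line x (y - x) dg.
rewrite (addrC x) subrK => ->.
rewrite (le_trans (ler_norm_sum _ _ _)) // mulr_sumr ler_sum // => i _.
by rewrite normrM mulrC ler_wpM2r.
Qed.

Lemma schwartz_iter_bounded f s : schwartz f ->
  exists2 C : R, 0 <= C & forall x, `|iter_partial s f x| <= C.
Proof.
move=> [_ /(_ (fun=> 0%N) s)[C hC]]; exists C.
  exact: le_trans (hC 0).
move=> x; have := hC x.
by rewrite big1 ?mul1r // => i _; rewrite expr0.
Qed.

Lemma schwartz_bounds f : schwartz f -> exists2 L : R, 1 <= L &
  [/\ forall x, `|f x| <= L,
      forall i x, `|partial i f x| <= L &
      forall i j x, `|partial i (partial j f) x| <= L].
Proof.
move=> hf.
have [C0 C00 h0] := schwartz_iter_bounded [::] hf.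
have /choice[C1 h1] : forall i : 'I_n, exists C : R,
    0 <= C /\ forall x, `|partial i f x| <= C.
  by move=> i; have [C ? ?] := schwartz_iter_bounded [:: i] hf; exists C.
have /choice[C2 h2] : forall p : 'I_n * 'I_n, exists C : R,
    0 <= C /\ forall x, `|partial p.1 (partial p.2 f) x| <= C.
  by move=> p; have [C ? ?] := schwartz_iter_bounded [:: p.1; p.2] hf; exists C.
have s1 : 0 <= \sum_i C1 i by apply: sumr_ge0 => i _; case: (h1 i).
have s2 : 0 <= \sum_p C2 p by apply: sumr_ge0 => i _; case: (h2 i).
exists (1 + C0 + \sum_i C1 i + \sum_p C2 p); first by lra.
have l1 i : C1 i <= \sum_i C1 i.
  rewrite (bigD1 i) //= lerDl sumr_ge0 // => j _; by case: (h1 j).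
have l2 i : C2 i <= \sum_p C2 p.
  rewrite (bigD1 i) //= lerDl sumr_ge0 // => j _; by case: (h2 j).
split.
- by move=> x; have := h0 x; rewrite /=; lra.
- by move=> i x; have [_ /(_ x)] := h1 i; have := l1 i; lra.
- by move=> i j x; have [_ /(_ x)] := h2 (i, j); have := l2 (i, j); rewrite /=; lra.
Qed.

Lemma schwartz_differentiable f x : schwartz f -> differentiable f x.
Proof. by move=> [/(_ [::] x)]. Qed.

Lemma schwartz_differentiable1 f i x : schwartz f -> differentiable (partial i f) x.
Proof. by move=> [/(_ [:: i] x)]. Qed.

(** The differential of [f] at [x] applied to [v], written out so that its linearity in [v] and its
    link to the partial derivatives of the theorem are immediate. *)
Definition dirder f x v : R := \sum_i v 0 i * partial i f x.

Section bounds.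
Variables (f : 'rV[R]_n -> R) (L : R).
Hypothesis hf : schwartz f.
Hypothesis f1 : forall i x, `|partial i f x| <= L.
Hypothesis f2 : forall i j x, `|partial i (partial j f) x| <= L.

Lemma lip_f x y : `|f y - f x| <= L * norm1 (y - x).
Proof. by apply: norm1_mvt => // z; exact: schwartz_differentiable. Qed.

Lemma lip_partial i x y : `|partial i f y - partial i f x| <= L * norm1 (y - x).
Proof. by apply: norm1_mvt => // z; exact: schwartz_differentiable1. Qed.

Lemma dirder_le x v : `|dirder f x v| <= L * norm1 v.
Proof.
rewrite (le_trans (ler_norm_sum _ _ _)) // mulr_sumr ler_sum // => i _.
by rewrite normrM mulrC ler_wpM2r.
Qed.

Lemma dirder_lip x y v : `|dirder f y v - dirder f x v| <= L * norm1 (y - x) * norm1 v.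
Proof.
rewrite /dirder -sumrB (le_trans (ler_norm_sum _ _ _)) //.
rewrite [norm1 v]/norm1 mulr_sumr ler_sum // => i _.
by rewrite -mulrBr normrM mulrC ler_wpM2r // lip_partial.
Qed.

Lemma norm1Z (t : R) v : norm1 (t *: v) = `|t| * norm1 v.
Proof.
by rewrite /norm1 mulr_sumr; apply: eq_bigr => i _; rewrite mxE normrM.
Qed.

(** The mean value theorem along the segment, then the Lipschitz bound on the gradient at the
    intermediate point. *)
Lemma taylor2 x v (s : R) :
  `|f (x + s *: v) - f x - s * dirder f x v| <= L * s ^+ 2 * norm1 v ^+ 2.
Proof.
have [t /andP[t0 t1]] := mvt_line x (s *: v) (fun y => schwartz_differentiable y hf).
rewrite scalerA => ->.
have -> : \sum_i (s *: v) 0 i * partial i f (x + (t * s) *: v) =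
    s * dirder f (x + (t * s) *: v) v.
  by rewrite /dirder mulr_sumr; apply: eq_bigr => i _; rewrite mxE mulrA.
rewrite -mulrBr normrM.
have L0 : 0 <= L * norm1 v by rewrite (le_trans _ (dirder_le x v)).
apply: (@le_trans _ _ (`|s| * (L * (`|t * s| * norm1 v) * norm1 v))).
  rewrite ler_wpM2l // -norm1Z.
  by have := dirder_lip x (x + (t * s) *: v) v; rewrite [in norm1 _](addrC x) addrK.
rewrite normrM (ger0_norm t0) -[s ^+ 2]real_normK ?num_real //.
have -> : `|s| * (L * (t * `|s| * norm1 v) * norm1 v) =
  t * ((L * norm1 v) * norm1 v * `|s| ^+ 2) by ring.
have -> : L * `|s| ^+ 2 * norm1 v ^+ 2 = (L * norm1 v) * norm1 v * `|s| ^+ 2 by ring.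
rewrite ler_piMl //; apply: mulr_ge0; last exact: exprn_ge0.
by apply: mulr_ge0 => //; exact: norm1_ge0.
Qed.

End bounds.

Lemma continuous_measurable_rV f : continuous f ->
  measurable_fun setT (f : borel_rV R n -> R).
Proof.
move=> cf; apply: (measurability _ (RGenOpens.measurableE R)) => //.
move=> _ [_ [a [b ->] <-]]; rewrite setTI; apply: sub_sigma_algebra.
by move/continuousP : cf; apply; exact: interval_open.
Qed.

Lemma schwartz_measurable f : schwartz f -> measurable_fun setT (f : borel_rV R n -> R).
Proof.
by move=> hf; apply: continuous_measurable_rV => x;
  exact/differentiable_continuous/schwartz_differentiable.
Qed.

Lemma schwartz_measurable1 f i : schwartz f ->
  measurable_fun setT (partial i f : borel_rV R n -> R).
Proof.
by move=> hf; apply: continuous_measurable_rV => x;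
  exact/differentiable_continuous/schwartz_differentiable1.
Qed.

End schwartz_calculus.

(** * Exponential remainders, and moments of the centred normal law *)

Section exp_remainder.
Context (R : realType).

(** Each remainder of the exponential series has the previous one as derivative; the mean value
    theorem gains one power of [y], at the price of the factorials. *)
Lemma mvt_exp_bound (F G : R -> R) k : F 0 = 0 ->
  (forall y : R, is_derive y 1 F (G y)) ->
  (forall y, `|G y| <= `|y| ^+ k * expR `|y|) ->
  forall y, `|F y| <= `|y| ^+ k.+1 * expR `|y|.
Proof.
move=> F0 dF hG y.
have cF : continuous F.
  move=> x; apply: differentiable_continuous; apply/derivable1_diffP.
  by have [] := dF x.
have [c cy ->] : exists2 c : R, `|c| <= `|y| & F y = G c * y.
  have [y0|y0] := leP 0 y.
    have [|c] := @MVT_segment _ F G 0 y y0 (fun x _ => dF x).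
      exact: continuous_subspaceT.
    rewrite in_itv /= F0 !subr0 => /andP[c0 cy] ->; exists c => //.
    by rewrite !ger0_norm.
  have [|c] := @MVT_segment _ F G y 0 (ltW y0) (fun x _ => dF x).
    exact: continuous_subspaceT.
  rewrite in_itv /= F0 !sub0r => /andP[yc c0] h; exists c.
    by rewrite !ler0_norm ?lerN2 // ltW.
  by rewrite -[F y]opprK h mulrN opprK.
rewrite normrM exprS mulrC -mulrA ler_wpM2l //.
apply: (le_trans (hG c)).
rewrite ler_pM ?exprn_ge0 ?expR_ge0 ?ler_expR //.
by rewrite lerXn2r ?nnegrE.
Qed.

Lemma expR_remainder0 (y : R) : `|expR y - 1| <= `|y| * expR `|y|.
Proof.
rewrite -[X in _ <= X * _]expr1.
apply: (@mvt_exp_bound (fun y => expR y - 1) expR 0%N); first by rewrite expR0 subrr.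
  by move=> x; apply: is_derive_eq; rewrite subr0.
by move=> x; rewrite expr0 mul1r ger0_norm ?expR_ge0 // ler_expR ler_norm.
Qed.

Lemma expR_remainder1 (y : R) : `|expR y - 1 - y| <= `|y| ^+ 2 * expR `|y|.
Proof.
apply: (@mvt_exp_bound (fun y => expR y - 1 - y) (fun y => expR y - 1) 1%N).
- by rewrite expR0 !subrr.
- by move=> x; apply: is_derive_eq; rewrite subr0.
- by move=> x; rewrite expr1; exact: expR_remainder0.
Qed.

Lemma expR_remainder2 (y : R) :
  `|expR y - 1 - y - y ^+ 2 / 2| <= `|y| ^+ 3 * expR `|y|.
Proof.
apply: (@mvt_exp_bound (fun y => expR y - 1 - y - y ^+ 2 / 2)
  (fun y => expR y - 1 - y) 2%N).
- by rewrite expR0 expr0n /= mul0r !subrr.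
- by move=> x; apply: is_derive_eq; rewrite subr0 /GRing.scale /=; field.
- exact: expR_remainder1.
Qed.

Lemma expR_norm_le (y : R) : expR `|y| <= expR y + expR (- y).
Proof.
by case: (ger0P y) => _; rewrite ?lerDl ?lerDr expR_ge0.
Qed.

Lemma eq0_linear_bound (z C : R) : (forall a, 0 < a <= 1 -> `|z| <= C * a) -> z = 0.
Proof.
move=> h; apply/eqP; rewrite -normr_le0 leNgt; apply/negP => z0.
have C0 : 0 < C.
  have := h 1; rewrite ltr01 lexx mulr1 => /(_ isT); exact: lt_le_trans.
(* Chosen so that [C * a] is at most half the absolute value of [z], which contradicts the bound. *)
pose a := Num.min 1 (`|z| / (2 * C)).
have := h a; rewrite lt_min ltr01 divr_gt0 ?mulr_gt0 // ge_min lexx => /(_ isT).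
have : C * a <= C * (`|z| / (2 * C)) by rewrite ler_pM2l // ge_min lexx orbT.
have -> : C * (`|z| / (2 * C)) = `|z| / 2 by field; rewrite gt_eqF.
by move: z0; set w := `|z|; lra.
Qed.

End exp_remainder.

Section gaussian_moments.
Context (R : realType) (s : R).
Hypothesis s0 : 0 < s.
Local Notation gauss := (normal_prob 0 s).
Local Notation leb := (@lebesgue_measure R).

(** The Radon-Nikodym derivative of the normal law and [normal_pdf] have the same integral over
    every measurable set, hence agree almost everywhere. *)
Lemma ge0_integral_normal (g : R -> \bar R) :
  measurable_fun setT g -> (forall x, (0 <= g x)%E) ->
  (\int[gauss]_x g x = \int[leb]_x (g x * (normal_pdf 0 s x)%:E))%E.
Proof.
move=> mg g0.
have dom := normal_prob_dominates 0 s.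
rewrite -(Radon_Nikodym_SigmaFinite.change_of_variables dom) //.
apply: ae_eq_integral => //.
- apply: emeasurable_funM => //.
  exact: measurable_int (Radon_Nikodym_SigmaFinite.f_integrable _).
- by apply: emeasurable_funM => //; apply/measurable_EFinP; exact: measurable_normal_pdf.
- apply: ae_eqe_mul2l; apply: integral_ae_eq => //.
  + exact: Radon_Nikodym_SigmaFinite.f_integrable.
  + by apply/measurable_EFinP; exact: measurable_normal_pdf.
  + by move=> A _ mA; rewrite -Radon_Nikodym_SigmaFinite.f_integral.
Qed.

Lemma normal_mgf (a : R) :
  (\int[gauss]_x (expR (a * x))%:E = (expR (a ^+ 2 * s ^+ 2 / 2))%:E)%E.
Proof.
have sn0 : s != 0 by rewrite gt_eqF.
rewrite ge0_integral_normal; last 2 first.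
- apply/measurable_EFinP; apply: measurableT_comp; first exact: measurable_expR.
  exact: measurable_funM.
- by move=> x; rewrite lee_fin expR_ge0.
(* Completing the square: the tilt by [expR (a * x)] moves the mean to [a s^2] and leaves a constant
   factor. *)
have E x : ((expR (a * x))%:E * (normal_pdf 0 s x)%:E =
   (expR (a ^+ 2 * s ^+ 2 / 2))%:E * (normal_pdf (a * s ^+ 2) s x)%:E)%E.
  rewrite -!EFinM; congr (_ %:E).
  rewrite !normal_pdfE // mulrCA [RHS]mulrCA; congr (_ * _).
  rewrite /normal_fun -!expRD; congr expR.
  by rewrite -mulr_natr; field.
under eq_integral do rewrite E.
rewrite ge0_integralZl_EFin ?expR_ge0 //.
- by rewrite integral_normal_pdf mule1.
- by move=> x _; rewrite lee_fin normal_pdf_ge0.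
- by apply/measurable_EFinP; exact: measurable_normal_pdf.
Qed.

Lemma mom_expR (a : R) : mom gauss (fun x => expR (a * x)).
Proof.
split.
  by apply: measurableT_comp; [exact: measurable_expR|exact: measurable_funM].
move=> k; under eq_integral.
  move=> x _; rewrite ger0_norm ?expR_ge0 // -expRM_natl mulrA; over.
by rewrite normal_mgf ltry.
Qed.

Lemma mom_expR_norm : mom gauss (fun x => expR `|x|).
Proof.
split.
  by apply: measurableT_comp; [exact: measurable_expR|exact: normr_measurable].
move=> k; under eq_integral do rewrite -normrX.
apply: (@mom_dom _ _ _ gauss bool (fun=> 2 ^+ k)
  (fun b => if b then (fun x => expR (1 * x)) else (fun x => expR (-1 * x))) (fun=> k)).
- apply: measurable_funX.
  by apply: measurableT_comp; [exact: measurable_expR|exact: normr_measurable].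
- by move=> _; rewrite exprn_ge0.
- by case; exact: mom_expR.
- move=> x; rewrite big_bool /= normrX mul1r mulN1r.
  rewrite !(ger0_norm (expR_ge0 _)).
  apply: le_trans (exprD_le _ _ _); rewrite ?expR_ge0 //.
  by rewrite lerXn2r ?nnegrE ?addr_ge0 ?expR_ge0 // expR_norm_le.
Qed.

Lemma normr_expn_le (x : R) k : `|x| ^+ k <= k`!%:R * expR `|x|.
Proof.
case: k => [|k].
  by rewrite expr0 fact0 mul1r -expR0 ler_expR.
have := @expR_ge1Dxn R `|x| k (normr_ge0 x).
have k0 : 0 < (k.+1)`!%:R :> R by rewrite ltr0n fact_gt0.
move=> h; have : `|x| ^+ k.+1 / (k.+1)`!%:R <= expR `|x| by lra.
by rewrite ler_pdivrMr // mulrC.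
Qed.

Lemma mom_normal : mom gauss id.
Proof.
split=> // k.
under eq_integral do rewrite /id -normrX.
apply: (@mom_dom _ _ _ gauss unit (fun=> k`!%:R) (fun=> fun x => expR `|x|) (fun=> 1%N)).
- exact: measurable_funX.
- by move=> _; rewrite ler0n.
- by move=> _; exact: mom_expR_norm.
- move=> x; rewrite big_const card_unit /= addr0 expr1 normrX.
  by rewrite (ger0_norm (expR_ge0 _)); exact: normr_expn_le.
Qed.

Let Ex_exp (a : R) : Ex gauss (fun x => expR (a * x)) = expR (a ^+ 2 * s ^+ 2 / 2).
Proof. by rewrite /Ex normal_mgf. Qed.

Let C3 := Ex gauss (fun x => `|x| ^+ 3 * expR `|x|).
Let C := C3 + s ^+ 4 * expR (s ^+ 2).
Let m1 := Ex gauss id.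
Let m2 := Ex gauss (fun x => x ^+ 2).

(* The first two moments are read off the expansion at [a = 0] of the moment
   generating function [a |-> expR (a ^+ 2 * s ^+ 2 / 2)]. *)
Let expansion (a : R) : `|a| <= 1 ->
  `|a * m1 + a ^+ 2 * ((m2 - s ^+ 2) / 2)| <= C * `|a| ^+ 3.
Proof.
move=> a1.
have mI := mom_normal; have mE := mom_expR a; have mN := mom_expR_norm.
have mI2 : mom gauss (fun x => x ^+ 2) by exact: momX.
(* Its expectation compares the generating function with the first two moments of the law; pointwise
   it is a third-order exponential remainder. *)
pose r x := expR (a * x) - 1 - a * x - a ^+ 2 / 2 * x ^+ 2.
have mr : mom gauss r by rewrite /r; mom.
have Er : Ex gauss r = expR (a ^+ 2 * s ^+ 2 / 2) - 1 - a * m1 - a ^+ 2 / 2 * m2.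
  have mc : mom gauss (fun=> 1) by exact: mom_cst.
  have h1 := momB mE mc; have h2 := momB h1 (momZ a mI).
  rewrite /r (ExB h2 (momZ _ mI2)) (ExB h1 (momZ a mI)) (ExB mE mc).
  by rewrite Ex_exp (Ex_cst _ 1) !ExZ.
have mb : mom gauss (fun x => `|a| ^+ 3 * (`|x| ^+ 3 * expR `|x|)) by mom.
have rb : `|Ex gauss r| <= `|a| ^+ 3 * C3.
  have rx x : `|r x| <= `|a| ^+ 3 * (`|x| ^+ 3 * expR `|x|).
    have -> : r x = expR (a * x) - 1 - a * x - (a * x) ^+ 2 / 2 by rewrite /r; field.
    apply: (le_trans (expR_remainder2 _)); rewrite normrM exprMn -mulrA.
    rewrite ler_wpM2l ?exprn_ge0 // ler_wpM2l ?exprn_ge0 // ler_expR.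
    by rewrite ler_piMl.
  rewrite -ExZ; last by mom.
  rewrite ler_norml; apply/andP; split.
    rewrite -ExN //; apply: Ex_le => //; first exact: momN.
    by move=> x; have := rx x; rewrite ler_norml => /andP[].
  by apply: Ex_le => // x; have := rx x; rewrite ler_norml => /andP[].
(* The exponent of the generating function: [expR u] is [1 + u] up to [u^2 expR u], an error of
   order [a^4]. *)
pose u := a ^+ 2 * s ^+ 2 / 2.
have u0 : 0 <= u by rewrite /u divr_ge0 // mulr_ge0 ?sqr_ge0.
have a2 : `|a| ^+ 2 = a ^+ 2 by rewrite real_normK ?num_real.
have a21 : a ^+ 2 <= 1 by rewrite -a2 exprn_ile1.
have us : u <= s ^+ 2.
  by rewrite /u; have := sqr_ge0 s; nra.
have := expR_remainder1 u; rewrite (ger0_norm u0) => hu.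
have hu2 : u ^+ 2 * expR u <= `|a| ^+ 3 * (s ^+ 4 * expR (s ^+ 2)).
  rewrite mulrA ler_pM ?expR_ge0 ?sqr_ge0 ?ler_expR //.
  have -> : u ^+ 2 = `|a| ^+ 3 * (`|a| * (s ^+ 4 / 4)).
    have -> : `|a| ^+ 3 * (`|a| * (s ^+ 4 / 4)) = (`|a| ^+ 2) ^+ 2 * (s ^+ 4 / 4) by field.
    by rewrite a2 /u; field.
  rewrite ler_wpM2l ?exprn_ge0 //.
  have : 0 <= s ^+ 4 by rewrite exprn_ge0 // ltW.
  by move: (`|a|) (normr_ge0 a) a1 => b b0 b1; nra.
have -> : a * m1 + a ^+ 2 * ((m2 - s ^+ 2) / 2) =
  (expR u - 1 - u) - Ex gauss r by rewrite Er /u; field.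
rewrite (le_trans (ler_normB _ _)) // /C.
by move: rb hu hu2; lra.
Qed.

(** Subtracting the expansions at [a] and [- a] removes the even term and bounds [a * m1] by
    [C a^3]. *)
Lemma normal_mean : Ex gauss id = 0.
Proof.
apply: (@eq0_linear_bound _ _ C) => a /andP[a0 a1].
have p : `|a| <= 1 by rewrite gtr0_norm.
have pN : `|- a| <= 1 by rewrite normrN.
have := expansion p; have := expansion pN; rewrite !normrN (gtr0_norm a0) sqrrN.
rewrite -/m1 => h1 h2.
have : `|a * m1| <= C * a ^+ 3.
  move: h1 h2; set z := a ^+ 2 * _; rewrite !ler_norml => /andP[? ?] /andP[? ?].
  by apply/andP; split; lra.
rewrite normrM (gtr0_norm a0).
have -> : C * a ^+ 3 = a * (C * a ^+ 2) by ring.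
rewrite ler_pM2l // => /le_trans; apply.
have C0 : 0 <= C.
  rewrite /C addr_ge0 ?mulr_ge0 ?expR_ge0 ?exprn_ge0 ?(ltW s0) //.
  by apply: Ex_ge0 => x; rewrite mulr_ge0 ?exprn_ge0 ?expR_ge0.
by rewrite ler_wpM2l //; nra.
Qed.

Lemma normal_second_moment : Ex gauss (fun x => x ^+ 2) = s ^+ 2.
Proof.
apply/eqP; rewrite -subr_eq0; apply/eqP.
apply: (@eq0_linear_bound _ _ (2 * C)) => a /andP[a0 a1].
have p : `|a| <= 1 by rewrite gtr0_norm.
have := expansion p; rewrite -/m2 /m1 normal_mean mulr0 add0r normrM.
rewrite (gtr0_norm a0) (ger0_norm (sqr_ge0 a)).
have -> : C * a ^+ 3 = a ^+ 2 * (C * a) by ring.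
rewrite ler_pM2l ?exprn_gt0 // normrM [`|2^-1|]ger0_norm ?invr_ge0 //.
by move: `|_| => z; lra.
Qed.

(** From [y^4 <= 24 expR |y|] at [y = x / s] and the generating function at plus and minus [1 / s];
    48 is twice 24, and [expR (1 / 2)] is rounded up to [expR 1]. *)
Lemma normal_fourth_moment : Ex gauss (fun x => x ^+ 4) <= 48 * expR 1 * s ^+ 4.
Proof.
have mE1 := mom_expR s^-1; have mE2 := mom_expR (- s^-1).
have mI4 : mom gauss (fun x => x ^+ 4) by apply: momX; exact: mom_normal.
have sn0 : s != 0 by rewrite gt_eqF.
apply: (@le_trans _ _
  (Ex gauss (fun x => 24 * s ^+ 4 * (expR (s^-1 * x) + expR (- s^-1 * x))))).
  apply: Ex_le => //; first by mom.
  move=> x.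
  have h := normr_expn_le (s^-1 * x) 4.
  have h2 := expR_norm_le (s^-1 * x).
  have e4 : `|s^-1 * x| ^+ 4 = s ^- 4 * x ^+ 4.
    by rewrite -normrX ger0_norm; [rewrite exprMn exprVn|rewrite exprn_even_ge0].
  have -> : x ^+ 4 = s ^+ 4 * `|s^-1 * x| ^+ 4 by rewrite e4 mulVKf // expf_neq0.
  have -> : 24 * s ^+ 4 * (expR (s^-1 * x) + expR (- s^-1 * x)) =
    s ^+ 4 * (24 * (expR (s^-1 * x) + expR (- s^-1 * x))) by ring.
  rewrite ler_wpM2l ?exprn_ge0 ?(ltW s0) // mulNr.
  by move: h; rewrite (_ : 4`! = 24)%N //; lra.
rewrite ExZ; last by mom.
rewrite ExD // !Ex_exp sqrrN exprVn mulVf ?expf_neq0 //.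
have : expR (1 / 2) <= expR 1 :> R by rewrite ler_expR; lra.
have : 0 <= s ^+ 4 by rewrite exprn_ge0 // ltW.
by set A := expR _; set A' := expR _; nra.
Qed.

End gaussian_moments.

(** * Brownian increments over a grid as independent coordinates *)

Section brownian_grid.
Context disp (T : measurableType disp) (R : realType) (P : probability T R).
Context (d : nat) (X : R -> 'I_d -> {RV P >-> R}).
Hypothesis hX : standard_brownian_motion X.

Lemma sigma_of_bigcap (I : Type) (K : finType) (Y : I -> T -> R)
    (B : K -> set R) (y : K -> I) : (forall k, measurable (B k)) ->
  sigma_of Y (\bigcap_(k in [set: K]) (Y (y k) @^-1` B k)).
Proof.
move=> mB.
pose G := \bigcup_k preimage_set_system setT (Y k) measurable.
apply: (@fin_bigcap_measurable _ (g_sigma_algebraType G)) => // k _.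
apply: sub_sigma_algebra; exists (y k) => //; exists (B k); first exact: mB.
by rewrite setTI.
Qed.

Definition grid_increments n (t : nat -> R) (w : T) : 'I_n * 'I_d -> R :=
  fun k => X (t k.1.+1) k.2 w - X (t k.1) k.2 w.

Definition grid_law n (t : nat -> R) (k : 'I_n * 'I_d) : probability R R :=
  distribution P (X (t k.1.+1) k.2 \- X (t k.1) k.2 : {mfun T >-> R}).

Lemma measurable_increment s t p :
  measurable_fun setT (fun w => X t p w - X s p w).
Proof. by apply: measurable_funB; exact: measurable_funPT. Qed.

(** Two product formulas are composed: independence over time of the increment vectors, then
    independence of the components inside one time step. The second concerns non-degenerate steps,
    whence the strict inequality for [i < n]. *)
Lemma bm_indep_coords n (t : nat -> R) : 0 <= t 0%N ->
  {homo t : i j / (i <= j)%N >-> i <= j} ->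
  (forall i, (i < n)%N -> t i < t i.+1) ->
  indep_coords P (@grid_law n t) (@grid_increments n t).
Proof.
move=> t0 th ts B mB.
have tge0 i : 0 <= t i by rewrite (le_trans t0) // th.
pose A (i : 'I_n) : set T := \bigcap_(p in [set: 'I_d])
  ((X (t i.+1) p \- X (t i) p) @^-1` B (i, p)).
have -> : [set w | forall k, B k (grid_increments t w k)] =
    \bigcap_(i in [set` [set: 'I_n]%SET]) A i.
  apply/seteqP; split => w /=; first by move=> h i _ p _; exact: (h (i, p)).
  by move=> h [i p]; have := h i; rewrite /= finset.in_setT => /(_ isT p Logic.I).
rewrite (bm_independent_increments hX t0 th (n := n)); last first.
  move=> i _; apply: (@sigma_of_bigcap _ 'I_d _ (fun p => B (i, p)) id).
  by move=> p; exact: mB.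
rewrite (eq_bigl xpredT); last by move=> i; rewrite finset.in_setT.
transitivity (\prod_(i < n) \prod_(p < d) grid_law t (i, p) (B (i, p)))%E; last first.
  by rewrite pair_bigA; apply: eq_bigr => -[].
apply: eq_bigr => i _.
have := bm_independent_coordinates hX (tge0 i) (ts i (ltn_ord i)).
move=> /(_ [set: 'I_d]%SET (fun p => (X (t i.+1) p \- X (t i) p) @^-1` B (i, p))).
have -> : \bigcap_(p in [set` [set: 'I_d]%SET])
    ((X (t i.+1) p \- X (t i) p) @^-1` B (i, p)) = A i.
  apply/seteqP; split => w /= h p; first by move=> _; apply: h; rewrite /= finset.in_setT.
  by move=> _; exact: h.
move=> ->.
  apply: eq_big => p; first by rewrite finset.in_setT.
  by [].
move=> p _; have := @sigma_of_bigcap _ unit (fun _ : unit => X (t i.+1) p \- X (t i) p)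
  (fun=> B (i, p)) id (fun=> mB _).
rewrite (_ : \bigcap_(k in _) _ = (X (t i.+1) p \- X (t i) p) @^-1` B (i, p)) //.
by apply/seteqP; split => w /= h; [exact: (h tt)|move=> _ _].
Qed.

End brownian_grid.

(** * The natural filtration, and independence of an increment from the past *)

Section filtration.
Context disp (T : measurableType disp) (R : realType) (P : probability T R).
Context (d : nat) (X : R -> 'I_d -> {RV P >-> R}).

Definition past_events (c : R) : set (set T) :=
  \bigcup_(sp : {s : R | 0 <= s <= c} * 'I_d)
    preimage_set_system setT (X (sval sp.1) sp.2) measurable.

(** The space [T] with the sigma-algebra of the path up to time [c], so that adaptedness is
    measurability and inherits its closure properties. *)
Definition past (c : R) := g_sigma_algebraType (past_events c).

Definition adapted (c : R) (U : T -> R) := measurable_fun setT (U : past c -> R).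

Lemma adaptedP c U : adapted c U <->
  forall A, measurable A -> natural_filtration X c (U @^-1` A).
Proof.
split=> [mU A mA|h _ A mA]; last by rewrite setTI; exact: h.
by rewrite -[_ @^-1` _]setTI; exact: mU.
Qed.

Lemma past_preimage c s p B : 0 <= s <= c -> measurable B ->
  measurable (X s p @^-1` B : set (past c)).
Proof.
move=> sc mB; apply: sub_sigma_algebra.
pose sp : {s : R | 0 <= s <= c} * 'I_d := (exist _ s sc, p).
by refine (ex_intro2 _ _ sp Logic.I _); refine (ex_intro2 _ _ B mB _); rewrite setTI.
Qed.

Lemma adapted_X c s p : 0 <= s <= c -> adapted c (X s p).
Proof. by move=> sc _ A mA; rewrite setTI; exact: past_preimage. Qed.

Lemma past_sub c c' A : c <= c' -> measurable (A : set (past c)) ->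
  measurable (A : set (past c')).
Proof.
move=> cc'; apply: smallest_sub; first exact: (@sigma_algebra_measurable _ (past c')).
move=> _ [[[s sc] p] _ [B mB <-]]; rewrite setTI.
by apply: past_preimage => //=; case/andP: (sc) => -> /= h; exact: le_trans cc'.
Qed.

Lemma adapted_mono c c' U : c <= c' -> adapted c U -> adapted c' U.
Proof. by move=> cc' mU _ A mA; apply: (past_sub cc'); exact: mU. Qed.

Lemma past_measurable c A : measurable (A : set (past c)) -> @measurable _ T A.
Proof.
apply: smallest_sub; first exact: (@sigma_algebra_measurable _ T).
move=> _ [[[s sc] p] _ [B mB <-]].
have mX : measurable_fun setT (X s p) by exact: measurable_funPT.
exact: (mX measurableT B mB).
Qed.

Lemma adapted_measurable c U : adapted c U -> measurable_fun setT U.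
Proof. by move=> mU _ A mA; apply: (@past_measurable c); exact: mU. Qed.

Lemma adaptedM c U V : adapted c U -> adapted c V -> adapted c (fun w => U w * V w).
Proof. exact: measurable_funM. Qed.

Lemma adaptedB c U V : adapted c U -> adapted c V -> adapted c (fun w => U w - V w).
Proof. exact: measurable_funB. Qed.

Lemma adapted_cst c r : adapted c (cst r).
Proof. exact: measurable_cst. Qed.

(** A pi-system generating [past c]; each event involves finitely many times and can be read on the
    increments of a finite grid. *)
Definition cylinders (c : R) : set (set T) := [set A |
  exists2 s : seq (R * 'I_d), (forall k, k \in s -> 0 <= k.1 <= c) &
  exists2 B : R * 'I_d -> set R, (forall k, measurable (B k)) &
  A = [set w | forall k, k \in s -> B k (X k.1 k.2 w)]].

Lemma cylinders_setI c : setI_closed (cylinders c).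
Proof.
move=> _ _ [s sc [B mB ->]] [s' sc' [B' mB' ->]]; exists (s ++ s').
  by move=> k; rewrite mem_cat => /orP[/sc|/sc'].
exists (fun k => (if k \in s then B k else setT) `&` (if k \in s' then B' k else setT)).
  by move=> k; apply: measurableI; case: ifP.
apply/seteqP; split => w /=.
  by move=> [h h'] k _; split; case: ifP => // ?; [exact: h|exact: h'].
move=> h; split => k ks; have [] := h k; rewrite ?mem_cat ?ks ?orbT //.
Qed.

Lemma cylinders_setT c : cylinders c setT.
Proof.
exists [::] => //; exists (fun=> setT) => //.
by apply/seteqP; split.
Qed.

Lemma past_cylinders c : @measurable _ (past c) = <<s cylinders c >>.
Proof.
apply/seteqP; split; apply: smallest_sub; try exact: smallest_sigma_algebra.
  move=> _ [[[s sc] p] _ [B mB <-]]; apply: sub_sigma_algebra.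
  exists [:: (s, p)]; first by move=> k; rewrite inE => /eqP ->.
  exists (fun=> B) => //; rewrite setTI.
  apply/seteqP; split => w /=; first by move=> h k; rewrite inE => /eqP ->.
  by move/(_ (s, p)); rewrite inE eqxx; apply.
move=> _ [s sc [B mB ->]].
rewrite (_ : mkset _ = \bigcap_(k in [set` s]) (X k.1 k.2 @^-1` B k)); last first.
  by apply/seteqP; split => w /= h k; exact: h.
apply: (@fin_bigcap_measurable _ (past c)) => //.
move=> k /= /sc kc. Show. exact: past_preimage.
Qed.

End filtration.

Lemma sum_increments (V : zmodType) (F : nat -> V) n j : (j <= n)%N ->
  \sum_(i < n | (i < j)%N) (F i.+1 - F i) = F j - F 0%N.
Proof.
move=> jn; rewrite -(big_ord_widen_cond n xpredT (fun i => F i.+1 - F i)) //.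
by rewrite -(big_mkord xpredT (fun i => F i.+1 - F i)) telescope_sumr.
Qed.

Lemma measure_ae_iff d (T : measurableType d) (R : realType)
    (P : probability T R) (A B : set T) : measurable A -> measurable B ->
  {ae P, forall w, A w <-> B w} -> P A = P B.
Proof.
move=> mA mB [N [mN PN AB]].
have {}PN : P N = 0%E := PN.
have half C D : measurable C -> measurable D -> C `<=` D `|` N -> (P C <= P D)%E.
  move=> mC mD CD; apply: (@le_trans _ _ (P (D `|` N))).
    by apply: le_measure; rewrite ?inE //; exact: measurableU.
  have : (P (D `|` N) <= P D + P N)%E by exact: measureU2.
  by rewrite PN adde0.
have key w : ~ N w -> (A w <-> B w).
  by move=> Nw; apply: contrapT => h; apply: Nw; exact: AB.
apply/eqP; rewrite eq_le; apply/andP; split; apply: half => // w Cw.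
  by have [|/key[h _]] := pselect (N w); [right|left; exact: h].
by have [|/key[_ h]] := pselect (N w); [right|left; exact: h].
Qed.

Section past_independence.
Context disp (T : measurableType disp) (R : realType) (P : probability T R).
Context (d : nat) (X : R -> 'I_d -> {RV P >-> R}).
Hypothesis hX : standard_brownian_motion X.

Definition increment s t p : {mfun T >-> R} := X t p \- X s p.

Section cylinder.
Variables (c t : R) (p : 'I_d).
Hypotheses (c0 : 0 <= c) (ct : c < t).
Variables (s : seq (R * 'I_d)) (B : R * 'I_d -> set R).
Hypothesis sc : forall k, k \in s -> 0 <= k.1 <= c.
Hypothesis mB : forall k, measurable (B k).

(** The distinct times of the cylinder in increasing order, with 0 and [c] added: 0 comes first, and
    [c] last at index [n]. *)
Let r := sort <=%R (undup (0 :: c :: map fst s)).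
Let n := (size r).-1.
(** The default value matters: beyond index [n] it is [t], so that step [n] of this grid goes from
    [c] to [t]. *)
Let tt i := nth t r i.

Let mem_r x : (x \in r) = (x \in 0 :: c :: map fst s).
Proof. by rewrite mem_sort mem_undup. Qed.

Let r_bound x : x \in r -> 0 <= x <= c.
Proof.
rewrite mem_r !inE => /or3P[/eqP ->|/eqP ->|/mapP[k ks ->]]; last exact: sc.
  by rewrite lexx.
by rewrite c0 lexx.
Qed.

Let size_r : size r = n.+1.
Proof.
rewrite /n prednK //; have : 0 \in r by rewrite mem_r inE eqxx.
by case: (r).
Qed.

Let r_sorted : sorted <%R r.
Proof. by rewrite sort_lt_sorted undup_uniq. Qed.

Let tt_lt i j : (i < j)%N -> (j <= n)%N -> tt i < tt j.
Proof.
move=> ij jn; have := @lt_sorted_ltn_nth _ _ t r r_sorted i j.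
by rewrite !inE size_r ltnS (leq_trans (ltnW ij) jn) ltnS jn => ->.
Qed.

Let tt_mem i : (i <= n)%N -> tt i \in r.
Proof. by move=> i_n; rewrite mem_nth // size_r. Qed.

Let tt_index x : x \in r -> exists2 i, (i <= n)%N & tt i = x.
Proof.
move=> xr; exists (index x r); last exact: nth_index.
by rewrite -ltnS -size_r index_mem.
Qed.

Let tt_le i j : (i <= j)%N -> (j <= n)%N -> tt i <= tt j.
Proof. by rewrite leq_eqVlt => /predU1P[->//|ij jn]; exact/ltW/tt_lt. Qed.

Let tt0 : tt 0 = 0.
Proof.
apply/eqP; rewrite eq_le; apply/andP; split.
  have [|i i_n <-] := @tt_index 0; first by rewrite mem_r inE eqxx.
  exact: tt_le.
by have /andP[] := r_bound (tt_mem (leq0n n)).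
Qed.

Let ttn : tt n = c.
Proof.
apply/eqP; rewrite eq_le; apply/andP; split.
  by have /andP[] := r_bound (tt_mem (leqnn n)).
have [|i i_n <-] := @tt_index c; first by rewrite mem_r !inE eqxx orbT.
exact: tt_le.
Qed.

Let tt_big i : (n < i)%N -> tt i = t.
Proof. by move=> ni; rewrite /tt nth_default // size_r. Qed.

Let tt_step i : (i < n.+1)%N -> tt i < tt i.+1.
Proof.
rewrite ltnS leq_eqVlt => /predU1P[->|i_n]; last exact: tt_lt.
by rewrite ttn tt_big.
Qed.

Let tt_homo : {homo tt : i j / (i <= j)%N >-> i <= j}.
Proof.
apply: homo_leq => //; first exact: le_trans.
move=> i; have [/tt_step/ltW //|ni] := ltnP i n.+1.
by rewrite !tt_big // ltnS ltnW.
Qed.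

Let tt0_ge0 : 0 <= tt 0. Proof. by rewrite tt0. Qed.

Let xi := @grid_increments _ T R P d X n.+1 tt.
Let k0 : 'I_n.+1 * 'I_d := (ord_max, p).

(** The cylinder read on increments: a value of the path is the sum of the increments before its
    time, and the last increment [k0] is never among them. *)
Let A : set (coords ('I_n.+1 * 'I_d)%type R) := [set x | forall k, k \in s ->
  B k (\sum_(i < n.+1 | (i < index k.1 r)%N) x (i, k.2))].

Let mA : measurable A.
Proof.
rewrite (_ : A = \bigcap_(k in [set` s]) ((fun x : coords _ R =>
    \sum_(i < n.+1 | (i < index k.1 r)%N) x (i, k.2)) @^-1` B k)).
  apply: fin_bigcap_measurable => // k _.
  have mS : measurable_fun setT (fun x : coords ('I_n.+1 * 'I_d)%type R =>
      \sum_(i < n.+1 | (i < index k.1 r)%N) x (i, k.2)).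
    rewrite (_ : (fun _ => _) = fun x : coords ('I_n.+1 * 'I_d)%type R =>
      \sum_(i < n.+1) if (i < index k.1 r)%N then x (i, k.2) else 0).
      apply: measurable_sum => i; case: (i < _)%N; last exact: measurable_cst.
      exact: (@measurable_coord ('I_n.+1 * 'I_d)%type R (i, k.2)).
    by apply/funext => x; rewrite big_mkcond.
  by rewrite -[X in measurable X]setTI; exact: mS.
by apply/seteqP; split => x /= h k; exact: h.
Qed.

Let A_upd x v : A (upd k0 x v) <-> A x.
Proof.
have E k : k \in s -> \sum_(i < n.+1 | (i < index k.1 r)%N) upd k0 x v (i, k.2) =
    \sum_(i < n.+1 | (i < index k.1 r)%N) x (i, k.2).
  move=> ks; apply: eq_bigr => i ik; rewrite /upd /k0 xpair_eqE.
  case: eqP => // iE; move: ik; rewrite iE /= => ik.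
  have : (index k.1 r < n.+1)%N.
    rewrite -size_r index_mem mem_r !inE; apply/orP; right; apply/orP; right.
    exact: map_f.
  by rewrite ltnS leqNgt ik.
by split => h k ks; move: (h k ks); rewrite E.
Qed.

Let cyl := [set w | forall k, k \in s -> B k (X k.1 k.2 w)].

Let mcyl : measurable cyl.
Proof.
rewrite (_ : cyl = \bigcap_(k in [set` s]) (X k.1 k.2 @^-1` B k)).
  apply: fin_bigcap_measurable => // k _; rewrite -[X in measurable X]setTI.
  have mX : measurable_fun setT (X k.1 k.2) by exact: measurable_funPT.
  by apply: mX.
by apply/seteqP; split => x /= h k; exact: h.
Qed.

(** Only almost surely: a path is the sum of its increments when it starts at 0. *)
Let cyl_ae : {ae P, forall w, cyl w <-> A (xi w)}.
Proof.
have := bm_start hX; apply: filterS => w w0.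
have E k : k \in s -> \sum_(i < n.+1 | (i < index k.1 r)%N) xi w (i, k.2) = X k.1 k.2 w.
  move=> ks; have kr : k.1 \in r.
    rewrite mem_r !inE; apply/orP; right; apply/orP; right; exact: map_f.
  rewrite (sum_increments (fun i => X (tt i) k.2 w)).
    by rewrite tt0 w0 subr0 /tt nth_index.
  by rewrite ltnW // -size_r index_mem.
by split => h k ks; move: (h k ks); rewrite E.
Qed.

Let mxi k : measurable_fun setT (fun w => xi w k).
Proof. exact: measurable_increment. Qed.

Let mxiA : measurable (xi @^-1` A).
Proof.
rewrite -[X in measurable X]setTI.
by apply: (measurable_coords (xi := xi : T -> coords _ R)).
Qed.

(** The last increment of the grid is independent of the other ones, and the cylinder is almost
    surely a function of those. *)
Lemma cylinder_indep (D : set R) : measurable D ->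
  (P (cyl `&` increment c t p @^-1` D) =
   P cyl * distribution P (increment c t p) D)%E.
Proof.
move=> mD.
have mV : measurable (increment c t p @^-1` D).
  by rewrite -[X in measurable X]setTI; exact: measurable_funPT.
have := indep_coords_upd mxi (bm_indep_coords hX tt0_ge0 tt_homo tt_step) k0 mA mD.
have -> : (fun w => upd k0 (xi w) 0) @^-1` A = xi @^-1` A.
  by apply/seteqP; split => w /=; rewrite A_upd.
rewrite /grid_law /= tt_big // ttn -/(increment c t p).
have -> : (fun w => xi w k0) @^-1` D = increment c t p @^-1` D.
  by rewrite /xi /grid_increments /= tt_big // ttn.
rewrite -(measure_ae_iff mcyl mxiA cyl_ae) => <-.
apply: measure_ae_iff; [exact: measurableI|exact: measurableI|].
by apply: filterS cyl_ae => w h /=; split => -[/h h1 h2]; split.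
Qed.

End cylinder.

Lemma measurable_past_id c : measurable_fun setT (idfun : T -> past X c).
Proof. by move=> _ A mA; rewrite setTI; exact: past_measurable mA. Qed.

Lemma past_indep c t p : 0 <= c -> c < t ->
  indep_law P (idfun : T -> past X c) (increment c t p)
    (distribution P (increment c t p)).
Proof.
move=> c0 ct.
apply: (@indep_law_pi _ T R P _ (past X c) _ _ _ (@measurable_past_id c)
  (measurable_funPT _) (cylinders X c) (past_cylinders X c) (@cylinders_setI _ _ _ _ _ X c)
  (@cylinders_setT _ _ _ _ _ X c)).
by move=> _ D [s sc [B mB ->]] mD; exact: cylinder_indep.
Qed.

End past_independence.

(** * Moments of Brownian increments, alone and against adapted factors *)

Section increments.
Context disp (T : measurableType disp) (R : realType) (P : probability T R).
Context (d : nat) (X : R -> 'I_d -> {RV P >-> R}).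
Hypothesis hX : standard_brownian_motion X.
Local Notation incr s t p := (increment X s t p).

Let ge0_integral_incr s t p (g : R -> R) : 0 <= s -> s < t ->
  measurable_fun setT g -> (forall x, 0 <= g x) ->
  (\int[P]_w (g (incr s t p w))%:E = \int[normal_prob 0 (Num.sqrt (t - s))]_x (g x)%:E)%E.
Proof.
move=> s0 st mg g0.
pose V : T -> measurableTypeR R := incr s t p.
have mV : measurable_fun setT V.
  by move=> _ A mA; exact: (@measurable_funPT _ _ _ _ (incr s t p) measurableT A mA).
pose V' : {mfun T >-> measurableTypeR R} := HB.pack V (isMeasurableFun.Build _ _ _ _ V mV).
rewrite -[LHS](@ge0_integral_distribution _ _ _ _ _ P V' (fun x => (g x)%:E)).
- apply: eq_measure_integral => A mA _.
  by rewrite /= -(bm_gaussian_coordinates hX s0 st p mA).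
- by apply/measurable_EFinP => _ A mA; exact: (mg measurableT A mA).
- by move=> x; rewrite lee_fin.
Qed.

Let sqrt_gt0 (s t : R) : s < t -> 0 < Num.sqrt (t - s).
Proof. by move=> st; rewrite sqrtr_gt0 subr_gt0. Qed.

Let incr_same s p w : incr s s p w = 0. Proof. by rewrite /= subrr. Qed.

Lemma mom_increment s t p : 0 <= s -> s <= t -> mom P (incr s t p).
Proof.
move=> s0; rewrite le_eqVlt => /predU1P[<-|st].
  by apply: mom_ext (mom_cst P 0) => w; rewrite incr_same.
split=> [|k]; first exact: measurable_funPT.
rewrite (ge0_integral_incr p (g := fun x => `|x| ^+ k)) //.
- exact: (mom_normal (sqrt_gt0 st)).2.
- by apply: measurable_funX; exact: normr_measurable.
Qed.

Let Ex_incr s t p (g : R -> R) : 0 <= s -> s < t -> measurable_fun setT g ->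
  (forall x, 0 <= g x) ->
  Ex P (fun w => g (incr s t p w)) = Ex (normal_prob 0 (Num.sqrt (t - s))) g.
Proof. by move=> s0 st mg g0; rewrite /Ex ge0_integral_incr. Qed.

Lemma Ex_increment2 s t p : 0 <= s -> s <= t -> Ex P (fun w => incr s t p w ^+ 2) = t - s.
Proof.
move=> s0; rewrite le_eqVlt => /predU1P[<-|st].
  rewrite subrr (eq_Ex _ (Y := cst 0)) ?Ex_cst // => w.
  by rewrite incr_same expr0n.
rewrite (Ex_incr p (g := fun x => x ^+ 2)) //.
- by rewrite (normal_second_moment (sqrt_gt0 st)) sqr_sqrtr // subr_ge0 ltW.
- by move=> x; exact: sqr_ge0.
Qed.

Lemma Ex_increment4 s t p : 0 <= s -> s <= t ->
  Ex P (fun w => incr s t p w ^+ 4) <= 48 * expR 1 * (t - s) ^+ 2.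
Proof.
move=> s0; rewrite le_eqVlt => /predU1P[<-|st].
  rewrite (_ : (s - s) ^+ 2 = 0); last by rewrite subrr expr0n.
  rewrite mulr0 (eq_Ex _ (Y := cst 0)) ?Ex_cst // => w.
  by rewrite incr_same expr0n.
rewrite (Ex_incr p (g := fun x => x ^+ 4)) //.
- apply: (le_trans (normal_fourth_moment (sqrt_gt0 st))).
  by rewrite (_ : 4 = 2 * 2)%N // exprM sqr_sqrtr // subr_ge0 ltW.
- by move=> x; rewrite exprn_even_ge0.
Qed.

Lemma Ex_increment s t p : 0 <= s -> s <= t -> Ex P (incr s t p) = 0.
Proof.
move=> s0; rewrite le_eqVlt => /predU1P[<-|st].
  by rewrite (eq_Ex _ (Y := cst 0)) ?Ex_cst // => w; rewrite incr_same.
have mI := mom_increment p s0 (ltW st).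
have mG := mom_normal (sqrt_gt0 st).
(* The transfer to the normal law is for non-negative integrands, so [x] is written as
   [(|x| + x) - |x|]. *)
pose g1 (x : R) := `|x| + x; pose g2 (x : R) := `|x|.
have m1 : mom P (fun w => g1 (incr s t p w)) by rewrite /g1; mom.
have m2 : mom P (fun w => g2 (incr s t p w)) by rewrite /g2; mom.
have n1 : mom (normal_prob 0 (Num.sqrt (t - s))) g1 by rewrite /g1; mom.
have n2 : mom (normal_prob 0 (Num.sqrt (t - s))) g2 by rewrite /g2; mom.
rewrite (eq_Ex _ (Y := fun w => g1 (incr s t p w) - g2 (incr s t p w))); last first.
  by move=> w; rewrite /g1 /g2 addrAC subrr add0r.
rewrite ExB // !Ex_incr //.
  rewrite -ExB // -[RHS](normal_mean (sqrt_gt0 st)); apply: eq_Ex => x.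
  by rewrite /g1 /g2 addrAC subrr add0r.
all: try exact: normr_measurable.
all: try by move=> x; rewrite /g2.
all: try by apply: measurable_funD => //; exact: normr_measurable.
by move=> x; rewrite /g1 -lerBlDr sub0r -normrN ler_norm.
Qed.

Let Ex_indep_ge0 c t p (U : T -> R) (g : R -> R) : 0 <= c -> c < t ->
  adapted X c U -> measurable_fun setT g -> (forall w, 0 <= U w) -> (forall x, 0 <= g x) ->
  mom P U -> mom P (fun w => g (incr c t p w)) ->
  Ex P (fun w => U w * g (incr c t p w)) = Ex P U * Ex P (fun w => g (incr c t p w)).
Proof.
move=> c0 ct aU mg U0 g0 mU mgV.
have mUg : mom P (fun w => U w * g (incr c t p w)) by mom.
apply: EFin_inj; rewrite EFinM -!ExE //.
have mF : measurable_fun setT (fun x : past X c * R => (U x.1 * g x.2)%:E).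
  apply/measurable_EFinP; apply: measurable_funM.
    exact: (measurableT_comp (aU : measurable_fun setT (U : past X c -> R)) measurable_fst).
  exact: (measurableT_comp mg measurable_snd).
have mI : measurable_fun setT (incr c t p) by exact: measurable_funPT.
rewrite [LHS](@freezing _ T R P _ (past X c) idfun (incr c t p) _
  (@measurable_past_id _ _ _ _ _ X c) mI (past_indep hX p c0 ct) _ mF); last first.
  by move=> x; rewrite lee_fin mulr_ge0.
have inner w : (\int[distribution P (incr c t p)]_v (U w * g v)%:E =
    (U w)%:E * \int[P]_w' (g (incr c t p w'))%:E)%E.
  under eq_integral do rewrite EFinM.
  rewrite ge0_integralZl_EFin //.
  - rewrite ge0_integral_distribution //; first exact/measurable_EFinP.
  - by move=> x _; rewrite lee_fin.
  - exact/measurable_EFinP.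
under eq_integral do rewrite /= inner.
rewrite ge0_integralZr //; first by apply/measurable_EFinP; case: mU.
- by move=> w _; rewrite lee_fin.
- by apply: integral_ge0 => w _; rewrite lee_fin.
Qed.

Lemma Ex_indep c t p (U : T -> R) (g : R -> R) : 0 <= c -> c < t ->
  adapted X c U -> measurable_fun setT g -> mom P U -> mom P (fun w => g (incr c t p w)) ->
  Ex P (fun w => U w * g (incr c t p w)) = Ex P U * Ex P (fun w => g (incr c t p w)).
Proof.
move=> c0 ct aU mg mU mgV.
pose V w := g (incr c t p w).
(* Both [U] and [g] become differences of non-negative functions, and the product rule is applied to
   the four resulting products. *)
pose gp x := `|g x| + g x; pose gn x := `|g x|.
pose Up w := `|U w| + U w; pose Un w := `|U w|.
have mUp : mom P Up by rewrite /Up; mom.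
have mUn : mom P Un by rewrite /Un; mom.
have mgp : mom P (fun w => gp (incr c t p w)) by rewrite /gp; mom.
have mgn : mom P (fun w => gn (incr c t p w)) by rewrite /gn; mom.
have aUn : adapted X c Un by apply: measurableT_comp => //; exact: normr_measurable.
have aUp : adapted X c Up by exact: measurable_funD.
have rgn : measurable_fun setT gn by apply: measurableT_comp => //; exact: normr_measurable.
have rgp : measurable_fun setT gp by exact: measurable_funD.
have p0 (x : R) : 0 <= `|x| + x by rewrite -lerBlDr sub0r -normrN ler_norm.
have h W g' := @Ex_indep_ge0 c t p W g' c0 ct.
have -> : Ex P U = Ex P Up - Ex P Un.
  by rewrite -ExB //; apply: eq_Ex => w; rewrite /Up /Un addrAC subrr add0r.
have -> : Ex P (fun w => g (incr c t p w)) =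
    Ex P (fun w => gp (incr c t p w)) - Ex P (fun w => gn (incr c t p w)).
  by rewrite -ExB //; apply: eq_Ex => w; rewrite /gp /gn addrAC subrr add0r.
have -> : Ex P (fun w => U w * g (incr c t p w)) =
    Ex P (fun w => Up w * gp (incr c t p w)) - Ex P (fun w => Up w * gn (incr c t p w))
    - (Ex P (fun w => Un w * gp (incr c t p w)) - Ex P (fun w => Un w * gn (incr c t p w))).
  have m1 := momM mUp mgp; have m2 := momM mUp mgn.
  have m3 := momM mUn mgp; have m4 := momM mUn mgn.
  rewrite -(ExB m1 m2) -(ExB m3 m4) -(ExB (momB m1 m2) (momB m3 m4)).
  by apply: eq_Ex => w; rewrite /Up /Un /gp /gn; ring.
by rewrite !h //; try ring; move=> x; rewrite /Up /Un /gp /gn ?p0.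
Qed.

Lemma Ex_adapted_increment c t p U : 0 <= c -> c <= t -> adapted X c U -> mom P U ->
  Ex P (fun w => U w * incr c t p w) = 0.
Proof.
move=> c0; rewrite le_eqVlt => /predU1P[<-|ct] aU mU.
  by rewrite (eq_Ex _ (Y := cst 0)) ?Ex_cst // => w; rewrite incr_same mulr0.
rewrite (Ex_indep (g := id)) //; last exact: mom_increment (ltW ct).
by rewrite Ex_increment ?mulr0 // ltW.
Qed.

Lemma Ex_adapted_increment2 c t p U : 0 <= c -> c <= t -> adapted X c U -> mom P U ->
  Ex P (fun w => U w * incr c t p w ^+ 2) = Ex P U * (t - c).
Proof.
move=> c0; rewrite le_eqVlt => /predU1P[<-|ct] aU mU.
  rewrite subrr mulr0 (eq_Ex _ (Y := cst 0)) ?Ex_cst // => w.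
  by rewrite incr_same expr0n mulr0.
rewrite (Ex_indep (g := fun x => x ^+ 2)) //; first by rewrite Ex_increment2 // ltW.
by apply: momX; exact: mom_increment (ltW ct).
Qed.

Lemma adapted_increment c s t p : 0 <= s <= c -> 0 <= t <= c -> adapted X c (incr s t p).
Proof. by move=> sc tc; apply: adaptedB; exact: adapted_X. Qed.

Let pair_le a b c e p (U : T -> R) : 0 <= a -> a <= b -> a <= c -> c <= e ->
  adapted X c U -> mom P U ->
  Ex P (fun w => U w * (incr a b p w * incr c e p w)) =
  Ex P U * Num.max 0 (Num.min b e - c).
Proof.
move=> a0 ab ac ce aU mU; have c0 := le_trans a0 ac.
have b0 := le_trans a0 ab; have e0 := le_trans c0 ce.
have mab := mom_increment p a0 ab; have mce := mom_increment p c0 ce.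
have [bc|cb] := leP b c.
  rewrite (eq_Ex _ (Y := fun w => (U w * incr a b p w) * incr c e p w)); last first.
    by move=> w; rewrite mulrA.
  rewrite Ex_adapted_increment //; last by mom.
    rewrite max_l ?mulr0 // subr_le0.
    by rewrite ge_min bc.
  by apply: adaptedM => //; apply: adapted_increment; rewrite ?a0 ?b0.
(* Both intervals are cut at [c] and at the end [f] of their overlap. Only the squared increment
   over the overlap survives: [z1], [z3] and [z4] contain a factor that is a future increment, and
   in [z5] one interval is empty because [f] is [b] or [e]. *)
pose f := Num.min b e.
have fb : f <= b by rewrite /f ge_min lexx.
have fe : f <= e by rewrite /f ge_min lexx orbT.
have cf : c <= f by rewrite /f le_min (ltW cb).
have f0 := le_trans c0 cf.
have -> : Num.max 0 (f - c) = f - c by rewrite max_r // subr_ge0.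
have mac := mom_increment p a0 ac; have mcf := mom_increment p c0 cf.
have mfe := mom_increment p f0 fe; have mfb := mom_increment p f0 fb.
have aUf : adapted X f U := adapted_mono cf aU.
have z1 : Ex P (fun w => (U w * incr a c p w) * incr c e p w) = 0.
  apply: Ex_adapted_increment => //; last by mom.
  by apply: adaptedM => //; apply: adapted_increment; rewrite ?a0 ?c0 ?lexx.
have z2 : Ex P (fun w => U w * incr c f p w ^+ 2) = Ex P U * (f - c).
  exact: Ex_adapted_increment2.
have z3 : Ex P (fun w => (U w * incr c f p w) * incr f e p w) = 0.
  apply: Ex_adapted_increment => //; last by mom.
  by apply: adaptedM => //; apply: adapted_increment; rewrite ?c0 ?f0 ?cf ?lexx.
have z4 : Ex P (fun w => (U w * incr c f p w) * incr f b p w) = 0.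
  apply: Ex_adapted_increment => //; last by mom.
  by apply: adaptedM => //; apply: adapted_increment; rewrite ?c0 ?f0 ?cf ?lexx.
have z5 w : incr f b p w * incr f e p w = 0.
  rewrite /f; case: leP => _; first by rewrite incr_same mul0r.
  by rewrite incr_same mulr0.
have m1 : mom P (fun w => (U w * incr a c p w) * incr c e p w) by mom.
have m2 : mom P (fun w => U w * incr c f p w ^+ 2) by mom.
have m3 : mom P (fun w => (U w * incr c f p w) * incr f e p w) by mom.
have m4 : mom P (fun w => (U w * incr c f p w) * incr f b p w) by mom.
rewrite -[RHS]addr0 -{1}z4 -[RHS]addr0 -{1}z3 -{1}z2 -[RHS]addr0 -{1}z1.
rewrite -(ExD m2 m4) -(ExD (momD m2 m4) m3) -(ExD (momD (momD m2 m4) m3) m1).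
apply: eq_Ex => w; rewrite -[LHS]addr0 -(mulr0 (- U w)) -(z5 w) /=; ring.
Qed.

(** The polarised isometry for two weighted increments: the last factor is the length of the overlap
    of the two intervals. *)
Lemma Ex_increment_pair a b c e p (U V : T -> R) : 0 <= a -> a <= b -> 0 <= c -> c <= e ->
  adapted X a U -> adapted X c V -> mom P U -> mom P V ->
  Ex P (fun w => (U w * incr a b p w) * (V w * incr c e p w)) =
  Ex P (fun w => U w * V w) * Num.max 0 (Num.min b e - Num.max a c).
Proof.
move=> a0 ab c0 ce aU aV mU mV.
have [ac|/ltW ca] := leP a c.
  rewrite -(@pair_le a b c e p) //; [by apply: eq_Ex => w; ring| |by mom].
  by apply: adaptedM => //; exact: adapted_mono aU.
rewrite minC -(@pair_le c e a b p) //; [by apply: eq_Ex => w; ring| |by mom].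
by apply: adaptedM => //; exact: adapted_mono aV.
Qed.

End increments.

(** Monotonicity read off the definition of the integral as a supremum over simple functions below;
    it serves for expectations whose measurability in [s] is not established. *)
Lemma ge0_subset_le_integral d (T : measurableType d) (R : realType)
    (mu : {measure set T -> \bar R}) (D : set T) (f g : T -> \bar R) :
  (forall x, D x -> (0 <= f x)%E) -> (forall x, D x -> (f x <= g x)%E) ->
  (\int[mu]_(x in D) f x <= \int[mu]_(x in D) g x)%E.
Proof.
move=> f0 fg; have g0 x : D x -> (0 <= g x)%E by move=> Dx; rewrite (le_trans (f0 _ Dx)) ?fg.
rewrite !ge0_integralE //; apply: le_ereal_sup => _ [h /= hf <-]; exists h => // x.
by rewrite (le_trans (hf x)) // lee_restrict.
Qed.

(** * The uniform grid of the unit interval *)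

Section grid.
Context (R : realType).

Definition grid (N i : nat) : R := i%:R / N%:R.

Lemma grid_ge0 N i : 0 <= grid N i.
Proof. by rewrite divr_ge0. Qed.

Lemma grid_le N i j : (i <= j)%N -> grid N i <= grid N j.
Proof. by move=> ij; rewrite ler_wpM2r ?invr_ge0 // ler_nat. Qed.

Lemma grid_le1 N i : (0 < N)%N -> (i <= N)%N -> grid N i <= 1.
Proof. by move=> N0 iN; rewrite ler_pdivrMr ?ltr0n // mul1r ler_nat. Qed.

Lemma gridn N : (0 < N)%N -> grid N N = 1.
Proof. by move=> N0; rewrite /grid divff // pnatr_eq0 -lt0n. Qed.

Lemma grid0 N : grid N 0 = 0.
Proof. by rewrite /grid mul0r. Qed.

Lemma gridS N i : (0 < N)%N -> grid N i.+1 - grid N i = N%:R^-1.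
Proof.
by move=> N0; rewrite /grid -mulrBl -natrB // subSnn mul1r.
Qed.

(** Cells are open on the left, like the intervals of simple processes, so 0 lies in no cell and is
    treated apart. The cell is found from the least grid point above [s]. *)
Lemma grid_cell N (s : R) : (0 < N)%N -> 0 < s <= 1 ->
  exists i : 'I_N, grid N i < s <= grid N i.+1.
Proof.
move=> N0 /andP[s0 s1].
have ex : exists i, s <= grid N i by exists N; rewrite gridn.
case: (ex_minnP ex) => -[|i] si min.
  by move: si; rewrite grid0 leNgt s0.
have iN : (i < N)%N by have := min N; rewrite gridn // => /(_ s1).
exists (Ordinal iN); rewrite /= si andbT ltNge; apply/negP => /min.
by rewrite ltnn.
Qed.

Lemma grid_cell_sum N (s : R) (i : 'I_N) (u : 'I_N -> R) :
  grid N i < s <= grid N i.+1 ->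
  \sum_(j < N) u j * \1_(`]grid N j, grid N j.+1]) s = u i.
Proof.
move=> /andP[is_ si]; rewrite (bigD1 i) //= big1 ?addr0.
  by rewrite indicE mem_set ?mulr1 //= in_itv /= is_ si.
move=> j ji; rewrite indicE memNset ?mulr0 //= in_itv /= => /andP[js sj].
have : (j : nat) != i by [].
rewrite neq_ltn => /orP[ij|ij]; have := grid_le N ij; lra.
Qed.

End grid.

(** * Ito isometry for elementary integrands on possibly overlapping intervals *)

Section isometry.
Context disp (T : measurableType disp) (R : realType) (P : probability T R).
Context (d : nat) (X : R -> 'I_d -> {RV P >-> R}).
Hypothesis hX : standard_brownian_motion X.
Variables (I : finType) (xi : I -> T -> R) (a b : I -> R) (q : 'I_d).
Hypotheses (a0 : forall i, 0 <= a i) (ab : forall i, a i <= b i)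
  (b1 : forall i, b i <= 1).
Hypotheses (axi : forall i, adapted X (a i) (xi i)) (mxi : forall i, mom P (xi i)).

Definition elementary_integral w := \sum_i xi i w * increment X (a i) (b i) q w.

Definition elementary_value (s : R) w := \sum_i xi i w * \1_(`]a i, b i]) s.

Let cov (k : I * I) := Ex P (fun w => xi k.1 w * xi k.2 w).
Let len (k : I * I) := Num.max 0 (Num.min (b k.1) (b k.2) - Num.max (a k.1) (a k.2)).
Let ind (k : I * I) (s : R) : R := \1_(`]a k.1, b k.1]) s * \1_(`]a k.2, b k.2]) s.

Lemma mom_elementary_value s : mom P (elementary_value s).
Proof. by apply: mom_sum => i _; apply: momM => //; exact: mom_cst. Qed.

Let integral_square : Ex P (fun w => elementary_integral w ^+ 2) = \sum_k cov k * len k.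
Proof.
have mincr i : mom P (increment X (a i) (b i) q) by exact: mom_increment.
rewrite (eq_Ex _ (Y := fun w => \sum_(k : I * I)
    (xi k.1 w * increment X (a k.1) (b k.1) q w) *
    (xi k.2 w * increment X (a k.2) (b k.2) q w))); last first.
  move=> w; rewrite expr2 /elementary_integral mulr_suml -(pair_bigA _ (fun i j =>
    (xi i w * increment X (a i) (b i) q w) * (xi j w * increment X (a j) (b j) q w))) /=.
  by apply: eq_bigr => i _; rewrite mulr_sumr.
rewrite Ex_sum => [|k _]; last by do 2 apply: momM.
by apply: eq_bigr => k _; rewrite Ex_increment_pair.
Qed.

Let value_square s : Ex P (fun w => elementary_value s w ^+ 2) = \sum_k cov k * ind k s.
Proof.
rewrite (eq_Ex _ (Y := fun w => \sum_(k : I * I) ind k s * (xi k.1 w * xi k.2 w))); last first.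
  move=> w; rewrite expr2 /elementary_value mulr_suml -(pair_bigA _ (fun i j =>
    ind (i, j) s * (xi i w * xi j w))) /=.
  by apply: eq_bigr => i _; rewrite mulr_sumr; apply: eq_bigr => j _; rewrite /ind /=; ring.
rewrite Ex_sum => [|k _]; last by apply: momZ; apply: momM.
by apply: eq_bigr => k _; rewrite ExZ 1?mulrC //; apply: momM.
Qed.

Let indE k : ind k = \1_(`]Num.max (a k.1) (a k.2), Num.min (b k.1) (b k.2)]).
Proof.
apply/funext => s; rewrite /ind !indicE !mem_setE !in_itv /= gt_max le_min.
by do 4 case: (_ < _) || case: (_ <= _); rewrite ?mulr1 ?mulr0.
Qed.

Let integrable_ind k : (@lebesgue_measure R).-integrable `[0, 1] (fun s => (ind k s)%:E).
Proof.
rewrite indE; apply: (@integrableS _ _ _ _ setT) => //.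
exact: (integrable_indic_itv _ _ false false).
Qed.

Let integral_ind k : (\int[lebesgue_measure]_(s in `[0%R, 1%R]) (ind k s)%:E = (len k)%:E)%E.
Proof.
rewrite indE integral_indic // setIidl; last first.
  move=> s /=; rewrite !in_itv /= gt_max le_min => /andP[/andP[h1 _] /andP[h2 _]].
  have := a0 k.1; have := b1 k.1; move: h1 h2; lra.
rewrite /= lebesgue_measure_itv /= lte_fin /len.
move: (Num.max (a _) _) (Num.min _ _) => u v.
have [h|h] := ltP u v; first by rewrite max_r // subr_ge0 ltW.
by rewrite max_l // subr_le0.
Qed.

Lemma measurable_value_square :
  measurable_fun (`[0%R, 1%R]%classic : set (measurableTypeR R))
    (fun s => Ex P (fun w => elementary_value s w ^+ 2)).
Proof.
rewrite (_ : (fun s : R => _) = fun s => \sum_k cov k * ind k s); last first.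
  by apply/funext => s; exact: value_square.
apply: measurable_sum => k; apply: measurable_funM; first exact: measurable_cst.
by apply/measurable_EFinP; exact: measurable_int (integrable_ind k).
Qed.

(** Both sides expand into the same double sum: covariance of two coefficients times the length of
    the overlap of their intervals. *)
Lemma elementary_isometry :
  (\int[lebesgue_measure]_(s in `[0%R, 1%R]) (Ex P (fun w => elementary_value s w ^+ 2))%:E
   = (Ex P (fun w => elementary_integral w ^+ 2))%:E)%E.
Proof.
rewrite integral_square.
under eq_integral => s _ do rewrite [Ex _ _]value_square -sumEFin.
rewrite integral_sum //.
  rewrite -sumEFin; apply: eq_bigr => k _.
  under eq_integral do rewrite EFinM.
  by rewrite integralZl // integral_ind -EFinM.
by move=> k; apply: (integrableZl _ (cov k) (integrable_ind k)).
Qed.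

End isometry.

(** * Mean square convergence of Riemann sums to the Ito integral *)

Section riemann_sums.
Context disp (T : measurableType disp) (R : realType) (P : probability T R).
Context (d : nat) (X : R -> 'I_d -> {RV P >-> R}).
Hypothesis hX : standard_brownian_motion X.

Lemma ae_Ex_start p (g : R -> R) : measurable_fun setT g ->
  (\int[P]_w (g (X 0 p w))%:E = (g 0)%:E)%E.
Proof.
move=> mg.
transitivity (\int[P]_w (cst (g 0)%:E) w)%E; last first.
  by rewrite integral_cst // [X in (_ * X)%E](@probability_setT _ _ _ P) mule1.
apply: ae_eq_integral => //.
- apply/measurable_EFinP; apply: (measurableT_comp mg).
  exact: measurable_funPT.
- by apply: filterS (bm_start hX) => w w0 _ /=; rewrite w0.
Qed.

Lemma mom_start p : mom P (X 0 p).
Proof.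
split=> [|k]; first exact: measurable_funPT.
rewrite (ae_Ex_start p (g := fun x => `|x| ^+ k)) ?ltry //.
by apply: measurable_funX; exact: normr_measurable.
Qed.

Lemma Ex_start2 p : Ex P (fun w => X 0 p w ^+ 2) = 0.
Proof. by rewrite /Ex (ae_Ex_start p (g := fun x => x ^+ 2)) // expr0n. Qed.

Lemma mom_bm t p : 0 <= t -> mom P (X t p).
Proof.
move=> t0; have := momD (mom_increment hX p (lexx 0) t0) (mom_start p).
by apply: mom_ext => w /=; rewrite subrK.
Qed.

(** Left-endpoint sums, with the integrand replaced by its increment from time 0: they are
    polynomials in the grid increments, and [X 0] vanishes almost surely. *)
Definition riemann N p q w :=
  \sum_(i < N) increment X 0 (grid R N i) p w *
    increment X (grid R N i) (grid R N i.+1) q w.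

Lemma mom_riemann N p q : mom P (riemann N p q).
Proof.
apply: mom_sum => i _; apply: momM; apply: mom_increment => //.
- exact: grid_ge0.
- exact: grid_ge0.
- exact: grid_le.
Qed.

Section simple.
Variables (H : simple_process (natural_filtration X)) (p q : 'I_d) (N : nat).
Hypothesis N0 : (0 < N)%N.

Let I := ('I_N + 'I_(sp_size H))%type.

Let tm i := sp_time H i.

(* A Riemann sum minus the integral of a simple process is again an elementary
   integral, over the disjoint union of the two families of intervals. *)
Let xi (k : I) : T -> R := match k with
  | inl i => increment X 0 (grid R N i) p
  | inr i => if tm i <= 1 then fun w => - sp_coef H i w else cst 0
  end.
(** Times are cut at 1. A piece that starts later becomes empty, and [xi] gives it the coefficient
    0, since its own coefficient is adapted only at a time beyond 1. *)
Let a (k : I) : R := match k with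
  | inl i => grid R N i | inr i => Num.min (tm i) 1 end.
Let b (k : I) : R := match k with
  | inl i => grid R N i.+1 | inr i => Num.min (tm i.+1) 1 end.

Let tm_ge0 i : 0 <= tm i.
Proof. exact: le_trans (sp_time_ge0 H) (sp_time_homo H (leq0n i)). Qed.

Let a0 k : 0 <= a k.
Proof. by case: k => i /=; [exact: grid_ge0|rewrite le_min tm_ge0 ler01]. Qed.

Let ab k : a k <= b k.
Proof.
case: k => i /=; first exact: grid_le.
by rewrite le_min !ge_min lexx orbT andbT (sp_time_homo H (leqnSn i)).
Qed.

Let b1 k : b k <= 1.
Proof. by case: k => i /=; [exact: grid_le1|rewrite ge_min lexx orbT]. Qed.

Let coef_adapted i : adapted X (tm i) (sp_coef H i).
Proof. by apply/adaptedP; exact: sp_coef_adapted. Qed.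

Let mom_coef i : mom P (sp_coef H i).
Proof.
have [M hM] := sp_coef_bounded H i.
exact: (mom_bounded P (adapted_measurable (@coef_adapted i)) hM).
Qed.

Let axi k : adapted X (a k) (xi k).
Proof.
case: k => i /=.
  by apply: adapted_increment; rewrite ?lexx ?grid_ge0.
case: ifP => ti; last exact: adapted_cst.
rewrite min_l //; have := adaptedM (@adapted_cst _ _ _ _ _ X (tm i) (-1)) (@coef_adapted i).
by congr adapted; apply/funext => w; rewrite mulN1r.
Qed.

Let mxi k : mom P (xi k).
Proof.
case: k => i /=; first by apply: mom_increment => //; exact: grid_ge0.
by case: ifP => _; [exact: momN|exact: mom_cst].
Qed.

Let EI w : elementary_integral X xi a b q w =
  riemann N p q w - sp_integral H (fun s => X s q) 1 w.
Proof.
rewrite /elementary_integral big_sumType /=; congr (_ + _).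
rewrite /sp_integral -sumrN; apply: eq_bigr => i _.
case: ifP => ti; first by rewrite mulNr.
have ti1 : 1 <= tm i by rewrite ltW // ltNge ti.
have ti2 : 1 <= tm i.+1 by rewrite (le_trans ti1) // (sp_time_homo H (leqnSn i)).
by rewrite mul0r !min_r // subrr mulr0 oppr0.
Qed.

Let EV s w : 0 <= s <= 1 -> elementary_value xi a b s w =
  \sum_(i < N) increment X 0 (grid R N i) p w * \1_(`]grid R N i, grid R N i.+1]) s
  - sp_value H s w.
Proof.
move=> /andP[s0 s1]; rewrite /elementary_value big_sumType /=; congr (_ + _).
rewrite /sp_value -sumrN; apply: eq_bigr => i _.
rewrite !indicE !mem_setE !in_itv /= gt_min le_min s1 andbT.
have [ti|ti] := leP (tm i) 1.
  rewrite mulNr; congr (- (_ * _)); congr (nat_of_bool (_ && _))%:R.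
  by rewrite [1 < s]ltNge s1 orbF.
by rewrite mul0r [tm i < s]ltNge (ltW (le_lt_trans s1 ti)) mulr0 oppr0.
Qed.

Let mom_value s : 0 <= s -> mom P (fun w => sp_value H s w - X s p w).
Proof.
move=> s0; apply: momB; last exact: mom_bm.
by apply: mom_sum => i _; apply: momM => //; exact: mom_cst.
Qed.

(** For [s] in the cell starting at [t_i] the error is, up to sign,
    [(H - X_s) + (X_s - X_(t_i)) + X_0]. The square is at most 2, 4 and 4 times the respective
    squares; the second has expectation at most 1/N and the third is almost surely 0. *)
Let value_bound s : 0 <= s <= 1 ->
  Ex P (fun w => elementary_value xi a b s w ^+ 2) <=
  4 / N%:R + 2 * Ex P (fun w => (sp_value H s w - X s p w) ^+ 2).
Proof.
move=> s01; have /andP[s0 s1] := s01.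
have mV := mom_elementary_value a b mxi s.
have mD := mom_value s0.
have c0 : 0 <= Ex P (fun w => (sp_value H s w - X s p w) ^+ 2).
  by apply: Ex_ge0 => w; exact: sqr_ge0.
have [s_0|s_0] := eqVneq s 0.
  rewrite (eq_Ex _ (Y := cst 0)); last first.
    move=> w; rewrite s_0 /elementary_value big1 ?expr0n // => k _.
    by rewrite indicE memNset ?mulr0 //= in_itv /= ltNge a0.
  by rewrite Ex_cst addr_ge0 ?divr_ge0 // mulr_ge0.
have [|i /andP[is_ si]] := @grid_cell R N s N0; first by rewrite lt_neqAle eq_sym s_0.
have mG := mom_increment hX p (grid_ge0 R N i) (ltW is_).
have mS := mom_start p.
pose D w := sp_value H s w - X s p w.
have -> : 4 / N%:R + 2 * Ex P (fun w => D w ^+ 2) =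
    2 * Ex P (fun w => D w ^+ 2) + 4 * N%:R^-1 + 4 * Ex P (fun w => X 0 p w ^+ 2).
  by rewrite Ex_start2 mulr0 addr0 addrC.
have hG : Ex P (fun w => increment X (grid R N i) s p w ^+ 2) <= N%:R^-1.
  rewrite Ex_increment2 ?grid_ge0 ?(ltW is_) //.
  by rewrite -(gridS R i N0); lra.
apply: (@le_trans _ _ (2 * Ex P (fun w => D w ^+ 2) +
  4 * Ex P (fun w => increment X (grid R N i) s p w ^+ 2) +
  4 * Ex P (fun w => X 0 p w ^+ 2))); last by lra.
have m1 := momX 2 mD; have m2 := momX 2 mG; have m3 := momX 2 mS.
rewrite -(ExZ 2 m1) -(ExZ 4 m2) -(ExZ 4 m3).
rewrite -(ExD (momZ 2 m1) (momZ 4 m2)).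
rewrite -(ExD (momD (momZ 2 m1) (momZ 4 m2)) (momZ 4 m3)).
apply: Ex_le; [exact: momX| |].
  exact: momD (momD (momZ 2 m1) (momZ 4 m2)) (momZ 4 m3).
move=> w; rewrite EV // (@grid_cell_sum _ _ _ i); last by rewrite is_.
rewrite /D /increment /=.
move: (sp_value H s w) (X s p w) (X (grid R N i) p w) (X 0 p w) => h x g z.
have := sqr_ge0 ((h - x) - ((x - g) + z)).
have := sqr_ge0 ((x - g) - z).
by nra.
Qed.

Lemma riemann_sub_simple :
  ((Ex P (fun w => (riemann N p q w - sp_integral H (fun s => X s q) 1 w) ^+ 2))%:E <=
   (4 / N%:R)%:E + 2%:E * \int[lebesgue_measure]_(s in `[0%R, 1%R])
        'E_P[fun w => ((sp_value H s w - X s p w) ^+ 2)%R])%E.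
Proof.
rewrite (eq_Ex _ (Y := fun w => elementary_integral X xi a b q w ^+ 2)); last first.
  by move=> w; rewrite EI.
rewrite -(elementary_isometry hX q a0 ab b1 (@axi) mxi).
pose c s := Ex P (fun w => (sp_value H s w - X s p w) ^+ 2).
pose k : R := 4 / N%:R.
pose e s := Ex P (fun w => elementary_value xi a b s w ^+ 2).
(* A measurable minorant of the mean square distance [c]: by [value_bound], [e] is at most
   [k + 2 c], and [e] is measurable in [s] as the square of an elementary integrand. *)
pose h (s : measurableTypeR R) := Num.max 0 ((e s - k) / 2).
have k0 : 0 <= k by rewrite divr_ge0.
have e0 s : 0 <= e s by apply: Ex_ge0 => w; exact: sqr_ge0.
have me : measurable_fun (`[0%R, 1%R]%classic : set (measurableTypeR R)) e.
  exact: measurable_value_square.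
have h0 s : 0 <= h s by rewrite /h le_max lexx.
have mh : measurable_fun (`[0%R, 1%R]%classic : set (measurableTypeR R)) h.
  apply: measurable_maxr; first exact: measurable_cst.
  apply: measurable_funM; last exact: measurable_cst.
  by apply: measurable_funB; last exact: measurable_cst.
apply: (@le_trans _ _ (\int[lebesgue_measure]_(s in `[0%R, 1%R])
    (k%:E + 2%:E * (h s)%:E))%E).
  apply: ge0_subset_le_integral => s /=; rewrite in_itv /= => s01.
    by rewrite lee_fin; exact: e0.
  rewrite -EFinM -EFinD lee_fin -/(e s).
  have : (e s - k) / 2 <= h s by rewrite /h le_max lexx orbT.
  by lra.
have mhE : measurable_fun (`[0%R, 1%R]%classic : set (measurableTypeR R))
    (fun s => (h s)%:E) by exact/measurable_EFinP.
rewrite ge0_integralD //; first last.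
- by apply/measurable_EFinP; apply: measurable_funM => //; exact: measurable_cst.
- by move=> s _; rewrite -EFinM lee_fin mulr_ge0.
rewrite ge0_integralZl_EFin //; last by move=> s _; rewrite lee_fin.
apply: leeD.
  rewrite integral_cst //= lebesgue_measure_itv /= lte_fin ltr01.
  by rewrite sube0 mule1.
rewrite lee_pmul2l // ; apply: ge0_subset_le_integral => s /=; rewrite in_itv /= => s01.
  by rewrite lee_fin.
have s0 : 0 <= s by case/andP: s01.
rewrite unlock /= ExE; last by apply: momX; exact: mom_value.
rewrite lee_fin /h ge_max; apply/andP; split.
  by apply: Ex_ge0 => w; exact: sqr_ge0.
have := value_bound s01; rewrite -/(e s) -/k; lra.
Qed.

End simple.

(** Both sides are close to the integral of one good simple process: the Riemann sum by the
    isometry, [J] by definition. The square stays under an extended integral since [J] is not known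
    to have all moments. *)
Lemma riemann_cvg_ito (J : {RV P >-> R}) p q :
  is_ito_integral (natural_filtration X) (fun s => X s p) (fun s => X s q) 1 J ->
  forall eps : R, 0 < eps -> exists N0 : nat, forall N, (N0 < N)%N ->
    (\int[P]_w ((riemann N p q w - J w) ^+ 2)%:E <= eps%:E)%E.
Proof.
move=> [Hn [h1 h2]] eps e0.
(* The final budget is [2 (4 / N + 2 e) + 2 e = 8 / N + 6 e], with [8 / N <= eps / 2] and
   [6 e = 3 eps / 8]. *)
pose e := eps / 16; have e_gt0 : 0 < e by rewrite divr_gt0.
have {}h1 : \forall n \near \oo, (\int[lebesgue_measure]_(s in `[0%R, 1%R])
  'E_P[fun w => ((sp_value (Hn n) s w - X s p w) ^+ 2)%R] < e%:E)%E.
  by apply: (h1 [set x | (x < e%:E)%E]); apply: open_ereal_lt'; rewrite lte_fin.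
have {}h2 : \forall n \near \oo,
  ('E_P[fun w => ((sp_integral (Hn n) (fun s => X s q) 1 w - J w) ^+ 2)%R] < e%:E)%E.
  by apply: (h2 [set x | (x < e%:E)%E]); apply: open_ereal_lt'; rewrite lte_fin.
have [n _ hn] := filterI h1 h2.
have {hn} [{}h1 {}h2] := hn n (leqnn n).
exists (Num.truncn (16 / eps)) => N hN.
have N0 : (0 < N)%N by exact: leq_ltn_trans hN.
have hN8 : 8 / N%:R <= eps / 2.
  have h : 16 / eps <= N%:R.
    by rewrite (le_trans (ltW (truncnS_gt _))) // ler_nat.
  rewrite ler_pdivrMr ?ltr0n //; move: h; rewrite ler_pdivrMr //.
  lra.
have hS := riemann_sub_simple (Hn n) p q N0.
set I := sp_integral (Hn n) (fun s => X s q) 1 in h2 hS.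
have mI : measurable_fun setT I.
  apply: measurable_sum => i; apply: measurable_funM.
    have hc := @sp_coef_adapted _ _ _ _ (Hn n) i.
    by apply: (@adapted_measurable _ _ _ _ _ X (sp_time (Hn n) i)); apply/adaptedP.
  by apply: measurable_funB; exact: measurable_funPT.
have mS := mom_riemann N p q.
have mSm : measurable_fun setT (riemann N p q) by case: mS.
have mJ : measurable_fun setT J by exact: measurable_funPT.
apply: (@le_trans _ _ (\int[P]_w (2%:E * ((riemann N p q w - I w) ^+ 2)%:E
    + 2%:E * ((I w - J w) ^+ 2)%:E))%E).
  apply: ge0_subset_le_integral => w _; first by rewrite lee_fin sqr_ge0.
  rewrite -!EFinM -EFinD lee_fin.
  by have := sqr_ge0 ((riemann N p q w - I w) - (I w - J w)); lra.
have m1 : measurable_fun setT (fun w => ((riemann N p q w - I w) ^+ 2)%:E).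
  by apply/measurable_EFinP; apply: measurable_funX; exact: measurable_funB.
have m2 : measurable_fun setT (fun w => ((I w - J w) ^+ 2)%:E).
  by apply/measurable_EFinP; apply: measurable_funX; exact: measurable_funB.
rewrite ge0_integralD //; first last.
- exact: emeasurable_funM.
- by move=> w _; rewrite -EFinM lee_fin mulr_ge0 // sqr_ge0.
- exact: emeasurable_funM.
- by move=> w _; rewrite -EFinM lee_fin mulr_ge0 // sqr_ge0.
rewrite !ge0_integralZl_EFin //; first last.
- by move=> w _; rewrite lee_fin sqr_ge0.
- by move=> w _; rewrite lee_fin sqr_ge0.
have h2' : (\int[P]_w ((I w - J w) ^+ 2)%:E <= e%:E)%E.
  by have := ltW h2; rewrite unlock.
have mSI : mom P (fun w => (riemann N p q w - I w) ^+ 2).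
  apply: momX; apply: momB => //; apply: mom_sum => i _; apply: momM.
    have hc := @sp_coef_adapted _ _ _ _ (Hn n) i.
    have [M hM] := sp_coef_bounded (Hn n) i.
    apply: (mom_bounded P _ hM).
    by apply: (@adapted_measurable _ _ _ _ _ X (sp_time (Hn n) i)); apply/adaptedP.
  have t0 j : 0 <= sp_time (Hn n) j.
    exact: le_trans (sp_time_ge0 _) (sp_time_homo (Hn n) (leq0n j)).
  by apply: momB; apply: mom_bm; rewrite le_min t0 ler01.
rewrite ExE //.
have h3 : ((Ex P (fun w => (riemann N p q w - I w) ^+ 2))%:E <=
    (4 / N%:R)%:E + 2%:E * e%:E)%E.
  apply: (le_trans hS); apply: leeD => //.
  by rewrite lee_pmul2l // ltW.
apply: (@le_trans _ _ (2%:E * ((4 / N%:R)%:E + 2%:E * e%:E) + 2%:E * e%:E)%E).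
  by apply: leeD; rewrite lee_pmul2l.
rewrite lee_fin /e.
by move: hN8; set z := N%:R^-1; lra.
Qed.

End riemann_sums.

(** * The scalar expansion that produces the constant 2 *)

Section scalar_estimates.
Context (R : realType).
Implicit Types x y F G : R.

(** Young's inequality with weight [del], from the expansion of a square; the factor of [y ^+ 2]
    stays close to 1, which preserves the sharp constant. *)
Lemma sqr_split (del x y : R) : 0 < del ->
  x ^+ 2 <= (1 + del) * y ^+ 2 + (1 + del^-1) * (x - y) ^+ 2.
Proof.
move=> d0; have di0 : 0 < del^-1 by rewrite invr_gt0.
have h : 0 <= del * (y - del^-1 * (x - y)) ^+ 2 by rewrite mulr_ge0 ?sqr_ge0 // ltW.
have E : del * (y - del^-1 * (x - y)) ^+ 2 =
    del * y ^+ 2 - 2 * (x - y) * y + del^-1 * (x - y) ^+ 2 by field; rewrite gt_eqF.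
by move: h; rewrite E; set z := del^-1; lra.
Qed.

(** Turns a cubic error into a small quadratic one plus a quartic one, so that second and fourth
    moments are enough. *)
Lemma cube_split (tau y : R) : 0 < tau -> `|y| ^+ 3 <= tau * y ^+ 2 + tau^-1 * y ^+ 4.
Proof.
move=> t0; have ti0 : 0 < tau^-1 by rewrite invr_gt0.
have E2 : y ^+ 2 = `|y| ^+ 2 by rewrite real_normK ?num_real.
have E4 : y ^+ 4 = `|y| ^+ 4 by rewrite (exprM _ 2 2) E2 -exprM.
rewrite E2 E4; move: `|y| (normr_ge0 y) => z z0.
have h : 0 <= tau * z ^+ 2 * (1 - tau^-1 * z) ^+ 2.
  by rewrite mulr_ge0 ?sqr_ge0 // mulr_ge0 ?sqr_ge0 // ltW.
have E : tau * z ^+ 2 * (1 - tau^-1 * z) ^+ 2 =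
    tau * z ^+ 2 - 2 * z ^+ 3 + tau^-1 * z ^+ 4 by field; rewrite gt_eqF.
have z3 : 0 <= z ^+ 3 by rewrite exprn_ge0.
by move: h; rewrite E; set w := tau^-1; lra.
Qed.

(** With [D = F - G] and [a = G^2 + eps] the main term is [D^2 (F + G)^2 / (2 a)]. As
    [F + G = 2 G + D] and [G^2 <= a], it is at most [2 (1 + del) D^2] plus a quartic term; the cubic
    remainder contributes the third [del]. *)
Lemma ent_fun_sqr_le (del eps L : R) : 0 < del -> 0 < eps -> 0 < L ->
  exists2 C : R, 0 <= C & forall F G, `|F| <= L -> `|G| <= L ->
    ent_fun (F ^+ 2 + eps) (G ^+ 2 + eps) <=
    (2 + 3 * del) * (F - G) ^+ 2 + C * (F - G) ^+ 4.
Proof.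
move=> d0 e0 L0.
(* A bound for [|F + G|^3 / (2 a^2)], namely [(2 L)^3 / (2 eps^2)]; the next choice of [tau] makes
   [k * tau] equal to [del]. *)
pose k := 4 * L ^+ 3 / eps ^+ 2.
have k0 : 0 < k by rewrite divr_gt0 ?mulr_gt0 ?exprn_gt0.
pose tau := del / k.
have t0 : 0 < tau by rewrite divr_gt0.
have d1 : 0 < del^-1 by rewrite invr_gt0.
exists ((1 + del^-1) / (2 * eps) + k / tau).
  by rewrite addr_ge0 ?divr_ge0 ?addr_ge0 ?mulr_ge0 // ltW.
move=> F G FL GL.
have g0 : 0 < F ^+ 2 + eps by rewrite ltr_wpDl // sqr_ge0.
have a0 : 0 < G ^+ 2 + eps by rewrite ltr_wpDl // sqr_ge0.
apply: (le_trans (ent_fun_le g0 a0)).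
have -> : F ^+ 2 + eps - (G ^+ 2 + eps) = (F - G) * (F + G) by ring.
set D := F - G; set a := G ^+ 2 + eps in a0 *.
have ea : eps <= a by rewrite /a lerDr sqr_ge0.
have Ga : G ^+ 2 <= a by rewrite /a lerDl ltW.
have D2 : 0 <= D ^+ 2 by exact: sqr_ge0.
have D4 : 0 <= D ^+ 4 by rewrite exprn_even_ge0.
have h1 : (D * (F + G)) ^+ 2 / (2 * a) <=
    2 * (1 + del) * D ^+ 2 + (1 + del^-1) / (2 * eps) * D ^+ 4.
  rewrite ler_pdivrMr ?mulr_gt0 //.
  have := sqr_split (F + G) (2 * G) d0.
  have -> : F + G - 2 * G = D by rewrite /D; ring.
  move=> h; rewrite exprMn.
  apply: (@le_trans _ _ (D ^+ 2 * ((1 + del) * (2 * G) ^+ 2 + (1 + del^-1) * D ^+ 2))).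
    by rewrite ler_wpM2l.
  have p1 : (1 + del) * D ^+ 2 * (4 * G ^+ 2) <= (1 + del) * D ^+ 2 * (4 * a).
    apply: ler_wpM2l; last by lra.
    by rewrite mulr_ge0 // addr_ge0 // ltW.
  have p2 : (1 + del^-1) * D ^+ 4 <= (1 + del^-1) / (2 * eps) * D ^+ 4 * (2 * a).
    have -> : (1 + del^-1) / (2 * eps) * D ^+ 4 * (2 * a) =
       (1 + del^-1) * D ^+ 4 * (a / eps).
      by move: (del^-1) => di; field; rewrite gt_eqF.
    rewrite ler_peMr ?ler_pdivlMr ?mul1r //.
    by rewrite mulr_ge0 ?addr_ge0 // ltW.
  by move: p1 p2; set z := del^-1; set u := (1 + z) / _; lra.
have h2 : `|D * (F + G)| ^+ 3 / (2 * a ^+ 2) <= k * `|D| ^+ 3.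
  rewrite normrM exprMn ler_pdivrMr ?mulr_gt0 ?exprn_gt0 //.
  have FG : `|F + G| ^+ 3 <= 8 * L ^+ 3.
    have -> : 8 * L ^+ 3 = (2 * L) ^+ 3 by ring.
    rewrite lerXn2r ?nnegrE ?mulr_ge0 ?(ltW L0) //.
    by rewrite (le_trans (ler_normD _ _)) //; lra.
  have -> : k * `|D| ^+ 3 * (2 * a ^+ 2) = `|D| ^+ 3 * (8 * L ^+ 3 * (a ^+ 2 / eps ^+ 2)).
    by rewrite /k; field; rewrite gt_eqF.
  rewrite ler_wpM2l ?exprn_ge0 // (le_trans FG) //; apply: ler_peMr.
    by rewrite mulr_ge0 ?exprn_ge0 // ltW.
  rewrite ler_pdivlMr ?exprn_gt0 // mul1r lerXn2r ?nnegrE //; exact: ltW.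
have h3 := cube_split D t0.
have h4 : k * `|D| ^+ 3 <= del * D ^+ 2 + k / tau * D ^+ 4.
  have -> : del * D ^+ 2 + k / tau * D ^+ 4 = k * (tau * D ^+ 2 + tau^-1 * D ^+ 4).
    by rewrite /tau; field; rewrite !gt_eqF.
  by rewrite ler_pM2l.
by move: h1 h2 h4; set u := k / tau; set v := (1 + del^-1) / _; lra.
Qed.

End scalar_estimates.

Definition real_entropy disp (T : measurableType disp) (R : realType)
    (P : probability T R) (u : T -> R) : R :=
  Ex P (fun w => u w * ln (u w)) - Ex P u * ln (Ex P u).

(** * Entropy bound for a point that is affine in each independent coordinate *)

Section coordinate_estimate.
Context disp (T : measurableType disp) (R : realType) (P : probability T R).
Context (K : finType) (mu : K -> probability R R).
Variable xi : T -> coords K R.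
Hypothesis mxi : forall k, mom P (fun w => xi w k).
Hypothesis Pxi : indep_coords P mu xi.
Hypothesis mmu : forall k, mom (mu k) id.

Let mxi' k : measurable_fun setT (fun w => xi w k). Proof. by case: (mxi k). Qed.

Lemma Ex_coord_expn k m (phi : coords K R -> R) : ~~ odd m ->
  measurable_fun setT phi -> (forall x, 0 <= phi x) ->
  (forall x v, phi (upd k x v) = phi x) -> mom P (fun w => phi (xi w)) ->
  Ex P (fun w => xi w k ^+ m * phi (xi w)) =
  Ex (mu k) (fun v => v ^+ m) * Ex P (fun w => phi (xi w)).
Proof.
move=> em mphi phi0 phik mphiP.
have even0 (v : R) : 0 <= v ^+ m by rewrite exprn_even_ge0.
have mk := mxi k.
apply: EFin_inj; rewrite EFinM -!ExE //; [|exact: momX|by mom].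
rewrite (resampling mxi' Pxi k (F := fun x => (x k ^+ m * phi x)%:E)); last 2 first.
- apply/measurable_EFinP; apply: measurable_funM => //.
  by apply: measurable_funX; exact: measurable_coord.
- by move=> x; rewrite lee_fin mulr_ge0.
have inner w : (\int[mu k]_v (upd k (xi w) v k ^+ m * phi (upd k (xi w) v))%:E =
    (\int[mu k]_v (v ^+ m)%:E) * (phi (xi w))%:E)%E.
  under eq_integral do rewrite updE phik EFinM.
  rewrite ge0_integralZr //.
  - by apply/measurable_EFinP; exact: exprn_measurable.
  - by move=> v _; rewrite lee_fin.
  - by rewrite lee_fin.
under eq_integral do rewrite inner.
rewrite ge0_integralZl //.
- by apply/measurable_EFinP; case: mphiP.
- by move=> w _; rewrite lee_fin.
- by apply: integral_ge0 => v _; rewrite lee_fin.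
Qed.

Variables (n : nat) (f : 'rV[R]_n -> R) (L : R).
Hypothesis L0 : 0 < L.
Hypothesis hf : schwartz f.
Hypothesis f0 : forall x, `|f x| <= L.
Hypothesis f1 : forall i x, `|partial i f x| <= L.
Hypothesis f2 : forall i j x, `|partial i (partial j f) x| <= L.

Variables (Y : coords K R -> 'rV[R]_n) (V : K -> coords K R -> 'rV[R]_n).
Hypothesis mY : forall i, measurable_fun setT (fun x => Y x 0 i).
Hypothesis mV : forall k i, measurable_fun setT (fun x => V k x 0 i).
Hypothesis momV : forall k i, mom P (fun w => V k (xi w) 0 i).
Hypothesis YV : forall k x v, Y (upd k x v) = Y (upd k x 0) + v *: V k x.
Hypothesis Vk : forall k x v, V k (upd k x v) = V k x.

Variables (s2 c4 : R).
Hypothesis mu2 : forall k, Ex (mu k) (fun v => v ^+ 2) = s2.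
Hypothesis mu4 : forall k, Ex (mu k) (fun v => v ^+ 4) <= c4 * s2 ^+ 2.

(** Taken where coordinate [k] is 0, hence independent of that coordinate, whose variance then
    factors out. *)
Let D0 k x := dirder f (Y (upd k x 0)) (V k x).
Let g x := f (Y x).

Let mYrV : measurable_fun setT (Y : coords K R -> borel_rV R n).
Proof. exact: measurable_fun_rV. Qed.

Let mg : measurable_fun setT g.
Proof. exact: (measurableT_comp (schwartz_measurable hf) mYrV). Qed.

Let mD0 k : measurable_fun setT (D0 k).
Proof.
apply: measurable_sum => i; apply: measurable_funM; first exact: mV.
have := measurableT_comp (schwartz_measurable1 i hf) mYrV => mp.
exact: (measurableT_comp mp (measurable_updl k 0)).
Qed.

Let mom_norm1 k : mom P (fun w => norm1 (V k (xi w))).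
Proof. by apply: mom_sum => i _; apply: mom_norm. Qed.

Let mom_D0 k : mom P (fun w => D0 k (xi w)).
Proof.
apply: mom_sum => i _; apply: momM => //.
have mp := measurableT_comp (schwartz_measurable1 i hf) mYrV.
apply: (mom_bounded P (M := L)) => //.
apply: (measurableT_comp (measurableT_comp mp (measurable_updl k 0))).
exact: measurable_coords.
Qed.

Let mnorm1 k : measurable_fun setT (fun x => norm1 (V k x)).
Proof.
by apply: measurable_sum => i; apply: measurableT_comp => //; exact: normr_measurable.
Qed.

Variables (del eps C1 : R).
Hypothesis del01 : 0 < del <= 1.
Hypothesis eps0 : 0 < eps.
Hypothesis C10 : 0 <= C1.
Hypothesis hC1 : forall F G, `|F| <= L -> `|G| <= L ->
  ent_fun (F ^+ 2 + eps) (G ^+ 2 + eps) <=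
  (2 + 3 * del) * (F - G) ^+ 2 + C1 * (F - G) ^+ 4.

Let C := (2 + 3 * del) * (1 + del^-1) * L ^+ 2 + C1 * L ^+ 4.

(** Taylor replaces the increment of [g] by [x k * D0 k x] up to a quadratic error, and
    [(2 + 3 del) (1 + del) <= 2 + 8 del] because [del <= 1]. The fourth power of the increment is
    handled by the Lipschitz bound. *)
Lemma pointwise_estimate k x :
  ent_fun (g x ^+ 2 + eps) (g (upd k x 0) ^+ 2 + eps) <=
  (2 + 8 * del) * (x k ^+ 2 * D0 k x ^+ 2) + C * (x k ^+ 4 * norm1 (V k x) ^+ 4).
Proof.
have /andP[d0 d1] := del01.
have di0 : 0 < del^-1 by rewrite invr_gt0.
apply: (le_trans (hC1 (f0 _) (f0 _))).
have Yx : Y x = Y (upd k x 0) + x k *: V k x by rewrite -YV upd_same.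
set De := g x - g (upd k x 0); set v := norm1 (V k x).
have v0 : 0 <= v := norm1_ge0 _.
have t2 : `|De - x k * D0 k x| <= L * x k ^+ 2 * v ^+ 2.
  by rewrite /De /g Yx; exact: taylor2.
have l1 : `|De| <= L * (`|x k| * v).
  rewrite /De /g (le_trans (lip_f hf f1 _ _)) //.
  by rewrite Yx (addrC (Y _)) addrK norm1Z.
have De2 : De ^+ 2 <= (1 + del) * (x k ^+ 2 * D0 k x ^+ 2) +
    (1 + del^-1) * (L ^+ 2 * (x k ^+ 4 * v ^+ 4)).
  apply: (le_trans (sqr_split De (x k * D0 k x) d0)).
  rewrite exprMn lerD2l ler_wpM2l //; first by rewrite addr_ge0 // ltW.
  have -> : L ^+ 2 * (x k ^+ 4 * v ^+ 4) = (L * x k ^+ 2 * v ^+ 2) ^+ 2 by ring.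
  rewrite -[X in X <= _]real_normK ?num_real // lerXn2r ?nnegrE //.
  by rewrite mulr_ge0 ?sqr_ge0 // mulr_ge0 ?sqr_ge0 // ltW.
have De4 : De ^+ 4 <= L ^+ 4 * (x k ^+ 4 * v ^+ 4).
  have -> : De ^+ 4 = `|De| ^+ 4 by rewrite -normrX ger0_norm // exprn_even_ge0.
  have -> : L ^+ 4 * (x k ^+ 4 * v ^+ 4) = (L * (`|x k| * v)) ^+ 4.
    have -> : x k ^+ 4 = `|x k| ^+ 4 by rewrite -normrX ger0_norm // exprn_even_ge0.
    by ring.
  by rewrite lerXn2r ?nnegrE // !mulr_ge0 // ltW.
set A := x k ^+ 2 * _ in De2 *; set B := x k ^+ 4 * _ in De2 De4 *.
have A0 : 0 <= A by rewrite mulr_ge0 ?sqr_ge0.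
have h1 : (2 + 3 * del) * De ^+ 2 <=
    (2 + 3 * del) * ((1 + del) * A + (1 + del^-1) * (L ^+ 2 * B)).
  by rewrite ler_wpM2l // addr_ge0 // mulr_ge0 // ltW.
have h2 : C1 * De ^+ 4 <= C1 * (L ^+ 4 * B) by rewrite ler_wpM2l.
have h3 : (2 + 3 * del) * ((1 + del) * A) <= (2 + 8 * del) * A.
  by rewrite mulrA ler_wpM2r //; nra.
by rewrite /C; move: h1 h2 h3; set z := del^-1; lra.
Qed.

Lemma discrete_entropy_bound :
  real_entropy P (fun w => f (Y (xi w)) ^+ 2 + eps) <=
  \sum_k ((2 + 8 * del) * (s2 * Ex P (fun w => D0 k (xi w) ^+ 2)) +
    C * c4 * (s2 ^+ 2 * Ex P (fun w => norm1 (V k (xi w)) ^+ 4))).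
Proof.
have /andP[d0 d1] := del01.
have C0 : 0 <= C.
  rewrite addr_ge0 // mulr_ge0 ?exprn_ge0 ?(ltW L0) // mulr_ge0 // addr_ge0 ?mulr_ge0 ?(ltW d0) //.
  by rewrite invr_ge0 ltW.
have bg (h : coords K R -> R) : measurable_fun setT h -> (forall x, `|h x| <= L) ->
    between eps (L ^+ 2 + eps) (fun x : coords K R => h x ^+ 2 + eps).
  move=> mh hL; split; first by apply: measurable_funD => //; exact: measurable_funX.
  move=> x; rewrite lerDr sqr_ge0 lerD2r /=.
  by rewrite -[h x ^+ 2]real_normK ?num_real // lerXn2r ?nnegrE // ltW.
have b1 := bg g mg (fun x => f0 (Y x)).
(* The comparison function of coordinate [k] in the tensorised inequality: the value with [x k] set
   to 0. *)
have b2 k := bg (fun x => g (upd k x 0)) (measurableT_comp mg (measurable_updl k 0))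
  (fun x => f0 _).
have b2k k x v : g (upd k (upd k x v) 0) ^+ 2 + eps = g (upd k x 0) ^+ 2 + eps.
  by rewrite upd_upd.
apply: (le_trans (entropy_tensorisation mxi' Pxi eps0 b1 b2 b2k)).
apply: ler_sum => k _.
have mN := mom_norm1 k; have mD := mom_D0 k; have mk := mxi k.
have mA : mom P (fun w => xi w k ^+ 2 * D0 k (xi w) ^+ 2) by mom.
have mB : mom P (fun w => xi w k ^+ 4 * norm1 (V k (xi w)) ^+ 4) by mom.
apply: (@le_trans _ _ (Ex P (fun w => (2 + 8 * del) * (xi w k ^+ 2 * D0 k (xi w) ^+ 2)
    + C * (xi w k ^+ 4 * norm1 (V k (xi w)) ^+ 4)))).
  apply: Ex_le => [| |w]; [|exact: momD (momZ _ mA) (momZ _ mB)|exact: pointwise_estimate].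
  exact: (mom_ent_fun P mxi' eps0 b1 (b2 k)).
rewrite (ExD (momZ _ mA) (momZ _ mB)) (ExZ _ mA) (ExZ _ mB).
rewrite (Ex_coord_expn (phi := fun x => D0 k x ^+ 2)) //; last 4 first.
- by apply: measurable_funX.
- by move=> x; exact: sqr_ge0.
- by move=> x v; rewrite /D0 upd_upd Vk.
- exact: momX.
rewrite (Ex_coord_expn (phi := fun x => norm1 (V k x) ^+ 4)) //; last 4 first.
- by apply: measurable_funX.
- by move=> x; rewrite exprn_ge0 // norm1_ge0.
- by move=> x v; rewrite Vk.
- exact: momX.
rewrite mu2 lerD2l -mulrA ler_wpM2l // [c4 * _]mulrA ler_wpM2r //.
by apply: Ex_ge0 => w; rewrite exprn_ge0 // norm1_ge0.
Qed.

End coordinate_estimate.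

(** * Algebra of the area as a quadratic polynomial in the increments *)

Section sums.
Context (R : realType).

(** Lagrange's identity: the difference of the two sides is half the double sum of the squares
    [(a i - a j) ^+ 2]. *)
Lemma sqr_sum_le (I : finType) (a : I -> R) :
  (\sum_i a i) ^+ 2 <= #|I|%:R * \sum_i a i ^+ 2.
Proof.
have h : 0 <= \sum_i \sum_j (a i - a j) ^+ 2.
  by apply: sumr_ge0 => i _; apply: sumr_ge0 => j _; exact: sqr_ge0.
suff E : \sum_i \sum_j (a i - a j) ^+ 2 =
    2 * (#|I|%:R * \sum_i a i ^+ 2 - (\sum_i a i) ^+ 2).
  by move: h; rewrite E; lra.
have inner i : \sum_j (a i - a j) ^+ 2 =
    #|I|%:R * a i ^+ 2 - 2 * (a i * \sum_j a j) + \sum_j a j ^+ 2.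
  rewrite (eq_bigr (fun j => a i ^+ 2 - 2 * (a i * a j) + a j ^+ 2)); last first.
    by move=> j _; ring.
  by rewrite !big_split /= sumr_const -(mulr_natl (a i ^+ 2)) sumrN -!mulr_sumr.
under eq_bigr do rewrite inner.
rewrite !big_split /= sumrN -!mulr_sumr -mulr_suml sumr_const.
rewrite -(mulr_natl (\sum_j a j ^+ 2)) -[#|xpredT|]/#|I|.
by ring.
Qed.

Lemma expr4_sum_le (I : finType) (a : I -> R) :
  (\sum_i a i) ^+ 4 <= #|I|%:R ^+ 3 * \sum_i a i ^+ 4.
Proof.
have h1 := sqr_sum_le a; have h2 := sqr_sum_le (fun i => a i ^+ 2).
rewrite (exprM _ 2 2).
apply: (@le_trans _ _ ((#|I|%:R * \sum_i a i ^+ 2) ^+ 2)).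
  rewrite lerXn2r ?nnegrE ?sqr_ge0 // mulr_ge0 //.
  by apply: sumr_ge0 => i _; exact: sqr_ge0.
rewrite exprMn (exprSr _ 2) -mulrA ler_wpM2l ?exprn_ge0 //.
apply: (le_trans h2); rewrite le_eqVlt; apply/orP; left; apply/eqP.
by congr (_ * _); apply: eq_bigr => i _; rewrite -exprM.
Qed.

(** A zero diagonal entry leaves no term in [v ^+ 2]; the slope is the polar form against the k-th
    basis vector. *)
Lemma quadratic_upd (K : finType) (c : K -> K -> R) (k : K) (x : coords K R) (v : R) :
  c k k = 0 ->
  \sum_a \sum_b c a b * (upd k x v a * upd k x v b) =
  \sum_a \sum_b c a b * (upd k x 0 a * upd k x 0 b)
    + v * \sum_b (c k b + c b k) * x b.
Proof.
move=> ckk.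
pose y := upd k x 0.
have yE a : upd k x v a = y a + v * (a == k)%:R.
  by rewrite /y /upd; case: eqP => _; rewrite ?mulr1 ?mulr0 ?add0r ?addr0.
have sx : \sum_b (c k b + c b k) * x b = \sum_b (c k b + c b k) * y b.
  apply: eq_bigr => b _; rewrite /y /upd; case: eqP => [->|//].
  by rewrite ckk addr0 !mul0r.
have pick (F : K -> R) : \sum_b F b * (b == k)%:R = F k.
  rewrite (bigD1 k) //= eqxx mulr1 big1 ?addr0 // => b /negbTE ->.
  by rewrite mulr0.
have inner a : \sum_b c a b * (upd k x v a * upd k x v b) =
    \sum_b c a b * (y a * y b) + v * (c a k * y a)
    + ((v * \sum_b c a b * y b) + v ^+ 2 * c a k) * (a == k)%:R.
  rewrite (eq_bigr (fun b => c a b * (y a * y b) +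
    (v * (c a b * y a)) * (b == k)%:R + v * (a == k)%:R * (c a b * y b)
    + (v ^+ 2 * (a == k)%:R * c a b) * (b == k)%:R)); last first.
    by move=> b _; rewrite !yE; ring.
  by rewrite !big_split /= !pick -mulr_sumr; ring.
under eq_bigr do rewrite inner.
rewrite !big_split /= pick ckk mulr0 addr0 sx -addrA; congr (_ + _).
rewrite -mulr_sumr -mulrDr addrC; congr (_ * _).
by rewrite -big_split /=; apply: eq_bigr => b _; rewrite mulrDl.
Qed.

Lemma polar_upd (K : finType) (c : K -> K -> R) (k : K) (x : coords K R) (v : R) :
  c k k = 0 ->
  \sum_b (c k b + c b k) * upd k x v b = \sum_b (c k b + c b k) * x b.
Proof.
move=> ckk; apply: eq_bigr => b _; rewrite /upd; case: eqP => [->|//].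
by rewrite ckk addr0 !mul0r.
Qed.

End sums.

Section area_polynomial.
Context (R : realType) (d m N : nat) (B : 'I_m -> 'M[R]_d).
Hypothesis Bskew : forall l, (B l)^T = - B l.
Local Notation K := ('I_N * 'I_d)%type.

Lemma skew_diag l p : B l p p = 0.
Proof. by have := congr1 (fun M : 'M[R]_d => M p p) (Bskew l); rewrite !mxE; lra. Qed.

Lemma skew_sym l p q : B l q p = - B l p q.
Proof. by have := congr1 (fun M : 'M[R]_d => M p q) (Bskew l); rewrite !mxE. Qed.

(** For fixed components this sums products of increments over [i < i'], a discrete iterated
    integral. The strict order makes the diagonal vanish, and the whole matrix replaces the pairs
    [p < q]. *)
Definition area_coef (l : 'I_m) (k k' : K) : R := B l k.2 k'.2 * (k.1 < k'.1)%N%:R.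

Definition area_point (x : coords K R) : 'rV[R]_(d + m) :=
  row_mx (\row_p \sum_(i < N) x (i, p))
    (\row_l \sum_k \sum_k' area_coef l k k' * (x k * x k')).

Definition area_dir (k : K) (x : coords K R) : 'rV[R]_(d + m) :=
  row_mx (\row_p (p == k.2)%:R)
    (\row_l \sum_k' (area_coef l k k' + area_coef l k' k) * x k').

Lemma area_coef_diag l k : area_coef l k k = 0.
Proof. by rewrite /area_coef ltnn mulr0. Qed.

Lemma area_point_upd k x v :
  area_point (upd k x v) = area_point (upd k x 0) + v *: area_dir k x.
Proof.
rewrite /area_point /area_dir scale_row_mx add_row_mx; congr row_mx.
  apply/rowP => p; rewrite !mxE; case: k => i p'.
  have E u : \sum_(j < N) upd (i, p') x u (j, p) =
      \sum_(j < N | j != i) upd (i, p') x 0 (j, p) +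
      (if p == p' then u else x (i, p)).
    rewrite (bigD1 i) //= addrC; congr (_ + _).
      by apply: eq_bigr => j /negbTE ji; rewrite /upd xpair_eqE ji.
    by rewrite /upd xpair_eqE eqxx.
  by rewrite !E /=; case: eqP => _; rewrite ?mulr1 ?mulr0 ?addr0.
apply/rowP => l; rewrite !mxE quadratic_upd //; exact: area_coef_diag.
Qed.

Lemma area_dir_upd k x v : area_dir k (upd k x v) = area_dir k x.
Proof.
rewrite /area_dir; congr row_mx; apply/rowP => l; rewrite !mxE.
by apply: polar_upd; exact: area_coef_diag.
Qed.

Lemma measurable_area_point i :
  measurable_fun setT (fun x : coords K R => area_point x 0 i).
Proof.
case: (split_ordP i) => j ->.
  rewrite (_ : (fun _ => _) = fun x : coords K R => \sum_(i < N) x (i, j)).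
    by apply: measurable_sum => k; exact: (@measurable_coord K R (k, j)).
  by apply/funext => x; rewrite row_mxEl mxE.
rewrite (_ : (fun _ => _) = fun x : coords K R =>
  \sum_k \sum_k' area_coef j k k' * (x k * x k')).
  apply: measurable_sum => k; apply: measurable_sum => k'.
  apply: measurable_funM; first exact: measurable_cst.
  by apply: measurable_funM; exact: measurable_coord.
by apply/funext => x; rewrite row_mxEr mxE.
Qed.

Lemma measurable_area_dir k i :
  measurable_fun setT (fun x : coords K R => area_dir k x 0 i).
Proof.
case: (split_ordP i) => j ->.
  rewrite (_ : (fun _ => _) = fun x : coords K R => (j == k.2)%:R).
    exact: measurable_cst.
  by apply/funext => x; rewrite row_mxEl mxE.
rewrite (_ : (fun _ => _) = fun x : coords K R =>
  \sum_k' (area_coef j k k' + area_coef j k' k) * x k').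
  apply: measurable_sum => k'.
  by apply: measurable_funM; [exact: measurable_cst|exact: measurable_coord].
by apply/funext => x; rewrite row_mxEr mxE.
Qed.

(** By skew-symmetry [- B l p q * F q p] equals [B l q p * F q p], which supplies the entries below
    the diagonal. *)
Lemma area_sum l (F : 'I_d -> 'I_d -> R) :
  \sum_(p < d) \sum_(q < d | (p < q)%N) B l p q * (F p q - F q p) =
  \sum_(p < d) \sum_(q < d) B l p q * F p q.
Proof.
have E1 : \sum_(p < d) \sum_(q < d | (p < q)%N) B l p q * (F p q - F q p) =
    \sum_(p < d) \sum_(q < d | (p < q)%N) B l p q * F p q +
    \sum_(q < d) \sum_(p < d | (p < q)%N) B l q p * F q p.
  rewrite [X in _ + X](exchange_big_dep predT) //= -big_split /=.
  apply: eq_bigr => p _; rewrite -big_split /=; apply: eq_bigr => q _.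
  by rewrite (skew_sym l p q); ring.
rewrite E1 -big_split /=; apply: eq_bigr => p _.
rewrite [RHS](bigID (fun q : 'I_d => (p < q)%N)) /=; congr (_ + _).
rewrite [RHS](bigD1 p) ?ltnn //= skew_diag mul0r add0r.
by apply: eq_bigl => q; rewrite -leqNgt ltn_neqAle andbC.
Qed.

End area_polynomial.

Section area_increments.
Context disp (T : measurableType disp) (R : realType) (P : probability T R).
Context (d m : nat) (X : R -> 'I_d -> {RV P >-> R}) (B : 'I_m -> 'M[R]_d).
Hypothesis Bskew : forall l, (B l)^T = - B l.
Variable N : nat.
Hypothesis N0 : (0 < N)%N.
Local Notation xi := (@grid_increments _ T R P d X N (grid R N)).

Lemma sum_grid_increments p w : \sum_(i < N) xi w (i, p) = X 1 p w - X 0 p w.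
Proof.
have := @sum_increments R (fun i => X (grid R N i) p w) N N (leqnn N).
by rewrite gridn // grid0 => <-; apply: eq_bigl => i; rewrite ltn_ord.
Qed.

(** For fixed components and a fixed later step, the increments over the earlier steps telescope to
    the integrand of the Riemann sum. *)
Lemma area_point_riemann w : area_point B (xi w) =
  row_mx (\row_p (X 1 p w - X 0 p w))
    (\row_l \sum_(p < d) \sum_(q < d) B l p q * riemann X N p q w).
Proof.
congr row_mx; apply/rowP => j; rewrite !mxE; first exact: sum_grid_increments.
rewrite -(pair_bigA _ (fun i p => \sum_k' area_coef B j (i, p) k' *
  (xi w (i, p) * xi w k'))) /= exchange_big /=; apply: eq_bigr => p _.
rewrite (eq_bigr (fun i => \sum_(q < d) \sum_(i' < N)
   area_coef B j (i, p) (i', q) * (xi w (i, p) * xi w (i', q)))); last first.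
  move=> i _; rewrite exchange_big /= pair_bigA; by apply: eq_bigr => -[].
rewrite exchange_big /=; apply: eq_bigr => q _.
rewrite exchange_big /= mulr_sumr; apply: eq_bigr => i' _.
rewrite /riemann /=.
have := @sum_increments R (fun i => X (grid R N i) p w) N i' (ltnW (ltn_ord i')).
rewrite grid0 => <-; rewrite mulr_suml mulr_sumr [RHS]big_mkcond /=.
apply: eq_bigr => i _; rewrite /area_coef /grid_increments /=.
by case: ltnP => _; rewrite ?mulr1 ?mulr0 ?mul0r.
Qed.

(** Increments after step [i] count positively and those before it negatively; with both ends of the
    cell near [s] this approximates [X_1 - 2 X_s]. *)
Definition dir_coord (i : nat) (q : 'I_d) (w : T) : R :=
  increment X (grid R N i.+1) 1 q w - increment X 0 (grid R N i) q w.

Lemma area_dir_increments (i : 'I_N) p w : area_dir B (i, p) (xi w) =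
  row_mx (\row_p' (p' == p)%:R) (\row_l \sum_(q < d) B l p q * dir_coord i q w).
Proof.
congr row_mx; apply/rowP => l; rewrite !mxE.
rewrite -(pair_bigA _ (fun i' q => (area_coef B l (i, p) (i', q) +
  area_coef B l (i', q) (i, p)) * xi w (i', q))) /= exchange_big /=.
apply: eq_bigr => q _.
rewrite (eq_bigr (fun i' : 'I_N => B l p q * (((i < i')%N%:R - (i' < i)%N%:R)
    * xi w (i', q)))); last first.
  by move=> i' _; rewrite /area_coef /= (skew_sym Bskew l p q); ring.
rewrite -mulr_sumr; congr (_ * _); rewrite /dir_coord /=.
have h1 : \sum_(i' < N | (i' < i)%N) xi w (i', q) =
    X (grid R N i) q w - X (grid R N 0) q w.
  exact: (@sum_increments R (fun i => X (grid R N i) q w) N i (ltnW (ltn_ord i))).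
have h2 : \sum_(i' < N | (i' < i.+1)%N) xi w (i', q) =
    X (grid R N i.+1) q w - X (grid R N 0) q w.
  exact: (@sum_increments R (fun i => X (grid R N i) q w) N i.+1 (ltn_ord i)).
have h3 := sum_grid_increments q w.
(* The sign pattern, 1 after [i] and -1 before it, is written as 1 minus the indicators of
   [i' < i + 1] and [i' < i], giving three telescoping sums. *)
rewrite (eq_bigr (fun i' : 'I_N => xi w (i', q)
   - (if (i' < i.+1)%N then xi w (i', q) else 0)
   - (if (i' < i)%N then xi w (i', q) else 0))); last first.
  move=> i' _; rewrite ltnS.
  by case: (ltngtP i' i) => _ /=; ring.
rewrite 2!big_split /= !sumrN -!big_mkcond /= h3 h1 h2 grid0; ring.
Qed.

End area_increments.

(** * Convergence of the grid point to the endpoint *)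

Section limit.
Context disp (T : measurableType disp) (R : realType) (P : probability T R).
Context (d m : nat) (X : R -> 'I_d -> {RV P >-> R}) (B : 'I_m -> 'M[R]_d).
Hypothesis Bskew : forall l, (B l)^T = - B l.
Hypothesis hX : standard_brownian_motion X.
Variable J : 'I_d -> 'I_d -> R -> {RV P >-> R}.
Hypothesis hJ : forall p q, is_ito_integral (natural_filtration X)
  (fun s => X s p) (fun s => X s q) 1 (J p q 1).

Local Notation increments N := (@grid_increments _ T R P d X N (grid R N)).
Local Notation law N := (@grid_law _ T R P d X N (grid R N)).

Lemma indep_increments N : (0 < N)%N -> indep_coords P (law N) (increments N).
Proof.
move=> N0; apply: (bm_indep_coords hX).
- exact: grid_ge0.
- by move=> i j; exact: grid_le.
- by move=> i _; rewrite -subr_gt0 gridS // invr_gt0 ltr0n.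
Qed.

Lemma Ex_law N k (g : R -> R) : measurable_fun setT g -> (forall x, 0 <= g x) ->
  Ex (law N k) g = Ex P (fun w => g (increments N w k)).
Proof.
move=> mg g0; rewrite /Ex ge0_integral_distribution //; first exact/measurable_EFinP.
Qed.

Lemma mom_grid_increments N k : mom P (fun w => increments N w k).
Proof. by apply: (mom_increment hX); [exact: grid_ge0|exact: grid_le]. Qed.

Lemma mom_law N k : mom (law N k) id.
Proof.
split=> [|j]; first exact: measurable_id.
rewrite ge0_integral_distribution //; first exact: (mom_grid_increments k).2.
by apply/measurable_EFinP; apply: measurable_funX; exact: normr_measurable.
Qed.

Definition c4 : R := 48 * expR 1.

Lemma c4_ge0 : 0 <= c4. Proof. by rewrite mulr_ge0 // expR_ge0. Qed.

Lemma law_second_moment N k : (0 < N)%N -> Ex (law N k) (fun v => v ^+ 2) = N%:R^-1.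
Proof.
move=> N0; rewrite Ex_law; [|exact: exprn_measurable|by move=> x; exact: sqr_ge0].
rewrite -(gridS R k.1 N0).
exact: (Ex_increment2 hX k.2 (grid_ge0 R N k.1) (grid_le R N (leqnSn _))).
Qed.

Lemma law_fourth_moment N k : (0 < N)%N ->
  Ex (law N k) (fun v => v ^+ 4) <= c4 * N%:R^-1 ^+ 2.
Proof.
move=> N0; rewrite Ex_law; [|exact: exprn_measurable|by move=> x; rewrite exprn_even_ge0].
rewrite -(gridS R k.1 N0).
exact: (Ex_increment4 hX k.2 (grid_ge0 R N k.1) (grid_le R N (leqnSn _))).
Qed.

Definition endpoint (w : T) : 'rV[R]_(d + m) := bm_levy_area X B J 1 w.

Lemma measurable_endpoint : measurable_fun setT (endpoint : T -> borel_rV R (d + m)).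
Proof. exact: measurable_bm_levy_area. Qed.

Lemma endpointE w : endpoint w = row_mx (\row_p X 1 p w)
  (\row_l \sum_(p < d) \sum_(q < d) B l p q * J p q 1 w).
Proof.
congr row_mx; apply/rowP => l; rewrite !mxE.
exact: (area_sum Bskew l (fun p q => J p q 1 w)).
Qed.

Lemma measurable_coord_rV n i : measurable_fun setT (fun y : borel_rV R n => y 0 i).
Proof. by apply: continuous_measurable_rV => x; exact: coord_continuous. Qed.

Definition rho N w := norm1 (area_point B (increments N w) - endpoint w).

(* Truncated because [J] is only known to be square-integrable, whereas [mom]
   asks for all moments; [f] being bounded, nothing is lost. *)
Definition zeta N w := Num.min 2 (rho N w).

Lemma rho_ge0 N w : 0 <= rho N w. Proof. exact: norm1_ge0. Qed.

Lemma zeta_ge0 N w : 0 <= zeta N w.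
Proof. by rewrite le_min ler0n rho_ge0. Qed.

Lemma zeta_le2 N w : zeta N w <= 2.
Proof. by rewrite ge_min lexx. Qed.

Lemma measurable_zeta N : measurable_fun setT (zeta N).
Proof.
apply: measurable_minr; first exact: measurable_cst.
apply: measurable_sum => i; apply: measurableT_comp; first exact: normr_measurable.
rewrite (_ : (fun _ => _) = fun w => area_point B (increments N w) 0 i - endpoint w 0 i).
  apply: measurable_funB.
    apply: (measurableT_comp (measurable_area_point _ i)).
    by apply: measurable_coords => k; case: (mom_grid_increments k).
  exact: (measurableT_comp (measurable_coord_rV i) measurable_endpoint).
by apply/funext => w; rewrite !mxE.
Qed.

Lemma mom_zeta N : mom P (zeta N).
Proof.
apply: (mom_bounded P (measurable_zeta N) (M := 2)) => w.
by rewrite ger0_norm ?zeta_ge0 ?zeta_le2.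
Qed.

Lemma norm1_row_mx n1 n2 (u : 'rV[R]_n1) (v : 'rV[R]_n2) :
  norm1 (row_mx u v) = norm1 u + norm1 v.
Proof.
rewrite /norm1 big_split_ord /=; congr (_ + _); apply: eq_bigr => i _.
  by rewrite row_mxEl.
by rewrite row_mxEr.
Qed.

Let A : finType := ('I_d + 'I_m * ('I_d * 'I_d))%type.

Let u N (a : A) w : R := match a with
  | inl p => `|X 0 p w|
  | inr k => `|B k.1 k.2.1 k.2.2| *
      `|riemann X N k.2.1 k.2.2 w - J k.2.1 k.2.2 1 w|
  end.

Let rho_le N w : (0 < N)%N -> rho N w <= \sum_a u N a w.
Proof.
move=> N0; rewrite /rho area_point_riemann // endpointE opp_row_mx add_row_mx norm1_row_mx.
rewrite big_sumType /=; apply: lerD.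
  by apply: ler_sum => p _; rewrite !mxE addrAC subrr sub0r normrN.
rewrite -(pair_bigA _ (fun l (k : 'I_d * 'I_d) => `|B l k.1 k.2| *
  `|riemann X N k.1 k.2 w - J k.1 k.2 1 w|)) /=.
apply: ler_sum => l _; rewrite !mxE -sumrB (le_trans (ler_norm_sum _ _ _)) //.
rewrite -(pair_bigA _ (fun p q => `|B l p q| * `|riemann X N p q w - J p q 1 w|)) /=.
apply: ler_sum => p _; rewrite -sumrB (le_trans (ler_norm_sum _ _ _)) //.
by apply: ler_sum => q _; rewrite -mulrBr normrM.
Qed.

Let zeta2_le N w : (0 < N)%N -> zeta N w ^+ 2 <= #|A|%:R * \sum_a u N a w ^+ 2.
Proof.
move=> N0; apply: le_trans (sqr_sum_le _).
rewrite lerXn2r ?nnegrE ?zeta_ge0 //.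
  by apply: sumr_ge0 => -[p|[l [p q]]] _ /=; rewrite ?mulr_ge0.
by rewrite (le_trans _ (rho_le w N0)) // ge_min lexx orbT.
Qed.

(** The distance is dominated by a finite sum: the terms in [X 0] vanish almost surely, and the
    others are Riemann errors that tend to 0 in mean square. *)
Lemma zeta_cvg (eps : R) : 0 < eps ->
  exists N0 : nat, forall N, (N0 < N)%N -> Ex P (fun w => zeta N w ^+ 2) <= eps.
Proof.
move=> e0.
pose S : R := #|A|%:R * \sum_(k : 'I_m * ('I_d * 'I_d)) `|B k.1 k.2.1 k.2.2| ^+ 2.
have S0 : 0 <= S by rewrite mulr_ge0 // sumr_ge0 // => k _; exact: sqr_ge0.
(* [S] collects the weights of the Riemann errors; adding 1 guards against [S = 0]. *)
pose e := eps / (S + 1).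
have e_gt0 : 0 < e by rewrite divr_gt0 // ltr_wpDl.
have /choice[M hM] : forall k : 'I_d * 'I_d, exists N0 : nat, forall N, (N0 < N)%N ->
    (\int[P]_w ((riemann X N k.1 k.2 w - J k.1 k.2 1 w) ^+ 2)%:E <= e%:E)%E.
  by move=> k; exact: (riemann_cvg_ito hX (hJ k.1 k.2) e_gt0).
exists (\max_k M k)%N => N hN; have N0 : (0 < N)%N by exact: leq_ltn_trans hN.
have mz := mom_zeta N.
have mJ p q : measurable_fun setT (J p q 1) by exact: measurable_funPT.
have mu2 a : measurable_fun setT (fun w => (u N a w ^+ 2)%:E).
  apply/measurable_EFinP; apply: measurable_funX; case: a => [p|[l [p q]]] /=.
    by apply: measurableT_comp; [exact: normr_measurable|exact: measurable_funPT].
  apply: measurable_funM; first exact: measurable_cst.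
  apply: measurableT_comp; first exact: normr_measurable.
  apply: measurable_funB => //; by case: (mom_riemann hX N p q).
rewrite -lee_fin -ExE; last exact: momX.
apply: (@le_trans _ _ (\int[P]_w (#|A|%:R%:E * \sum_a (u N a w ^+ 2)%:E)%E)%E).
  apply: ge0_subset_le_integral => w _; first by rewrite lee_fin sqr_ge0.
  by rewrite sumEFin -EFinM lee_fin; exact: zeta2_le.
rewrite ge0_integralZl_EFin //; last 2 first.
- by move=> w _; apply: sume_ge0 => a _; rewrite lee_fin sqr_ge0.
- exact: emeasurable_sum.
rewrite ge0_integral_sum //; last by move=> a w _; rewrite lee_fin sqr_ge0.
apply: (@le_trans _ _ (#|A|%:R%:E * \sum_a
  (match a with inl _ => 0 | inr k => `|B k.1 k.2.1 k.2.2| ^+ 2 * e end)%:E)%E).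
  rewrite lee_wpmul2l ?lee_fin // ; apply: lee_sum => -[p|[l [p q]]] _ /=.
    under eq_integral do rewrite real_normK ?num_real //.
    by rewrite ExE ?Ex_start2 //; apply: momX; exact: mom_start.
  under eq_integral do rewrite exprMn [`|_ - _| ^+ 2]real_normK ?num_real // EFinM.
  rewrite ge0_integralZl_EFin ?sqr_ge0 //; last 2 first.
  - by move=> w _; rewrite lee_fin sqr_ge0.
  - apply/measurable_EFinP; apply: measurable_funX; apply: measurable_funB => //.
    by case: (mom_riemann hX N p q).
  rewrite (EFinM _ e); apply: lee_wpmul2l; first by rewrite lee_fin sqr_ge0.
  by apply: (hM (p, q)); apply: leq_ltn_trans hN; exact: (leq_bigmax (p, q)).
rewrite sumEFin -EFinM lee_fin big_sumType /= big1 // add0r -mulr_suml mulrA -/S /e.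
by rewrite mulrCA ler_piMr ?(ltW e0) // ler_pdivrMr ?mul1r ?ltr_wpDl // lerDl.
Qed.

End limit.

(** * Moments of the slopes and their convergence *)

Section direction.
Context disp (T : measurableType disp) (R : realType) (P : probability T R).
Context (d m : nat) (X : R -> 'I_d -> {RV P >-> R}) (B : 'I_m -> 'M[R]_d).
Hypothesis Bskew : forall l, (B l)^T = - B l.
Hypothesis hX : standard_brownian_motion X.
Variable J : 'I_d -> 'I_d -> R -> {RV P >-> R}.
Hypothesis hJ : forall p q, is_ito_integral (natural_filtration X)
  (fun s => X s p) (fun s => X s q) 1 (J p q 1).

Local Notation increments N := (@grid_increments _ T R P d X N (grid R N)).
Local Notation law N := (@grid_law _ T R P d X N (grid R N)).

(** Its coordinates are the coefficients of the partial derivatives in the theorem, whose integrand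
    is thus the square of [dirder] along it. *)
Definition direction (p : 'I_d) (s : R) (w : T) : 'rV[R]_(d + m) :=
  row_mx (\row_p' (p' == p)%:R) (\row_l \sum_(q < d) B l p q * (X 1 q w - 2 * X s q w)).

Let b : R := \sum_l \sum_p \sum_q `|B l p q|.

Let b_ge0 : 0 <= b.
Proof. by apply: sumr_ge0 => l _; apply: sumr_ge0 => p _; exact: sumr_ge0. Qed.

Let B_le l p q : `|B l p q| <= b.
Proof.
apply: (@le_trans _ _ (\sum_p \sum_q `|B l p q|)).
  apply: (@le_trans _ _ (\sum_q `|B l p q|)).
    by rewrite (bigD1 q) //= lerDl sumr_ge0.
  rewrite [leRHS](bigD1 p) //= lerDl sumr_ge0 // => p' _; exact: sumr_ge0.
rewrite /b [leRHS](bigD1 l) //= lerDl sumr_ge0 // => l' _.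
by apply: sumr_ge0 => p' _; exact: sumr_ge0.
Qed.

Let beta : R := m%:R * b.

Let beta_ge0 : 0 <= beta. Proof. by rewrite mulr_ge0. Qed.

Let norm1_combination (p : 'I_d) (h : 'I_d -> R) :
  norm1 (\row_l \sum_q B l p q * h q) <= beta * \sum_q `|h q|.
Proof.
apply: (@le_trans _ _ (\sum_(l < m) b * \sum_q `|h q|)).
  apply: ler_sum => l _; rewrite mxE (le_trans (ler_norm_sum _ _ _)) // mulr_sumr.
  by apply: ler_sum => q _; rewrite normrM ler_wpM2r.
by rewrite sumr_const card_ord -mulr_natl mulrA.
Qed.

Let norm1_delta (p : 'I_d) : norm1 (\row_p' (p' == p)%:R : 'rV[R]_d) = 1.
Proof.
rewrite /norm1 (bigD1 p) //= big1 ?addr0 => [|q /negbTE qp]; rewrite mxE ?eqxx ?normr1 //.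
by rewrite qp normr0.
Qed.

Let mom_dir_coord N i q : (0 < N)%N -> (i < N)%N -> mom P (dir_coord X N i q).
Proof.
move=> N0 iN; apply: momB; apply: (mom_increment hX); rewrite ?grid_ge0 //.
exact: grid_le1.
Qed.

Let expr4_sub (x y : R) : (x - y) ^+ 4 <= 8 * x ^+ 4 + 8 * y ^+ 4.
Proof.
have h1 : (x - y) ^+ 2 <= 2 * x ^+ 2 + 2 * y ^+ 2 by have := sqr_ge0 (x + y); lra.
have h2 : ((x - y) ^+ 2) ^+ 2 <= (2 * x ^+ 2 + 2 * y ^+ 2) ^+ 2.
  by rewrite lerXn2r ?nnegrE ?sqr_ge0 // addr_ge0 // mulr_ge0 // sqr_ge0.
have := sqr_ge0 (x ^+ 2 - y ^+ 2); rewrite (exprM _ 2 2); move: h2.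
by rewrite (exprM x 2 2) (exprM y 2 2); move: (x ^+ 2) (y ^+ 2) => x2 y2; lra.
Qed.

Let dir_coord4 N i q : (0 < N)%N -> (i < N)%N ->
  Ex P (fun w => dir_coord X N i q w ^+ 4) <= 16 * c4 R.
Proof.
move=> N0 iN.
have g1 := grid_ge0 R N i.+1; have g0 := grid_ge0 R N i.
have gl := grid_le1 R N0 iN; have gl0 := grid_le1 R N0 (ltnW iN).
have m1 := mom_increment hX q g1 gl; have m2 := mom_increment hX q (lexx 0) g0.
have e1 := Ex_increment4 hX q g1 gl; have e2 := Ex_increment4 hX q (lexx 0) g0.
have m14 := momX 4 m1; have m24 := momX 4 m2.
apply: (@le_trans _ _ (Ex P (fun w => 8 * increment X (grid R N i.+1) 1 q w ^+ 4 +
    8 * increment X 0 (grid R N i) q w ^+ 4))).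
  apply: Ex_le; [by apply: momX; exact: mom_dir_coord| |by move=> w; exact: expr4_sub].
  exact: momD (momZ 8 m14) (momZ 8 m24).
rewrite (ExD (momZ 8 m14) (momZ 8 m24)) (ExZ 8 m14) (ExZ 8 m24).
have c0 := c4_ge0 R.
have k1 : c4 R * (1 - grid R N i.+1) ^+ 2 <= c4 R * 1.
  by rewrite ler_wpM2l //; move: g1 gl; nra.
have k2 : c4 R * (grid R N i - 0) ^+ 2 <= c4 R * 1.
  by rewrite ler_wpM2l //; move: g0 gl0; nra.
by rewrite /c4 in k1 k2 *; lra.
Qed.

(** The slope is built from increments over times at most 1, so the bound is uniform in [N]. With N
    d coordinates and squared variance 1/N^2, the total quartic error is then of order 1/N. *)
Lemma norm1_area_dir4 : exists2 C : R, 0 <= C & forall N k, (0 < N)%N ->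
  Ex P (fun w => norm1 (area_dir B k (increments N w)) ^+ 4) <= C.
Proof.
(* From [(1 + beta S)^4 <= 8 + 8 beta^4 S^4], then [d^3] from the fourth power of a sum of [d]
   terms, and [16 c4] for each of these terms, a difference of two increments. *)
exists (8 * 1 + 8 * (beta ^+ 4 * (d%:R ^+ 3 * (d%:R * (16 * c4 R))))).
  by rewrite addr_ge0 // !mulr_ge0 // ?exprn_ge0 // ?mulr_ge0 // c4_ge0.
move=> N [i p] N0.
pose S w := \sum_q `|dir_coord X N i q w|.
have mq q : mom P (dir_coord X N i q) by exact: mom_dir_coord.
have mS4 : mom P (fun w => \sum_q `|dir_coord X N i q w| ^+ 4).
  by apply: mom_sum => q _; apply: momX; exact: mom_norm.
have bound w : norm1 (area_dir B (i, p) (increments N w)) <= 1 + beta * S w.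
  rewrite (area_dir_increments X Bskew N0) norm1_row_mx norm1_delta lerD2l.
  exact: norm1_combination.
have S0 w : 0 <= S w by exact: sumr_ge0.
have mn : mom P (fun w => norm1 (area_dir B (i, p) (increments N w))).
  apply: mom_sum => j _; apply: mom_norm.
  case: (split_ordP j) => j' ->.
    by apply: mom_ext (mom_cst P ((j' == p)%:R)) => w; rewrite /area_dir row_mxEl mxE.
  apply: (mom_ext (X := fun w => \sum_k' (area_coef B j' (i, p) k' +
    area_coef B j' k' (i, p)) * increments N w k')).
    by move=> w; rewrite /area_dir row_mxEr mxE.
  by apply: mom_sum => k' _; apply: momZ; exact: mom_grid_increments.
apply: (@le_trans _ _ (Ex P (fun w => 8 * 1 +
    (8 * (beta ^+ 4 * d%:R ^+ 3)) * \sum_q `|dir_coord X N i q w| ^+ 4))).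
  apply: Ex_le; [exact: momX|by apply: momD; [exact: mom_cst|exact: momZ]|move=> w].
  apply: (@le_trans _ _ ((1 - - (beta * S w)) ^+ 4)).
    rewrite opprK lerXn2r ?nnegrE ?norm1_ge0 // ?addr_ge0 // ?mulr_ge0 //.
  apply: (le_trans (expr4_sub _ _)).
  rewrite expr1n lerD2l -mulrA ler_wpM2l //.
  rewrite (_ : (- (beta * S w)) ^+ 4 = beta ^+ 4 * S w ^+ 4); last by ring.
  rewrite -mulrA ler_wpM2l ?exprn_ge0 //.
  by have := expr4_sum_le (fun q => `|dir_coord X N i q w|); rewrite card_ord.
rewrite (ExD (mom_cst P (8 * 1)) (momZ _ mS4)) (Ex_cst P (8 * 1)) (ExZ _ mS4).
have -> : 8 * (beta ^+ 4 * (d%:R ^+ 3 * (d%:R * (16 * c4 R)))) =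
    8 * (beta ^+ 4 * d%:R ^+ 3) * (d%:R * (16 * c4 R)) by ring.
rewrite lerD2l; apply: ler_wpM2l.
  by rewrite mulr_ge0 // mulr_ge0 ?exprn_ge0.
rewrite Ex_sum => [|q _]; last by apply: momX; exact: mom_norm.
apply: (@le_trans _ _ (\sum_(q < d) 16 * c4 R)).
  apply: ler_sum => q _; apply: le_trans (@dir_coord4 N i q N0 (ltn_ord i)).
  rewrite le_eqVlt; apply/orP; left; apply/eqP; apply: eq_Ex => w.
  by rewrite -normrX ger0_norm // exprn_even_ge0.
by rewrite sumr_const card_ord -[X in X <= _]mulr_natl.
Qed.

Lemma norm1_area_dir_sub : exists2 C : R, 0 <= C & forall N (i : 'I_N) p s, (0 < N)%N ->
  grid R N i < s <= grid R N i.+1 ->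
  mom P (fun w => norm1 (area_dir B (i, p) (increments N w) - direction p s w)) /\
  Ex P (fun w => norm1 (area_dir B (i, p) (increments N w) - direction p s w) ^+ 2)
    <= C / N%:R.
Proof.
exists (beta ^+ 2 * (d%:R * (d%:R * 9))).
  by rewrite mulr_ge0 ?sqr_ge0.
move=> N i p s N0 /andP[is_ si].
have g0 := grid_ge0 R N i.
have s0 : 0 <= s by lra.
(* The difference between [dir_coord] and [X_1 - 2 X_s], split at [s] into the two parts of the cell
   and the initial value; each part of the cell has variance at most 1/N. *)
pose e q w := increment X (grid R N i) s q w - increment X s (grid R N i.+1) q w + X 0 q w.
have m1 q := mom_increment hX q g0 (ltW is_).
have m2 q := mom_increment hX q s0 si.
have m3 q := mom_start hX q.
have me q : mom P (e q) by apply: momD => //; exact: momB.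
have E w : area_dir B (i, p) (increments N w) - direction p s w =
    row_mx 0 (\row_l \sum_q B l p q * e q w).
  rewrite (area_dir_increments X Bskew N0) /direction opp_row_mx add_row_mx subrr.
  congr row_mx; apply/rowP => l; rewrite !mxE -sumrB; apply: eq_bigr => q _.
  by rewrite -mulrBr /e /dir_coord /=; congr (_ * _); ring.
have norm10 : norm1 (0 : 'rV[R]_d) = 0.
  by rewrite /norm1 big1 // => j _; rewrite mxE normr0.
have mn : mom P (fun w => norm1 (area_dir B (i, p) (increments N w) - direction p s w)).
  apply: (mom_ext (X := fun w => \sum_l `|\sum_q B l p q * e q w|)).
    move=> w; rewrite E norm1_row_mx norm10 add0r.
    by apply: eq_bigr => l _; rewrite mxE.
  by apply: mom_sum => l _; apply: mom_norm; apply: mom_sum => q _; exact: momZ.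
split => //.
have mS : mom P (fun w => \sum_q e q w ^+ 2) by apply: mom_sum => q _; exact: momX.
apply: (@le_trans _ _ (Ex P (fun w => (beta ^+ 2 * d%:R) * \sum_q e q w ^+ 2))).
  apply: Ex_le; [exact: momX|exact: momZ|move=> w].
  rewrite E norm1_row_mx norm10 add0r.
  apply: (@le_trans _ _ ((beta * \sum_q `|e q w|) ^+ 2)).
    have S0 : 0 <= \sum_q `|e q w| by exact: sumr_ge0.
    by rewrite lerXn2r ?nnegrE ?norm1_ge0 // mulr_ge0.
  rewrite exprMn -mulrA ler_wpM2l ?sqr_ge0 //.
  have := sqr_sum_le (fun q => `|e q w|); rewrite card_ord => /le_trans; apply.
  rewrite ler_wpM2l //; apply: ler_sum => q _.
  by rewrite real_normK ?num_real.
rewrite (ExZ _ mS) Ex_sum => [|q _]; last exact: momX.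
have -> : beta ^+ 2 * (d%:R * (d%:R * 9)) / N%:R =
    beta ^+ 2 * d%:R * (d%:R * (9 / N%:R)) by ring.
apply: ler_wpM2l.
  by rewrite mulr_ge0 ?sqr_ge0.
apply: (@le_trans _ _ (\sum_(q < d) 9 / N%:R)); last first.
  by rewrite sumr_const card_ord -[X in X <= _]mulr_natl.
apply: ler_sum => q _.
have n1 := momX 2 (m1 q); have n2 := momX 2 (m2 q); have n3 := momX 2 (m3 q).
apply: (@le_trans _ _ (Ex P (fun w => 3 * increment X (grid R N i) s q w ^+ 2 +
   3 * increment X s (grid R N i.+1) q w ^+ 2 + 3 * X 0 q w ^+ 2))).
  apply: Ex_le; [exact: momX|exact: momD (momD (momZ 3 n1) (momZ 3 n2)) (momZ 3 n3)|].
  move=> w; rewrite /e; move: (increment _ _ _ _ _) (increment _ _ _ _ _) (X 0 q w) => x y z.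
  by have := sqr_ge0 (x + y); have := sqr_ge0 (y - z); have := sqr_ge0 (x + z); lra.
rewrite (ExD (momD (momZ 3 n1) (momZ 3 n2)) (momZ 3 n3)) (ExD (momZ 3 n1) (momZ 3 n2)).
rewrite (ExZ 3 n1) (ExZ 3 n2) (ExZ 3 n3) Ex_start2 //.
rewrite Ex_increment2 ?(ltW is_) // Ex_increment2 //.
have := gridS R i N0; have : 0 <= N%:R^-1 :> R by rewrite invr_ge0.
by set z := N%:R^-1; lra.
Qed.

Lemma mom_direction p s i : 0 <= s -> mom P (fun w => direction p s w 0 i).
Proof.
move=> s0; case: (split_ordP i) => j ->.
  by apply: mom_ext (mom_cst P ((j == p)%:R)) => w; rewrite /direction row_mxEl mxE.
apply: (mom_ext (X := fun w => \sum_q B j p q * (X 1 q w - 2 * X s q w))).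
  by move=> w; rewrite /direction row_mxEr mxE.
apply: mom_sum => q _; apply: momZ; apply: momB; first exact: mom_bm.
by apply: momZ; exact: mom_bm.
Qed.

End direction.

Section norm1_lemmas.
Context (R : realType) (n : nat).
Implicit Types u v : 'rV[R]_n.

Lemma norm1D u v : norm1 (u + v) <= norm1 u + norm1 v.
Proof.
by rewrite /norm1 -big_split; apply: ler_sum => i _; rewrite mxE ler_normD.
Qed.

Lemma norm1N u : norm1 (- u) = norm1 u.
Proof. by apply: eq_bigr => i _; rewrite mxE normrN. Qed.

Lemma dirderB (f : 'rV[R]_n -> R) y u v :
  dirder f y (u - v) = dirder f y u - dirder f y v.
Proof.
by rewrite /dirder -sumrB; apply: eq_bigr => i _; rewrite !mxE mulrBl.
Qed.

End norm1_lemmas.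

(** * Comparison of the grid derivative with the limiting derivative *)

Section derivative_gap.
Context disp (T : measurableType disp) (R : realType) (P : probability T R).
Context (d m : nat) (X : R -> 'I_d -> {RV P >-> R}) (B : 'I_m -> 'M[R]_d).
Hypothesis Bskew : forall l, (B l)^T = - B l.
Hypothesis hX : standard_brownian_motion X.
Variable J : 'I_d -> 'I_d -> R -> {RV P >-> R}.
Hypothesis hJ : forall p q, is_ito_integral (natural_filtration X)
  (fun s => X s p) (fun s => X s q) 1 (J p q 1).
Variables (f : 'rV[R]_(d + m) -> R) (L : R).
Hypothesis L0 : 0 < L.
Hypothesis hf : schwartz f.
Hypothesis f1 : forall i x, `|partial i f x| <= L.
Hypothesis f2 : forall i j x, `|partial i (partial j f) x| <= L.

Local Notation increments N := (@grid_increments _ T R P d X N (grid R N)).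

(** The instance of [D0] for the area polynomial at the Brownian increments. *)
Definition grid_derivative N (k : 'I_N * 'I_d) w :=
  dirder f (area_point B (upd k (increments N w) 0)) (area_dir B k (increments N w)).

Definition limit_derivative p s w := dirder f (endpoint X B J w) (direction X B p s w).

Lemma mom_area_dir N k i : mom P (fun w => area_dir B k (increments N w) 0 i).
Proof.
case: k => j p; case: (split_ordP i) => j' ->.
  by apply: mom_ext (mom_cst P ((j' == p)%:R)) => w; rewrite /area_dir row_mxEl mxE.
apply: (mom_ext (X := fun w => \sum_k' (area_coef B j' (j, p) k' +
  area_coef B j' k' (j, p)) * increments N w k')).
  by move=> w; rewrite /area_dir row_mxEr mxE.
by apply: mom_sum => k' _; apply: momZ; exact: mom_grid_increments.
Qed.

Let measurable_increments N :
  measurable_fun setT (increments N : T -> coords ('I_N * 'I_d)%type R).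
Proof. by apply: measurable_coords => k; case: (mom_grid_increments hX k). Qed.

Let measurable_point N k : measurable_fun setT
  (fun w => area_point B (upd k (increments N w) 0) : borel_rV R (d + m)).
Proof.
apply: measurable_fun_rV => i.
apply: (measurableT_comp (measurable_area_point B i)).
exact: (measurableT_comp (measurable_updl k 0) (@measurable_increments N)).
Qed.

Lemma mom_grid_derivative N k : mom P (@grid_derivative N k).
Proof.
apply: mom_sum => i _; apply: momM; first exact: mom_area_dir.
apply: (mom_bounded P (M := L)) => //.
exact: (measurableT_comp (schwartz_measurable1 i hf) (measurable_point k)).
Qed.

Lemma mom_limit_derivative p s : 0 <= s -> mom P (limit_derivative p s).
Proof.
move=> s0; apply: mom_sum => i _; apply: momM; first exact: mom_direction.
apply: (mom_bounded P (M := L)) => //.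
exact: (measurableT_comp (schwartz_measurable1 i hf) (measurable_endpoint X B J)).
Qed.

(** Two replacements: first the base point, moved by at most the increment times the norm of the
    slope, plus [rho]; then the slope itself. *)
Let pointwise_gap N (k : 'I_N * 'I_d) s w :
  `|grid_derivative k w - limit_derivative k.2 s w| <=
  L * ((`|increments N w k| * norm1 (area_dir B k (increments N w)) + zeta X B J N w)
      * norm1 (area_dir B k (increments N w))
    + norm1 (area_dir B k (increments N w) - direction X B k.2 s w)).
Proof.
set V := area_dir B k _; set v := norm1 V.
set Y0 := area_point B (upd k (increments N w) 0).
set Y := area_point B (increments N w).
have v0 : 0 <= v := norm1_ge0 _.
have YE : Y = Y0 + increments N w k *: V.
  by rewrite /Y /Y0 /V -area_point_upd upd_same.
have xv0 : 0 <= `|increments N w k| * v by rewrite mulr_ge0.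
have h1 : `|dirder f Y0 V - dirder f (endpoint X B J w) V| <=
    L * ((`|increments N w k| * v + zeta X B J N w) * v).
  (* Beyond distance 2 the trivial bound, [2 L] times the norm of the slope, takes over from the
     Lipschitz one: hence the truncation level of [zeta]. *)
  rewrite mulrA /zeta; case: (leP 2 (rho X B J N w)) => hr.
    apply: (@le_trans _ _ (L * 2 * v)).
      rewrite (le_trans (ler_normB _ _)) //.
      have := dirder_le f1 Y0 V; have := dirder_le f1 (endpoint X B J w) V.
      by rewrite -/v; lra.
    by rewrite ler_wpM2r // ler_wpM2l ?(ltW L0) // lerDr.
  apply: (le_trans (dirder_lip hf f2 _ _ _)).
  rewrite -/v ler_wpM2r // ler_wpM2l ?(ltW L0) //.
  have -> : Y0 - endpoint X B J w = - (increments N w k *: V) + (Y - endpoint X B J w).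
    by rewrite YE -addrA addrCA addKr.
  by rewrite (le_trans (norm1D _ _)) // norm1N norm1Z.
have h2 : `|dirder f (endpoint X B J w) (V - direction X B k.2 s w)| <=
  L * norm1 (V - direction X B k.2 s w) by exact: dirder_le.
rewrite mulrDr; apply: le_trans (lerD h1 h2).
rewrite dirderB /grid_derivative /limit_derivative -/V -/Y0.
by rewrite (le_trans _ (ler_normD _ _)) // addrA subrK.
Qed.

(** [zeta] and the slope are not independent, so their product is separated by Young's inequality
    with a small weight on the fourth moment of the slope, using [zeta <= 2]. The bound is uniform
    over cells and over [s], as the summation over all cells requires. *)
Lemma derivative_gap (tau : R) : 0 < tau -> exists N0 : nat,
  forall N (i : 'I_N) p s, (N0 < N)%N -> grid R N i < s <= grid R N i.+1 ->
  Ex P (fun w => (grid_derivative (i, p) w - limit_derivative p s w) ^+ 2) <= tau.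
Proof.
move=> tau0.
have [CV CV0 hCV] := norm1_area_dir4 Bskew hX.
have [Cn Cn0 hCn] := norm1_area_dir_sub Bskew hX.
pose l := 3 * L ^+ 2.
have l0 : 0 < l by rewrite mulr_gt0 ?exprn_gt0.
(* The target is cut in three: [l t (CV + 1)] and [l e / t] both equal [tau / 3], and a large [N]
   brings the remaining errors below the last third. *)
pose t := tau / (3 * l * (CV + 1)).
have t0 : 0 < t by rewrite divr_gt0 // !mulr_gt0 // ltr_wpDl.
pose e := t * (tau / (3 * l)).
have e0 : 0 < e by rewrite mulr_gt0 // divr_gt0 // mulr_gt0.
have [N1 hN1] := zeta_cvg Bskew hX hJ e0.
exists (maxn N1 (Num.truncn (3 * l * (CV + Cn) / tau))) => N i p s.
rewrite gtn_max => /andP[hN hN2] scell.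
have N0 : (0 < N)%N by exact: leq_ltn_trans hN.
have s0 : 0 <= s by case/andP: scell => h _; have := grid_ge0 R N i; lra.
have {}hN1 := hN1 N hN.
have {}hN2 : l * (CV + Cn) / N%:R <= tau / 3.
  have h : 3 * l * (CV + Cn) / tau <= N%:R.
    by rewrite (le_trans (ltW (truncnS_gt _))) // ler_nat.
  rewrite ler_pdivrMr ?ltr0n //; move: h; rewrite ler_pdivrMr //; lra.
have {hCn} [mn hCn] := hCn N i p s N0 scell.
have {}hCV := hCV N (i, p) N0.
have mx := mom_grid_increments hX (i, p).
have mv : mom P (fun w => norm1 (area_dir B (i, p) (increments N w))).
  by apply: mom_sum => j _; apply: mom_norm; exact: mom_area_dir.
have mz := mom_zeta B hX J N.
have md := momB (mom_grid_derivative (i, p)) (mom_limit_derivative p s0).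
pose A w := increments N w (i, p) ^+ 2 * norm1 (area_dir B (i, p) (increments N w)) ^+ 4.
pose A2 w := norm1 (area_dir B (i, p) (increments N w)) ^+ 4.
pose A3 w := zeta X B J N w ^+ 2.
pose A4 w := norm1 (area_dir B (i, p) (increments N w) - direction X B p s w) ^+ 2.
have mA : mom P A by apply: momM; exact: momX.
have mA2 : mom P A2 by exact: momX.
have mA3 : mom P A3 by exact: momX.
have mA4 : mom P A4 by exact: momX.
(* The slope does not involve its own increment, so the expectation factors and the variance 1/N
   appears. *)
have EA : Ex P A = N%:R^-1 * Ex P A2.
  rewrite -(law_second_moment hX (i, p) N0).
  apply: (Ex_coord_expn (fun k => mom_grid_increments hX k) (indep_increments hX N0)
    (fun k => mom_law hX k) (k := (i, p)) (m := 2) (phi := fun x => norm1 (area_dir B (i, p) x) ^+ 4)) => //.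
  - apply: measurable_funX; apply: measurable_sum => j.
    by apply: measurableT_comp; [exact: normr_measurable|exact: measurable_area_dir].
  - by move=> x; rewrite exprn_ge0 // norm1_ge0.
  - by move=> x v; rewrite area_dir_upd.
have t1 : 0 < t^-1 by rewrite invr_gt0.
apply: (@le_trans _ _ (Ex P (fun w => l * (A w + t * A2 w + t^-1 * A3 w + A4 w)))).
  have mR : mom P (fun w => A w + t * A2 w + t^-1 * A3 w + A4 w).
    exact: momD (momD (momD mA (momZ t mA2)) (momZ t^-1 mA3)) mA4.
  apply: Ex_le; [exact: momX|exact: momZ|move=> w].
  have := pointwise_gap (i, p) s w; rewrite /= => hw.
  have z0 := zeta_ge0 X B J N w; have z2 := zeta_le2 X B J N w.
  rewrite /A /A2 /A3 /A4.
  set eta := norm1 (_ - _) in hw *; set v := norm1 (area_dir _ _ _) in hw *.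
  have eta0 : 0 <= eta := norm1_ge0 _; have v0 : 0 <= v := norm1_ge0 _.
  move: (zeta _ _ _ _ _) eta v z0 z2 eta0 v0 hw => z eta v z0 z2 eta0 v0 hw.
  have x2 : increments N w (i, p) ^+ 2 = `|increments N w (i, p)| ^+ 2.
    by rewrite real_normK ?num_real.
  rewrite x2; move: (`|increments N w (i, p)|) (normr_ge0 (increments N w (i, p))) hw
    => x x0 hw.
  apply: (@le_trans _ _ ((L * ((x * v + z) * v + eta)) ^+ 2)).
    rewrite -[X in X <= _]real_normK ?num_real // lerXn2r ?nnegrE //.
    by rewrite mulr_ge0 ?(ltW L0) // addr_ge0 // mulr_ge0 // addr_ge0 // mulr_ge0.
  have -> : l * (x ^+ 2 * v ^+ 4 + t * v ^+ 4 + t^-1 * z ^+ 2 + eta ^+ 2) =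
      L ^+ 2 * (3 * (x ^+ 2 * v ^+ 4 + t * v ^+ 4 + t^-1 * z ^+ 2 + eta ^+ 2)).
    by rewrite /l; move: (t^-1) => u; ring.
  rewrite exprMn ler_wpM2l ?sqr_ge0 //.
  have q1 : z ^+ 2 * v ^+ 2 <= t * v ^+ 4 + t^-1 * z ^+ 2.
    have h : 0 <= t^-1 * (z ^+ 2 / 2 - t * v ^+ 2) ^+ 2.
      by rewrite mulr_ge0 ?sqr_ge0 // ltW.
    have E : t^-1 * (z ^+ 2 / 2 - t * v ^+ 2) ^+ 2 =
        t^-1 * (z ^+ 2 * z ^+ 2 / 4) - z ^+ 2 * v ^+ 2 + t * v ^+ 4.
      by field; rewrite gt_eqF.
    have z4 : z ^+ 2 * z ^+ 2 / 4 <= z ^+ 2.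
      have y4 : z ^+ 2 <= 4 by nra.
      by move: (z ^+ 2) (sqr_ge0 z) y4 => y y0 y4; nra.
    have : t^-1 * (z ^+ 2 * z ^+ 2 / 4) <= t^-1 * z ^+ 2 by rewrite ler_pM2l.
    by move: h; rewrite E; lra.
  have q2 : ((x * v + z) * v + eta) ^+ 2 <=
      3 * (x ^+ 2 * v ^+ 4 + z ^+ 2 * v ^+ 2 + eta ^+ 2).
    have -> : (x * v + z) * v + eta = x * v ^+ 2 + z * v + eta by ring.
    have -> : x ^+ 2 * v ^+ 4 = (x * v ^+ 2) ^+ 2 by ring.
    have -> : z ^+ 2 * v ^+ 2 = (z * v) ^+ 2 by ring.
    move: (x * v ^+ 2) (z * v) => a b.
    by have := sqr_ge0 (a - b); have := sqr_ge0 (a - eta); have := sqr_ge0 (b - eta); lra.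
  by move: q1 q2; set u := t^-1; lra.
rewrite ExZ; last exact: momD (momD (momD mA (momZ t mA2)) (momZ t^-1 mA3)) mA4.
rewrite (ExD (momD (momD mA (momZ t mA2)) (momZ t^-1 mA3)) mA4).
rewrite (ExD (momD mA (momZ t mA2)) (momZ t^-1 mA3)) (ExD mA (momZ t mA2)).
rewrite (ExZ t mA2) (ExZ t^-1 mA3) EA.
have k1 : l * (t * Ex P A2) <= tau / 3.
  apply: (@le_trans _ _ (l * (t * (CV + 1)))).
    by rewrite ler_pM2l // ler_pM2l // (le_trans hCV) // lerDl.
  rewrite /t le_eqVlt; apply/orP; left; apply/eqP.
  by field; rewrite !gt_eqF // ltr_wpDl.
have k2 : l * (t^-1 * Ex P A3) <= tau / 3.
  apply: (@le_trans _ _ (l * (t^-1 * e))).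
    by rewrite ler_pM2l // ler_pM2l.
  rewrite /e mulKf ?gt_eqF // le_eqVlt; apply/orP; left; apply/eqP.
  by field; rewrite gt_eqF.
have k3 : l * (N%:R^-1 * Ex P A2) <= l * CV / N%:R.
  have -> : l * CV / N%:R = l * (N%:R^-1 * CV) by ring.
  by rewrite ler_pM2l // ler_wpM2l // invr_ge0.
have k4 : l * Ex P A4 <= l * (Cn / N%:R) by rewrite ler_pM2l.
have : l * (CV + Cn) / N%:R = l * CV / N%:R + l * (Cn / N%:R) by ring.
by move: k1 k2 k3 k4 hN2; lra.
Qed.

End derivative_gap.

(** * From sums over cells to integrals over [s] *)

Section riemann_lower_bound.
Context (R : realType).

(* Step functions below [g] make do without the measurability of [g]. *)
Lemma riemann_lower_bound N (g : R -> R) (A : 'I_N -> R) (kappa c : R) :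
  (0 < N)%N -> 0 < kappa -> (forall s, 0 <= s -> 0 <= g s) ->
  (forall (i : 'I_N) s, grid R N i < s <= grid R N i.+1 -> A i <= kappa * g s + c) ->
  ((N%:R^-1 * \sum_i A i)%:E <=
   kappa%:E * \int[lebesgue_measure]_(s in `[0%R, 1%R]) (g s)%:E + c%:E)%E.
Proof.
move=> N0 k0 g0 hA.
(* The lower bound that the hypothesis yields for [g] on cell [i], clipped at 0 as [g] is
   non-negative. *)
pose a i := Num.max 0 ((A i - c) / kappa).
have a0 i : 0 <= a i by rewrite le_max lexx.
pose h (s : R) := \sum_(i < N) a i * \1_(`]grid R N i, grid R N i.+1]) s.
have Ni0 : 0 < N%:R^-1 :> R by rewrite invr_gt0 ltr0n.
have hg : (\int[lebesgue_measure]_(s in `[0%R, 1%R]) (h s)%:E <=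
    \int[lebesgue_measure]_(s in `[0%R, 1%R]) (g s)%:E)%E.
  apply: ge0_subset_le_integral => s /=; rewrite in_itv /= => /andP[s0 s1].
    by rewrite lee_fin sumr_ge0 // => i _; rewrite mulr_ge0.
  rewrite lee_fin; have [->|s_0] := eqVneq s 0.
    rewrite /h big1 ?g0 // => i _.
    by rewrite indicE memNset ?mulr0 //= in_itv /= ltNge grid_ge0.
  have [|i si] := @grid_cell R N s N0; first by rewrite lt_neqAle eq_sym s_0 s0.
  rewrite /h (grid_cell_sum _ si) /a ge_max g0 //=.
  by rewrite ler_pdivrMr // lerBlDr mulrC hA.
have Ih : (\int[lebesgue_measure]_(s in `[0%R, 1%R]) (h s)%:E =
    (N%:R^-1 * \sum_i a i)%:E)%E.
  under eq_integral do rewrite -sumEFin.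
  rewrite ge0_integral_sum //; last 2 first.
  - by move=> i; apply/measurable_EFinP; apply: measurable_funM => //.
  - by move=> i s _; rewrite lee_fin mulr_ge0.
  rewrite mulr_sumr -sumEFin; apply: eq_bigr => i _.
  under eq_integral do rewrite EFinM.
  rewrite ge0_integralZl_EFin //; last first.
    by apply/measurable_EFinP; exact: measurable_indic.
  rewrite integral_indic // setIidl; last first.
    move=> s /=; rewrite !in_itv /= => /andP[h1 h2].
    have := grid_ge0 R N i; have := grid_le1 R N0 (ltn_ord i); lra.
  rewrite /= lebesgue_measure_itv /= lte_fin ifT; last first.
    by rewrite -subr_gt0 gridS.
  by rewrite -EFinD gridS // -EFinM mulrC.
apply: (@le_trans _ _ (kappa%:E * (N%:R^-1 * \sum_i a i)%:E + c%:E)%E); last first.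
  by apply: leeD => //; rewrite -Ih lee_wpmul2l // lee_fin ltW.
rewrite -EFinM -EFinD lee_fin.
have -> : c = N%:R^-1 * \sum_(i < N) c.
  by rewrite sumr_const card_ord -[c *+ N]mulr_natl mulKf // pnatr_eq0 -lt0n.
rewrite mulrCA -mulrDr ler_pM2l // mulr_sumr -big_split /=; apply: ler_sum => i _.
have : (A i - c) / kappa <= a i by rewrite /a le_max lexx orbT.
by rewrite ler_pdivrMr // mulrC; lra.
Qed.

End riemann_lower_bound.

(** * Continuity of the entropy of bounded variables *)

Section entropy_continuity.
Context (R : realType).

Lemma ln_sub_le (a b : R) : 0 < a -> 0 < b -> b * (ln a - ln b) <= a - b.
Proof.
move=> a0 b0; have ab0 : 0 < a / b by rewrite divr_gt0.
have : ln (1 + (a / b - 1)) <= a / b - 1 by apply: le_ln1Dx; lra.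
rewrite addrC subrK ln_div ?posrE // => h.
have : b * (ln a - ln b) <= b * (a / b - 1) by rewrite ler_pM2l.
have -> : b * (a / b - 1) = a - b by field; rewrite gt_eqF.
by [].
Qed.

(** The derivative [1 + ln x] is bounded on the interval; the proof applies the tangent inequality
    for ln in both orders of the two points. *)
Lemma xlnx_lipschitz (e M a b : R) : 0 < e -> e <= a <= M -> e <= b <= M ->
  `|a * ln a - b * ln b| <= (1 + (`|ln e| + `|ln M|)) * `|a - b|.
Proof.
move=> e0.
have lnb x : e <= x <= M -> `|ln x| <= `|ln e| + `|ln M|.
  move=> /andP[ex xM]; have x0 : 0 < x by exact: lt_le_trans ex.
  have l1 : ln e <= ln x by rewrite ler_ln ?posrE.
  have l2 : ln x <= ln M by rewrite ler_ln ?posrE // (lt_le_trans x0).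
  have := ler_norm (- ln e); rewrite normrN; have := ler_norm (ln M).
  have := normr_ge0 (ln e); have := normr_ge0 (ln M).
  by rewrite ler_norml; move=> *; apply/andP; split; lra.
have half x y : e <= x <= M -> e <= y <= M ->
    x * ln x - y * ln y <= (1 + (`|ln e| + `|ln M|)) * `|x - y|.
  move=> hx hy; have /andP[ex _] := hx; have /andP[ey _] := hy.
  have x0 := lt_le_trans e0 ex; have y0 := lt_le_trans e0 ey.
  have := ln_sub_le x0 y0; have := lnb x hx.
  have := ler_norm (x - y); have := ler_norm ((x - y) * ln x).
  rewrite normrM; set c := `|ln e| + `|ln M|; set z := `|x - y|.
  have z0 : 0 <= z by exact: normr_ge0.
  move=> h1 h2 h3 h4; have : z * `|ln x| <= z * c by rewrite ler_wpM2l.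
  by lra.
move=> ha hb; rewrite ler_norml; apply/andP; split; last exact: half.
by have := half b a hb ha; rewrite distrC; lra.
Qed.

Lemma xlnx_add_ge (u e : R) : 0 <= u -> 0 < e ->
  u * ln u + e * ln e <= (u + e) * ln (u + e).
Proof.
move=> u0 e0; rewrite mulrDl; apply: lerD; last first.
  by rewrite ler_pM2l // ler_ln ?posrE ?lerDr // ltr_wpDl.
move: u0; rewrite le_eqVlt => /predU1P[<-|u0]; first by rewrite !mul0r.
by rewrite ler_pM2l // ler_ln ?posrE ?lerDl ?(ltW e0) // addr_gt0.
Qed.

Lemma xlnx_add_le (u e : R) : 0 <= u -> 0 < e <= 1 ->
  (u + e) * ln (u + e) <= u * ln u + e * (2 + u).
Proof.
move=> u0 /andP[e0 e1].
have ue0 : 0 < u + e by rewrite ltr_wpDl.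
have l1 := ltW (ln_sublinear ue0).
have h1 : u * ln (u + e) <= u * ln u + e.
  move: u0; rewrite le_eqVlt => /predU1P[<-|u0]; first by rewrite !mul0r add0r ltW.
  by have := ln_sub_le ue0 u0; lra.
have : e * ln (u + e) <= e * (u + e) by rewrite ler_pM2l.
by nra.
Qed.

(** Through [ln (1 / r) <= 1 / r]: with a regularisation [r^2] the error [r^2 ln (r^2)] becomes
    linear in [r]. *)
Lemma sqr_xlnx_ge (r : R) : 0 < r -> - (2 * r) <= r ^+ 2 * ln (r ^+ 2).
Proof.
move=> r0; rewrite lnXn // mulrC.
have ri : 0 < r^-1 by rewrite invr_gt0.
have := ltW (ln_sublinear ri); rewrite lnV ?posrE // => h.
have : r ^+ 2 * (- ln r) <= r ^+ 2 * r^-1 by rewrite ler_pM2l ?exprn_gt0.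
have -> : r ^+ 2 * r^-1 = r by field; rewrite gt_eqF.
by rewrite mulrC -mulr_natl; lra.
Qed.

Lemma xlnx_bound (u M : R) : 0 <= u <= M -> `|u * ln u| <= 1 + M ^+ 2.
Proof.
move=> /andP[u0 uM]; have M0 : 0 <= M ^+ 2 by exact: sqr_ge0.
move: u0; rewrite le_eqVlt => /predU1P[<-|u0].
  by rewrite mul0r normr0 addr_ge0.
have h1 : u * ln u <= u * u by rewrite ler_pM2l // ltW // ln_sublinear.
have ui : 0 < u^-1 by rewrite invr_gt0.
have h2 : u * ln u^-1 <= u * u^-1 by rewrite ler_pM2l // ltW // ln_sublinear.
rewrite lnV ?posrE // divff ?gt_eqF // in h2.
by rewrite ler_norml; apply/andP; split; nra.
Qed.

Context disp (T : measurableType disp) (P : probability T R).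

(** The squares differ by at most [2 L^2 z], and [x ln x] is Lipschitz on the range; the two terms
    of the entropy double the constant. It blows up with [ln e], so [e] stays fixed while [z] tends
    to 0. *)
Lemma real_entropy_close (U V z : T -> R) (L e : R) : 0 < L -> 0 < e ->
  measurable_fun setT U -> measurable_fun setT V -> mom P z ->
  (forall w, `|U w| <= L) -> (forall w, `|V w| <= L) ->
  (forall w, `|U w - V w| <= L * z w) ->
  real_entropy P (fun w => V w ^+ 2 + e) <= real_entropy P (fun w => U w ^+ 2 + e) +
    4 * L ^+ 2 * (1 + (`|ln e| + `|ln (L ^+ 2 + e)|)) * Ex P z.
Proof.
move=> L0 e0 mU mV mz UL VL UVz.
set M := L ^+ 2 + e; set c := 1 + _.
have c0 : 0 <= c by rewrite /c addr_ge0 ?addr_ge0.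
have bnd (W : T -> R) w : (forall w, `|W w| <= L) -> e <= W w ^+ 2 + e <= M.
  move=> WL; rewrite lerDr sqr_ge0 lerD2r.
  by rewrite -[W w ^+ 2]real_normK ?num_real // lerXn2r ?nnegrE // ltW.
have dist w : `|U w ^+ 2 + e - (V w ^+ 2 + e)| <= 2 * L ^+ 2 * z w.
  have -> : U w ^+ 2 + e - (V w ^+ 2 + e) = (U w + V w) * (U w - V w) by ring.
  have -> : 2 * L ^+ 2 * z w = (2 * L) * (L * z w) by ring.
  rewrite normrM ler_pM // (le_trans (ler_normD _ _)) //.
  by have := UL w; have := VL w; lra.
have mm (W : T -> R) : measurable_fun setT W -> (forall w, `|W w| <= L) ->
    mom P (fun w => W w ^+ 2 + e) /\
    mom P (fun w => (W w ^+ 2 + e) * ln (W w ^+ 2 + e)).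
  move=> mW WL; have mWe : measurable_fun setT (fun w => W w ^+ 2 + e).
    by apply: measurable_funD => //; exact: measurable_funX.
  split.
    apply: (mom_bounded P mWe (M := M)) => w; have /andP[h1 h2] := bnd W w WL.
    by rewrite ger0_norm // (le_trans (ltW e0)).
  apply: (mom_bounded P (M := 1 + M ^+ 2)).
    by apply: measurable_funM => //; apply: measurableT_comp => //; exact: measurable_ln.
  move=> w; apply: xlnx_bound; have /andP[h1 h2] := bnd W w WL.
  by rewrite h2 (le_trans (ltW e0)).
have [mU1 mU2] := mm U mU UL; have [mV1 mV2] := mm V mV VL.
have mean (W : T -> R) : mom P (fun w => W w ^+ 2 + e) -> (forall w, `|W w| <= L) ->
    e <= Ex P (fun w => W w ^+ 2 + e) <= M.
  move=> mW WL; rewrite -{1}(Ex_cst P e) -(Ex_cst P M); apply/andP; split;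
    apply: Ex_le => //; try exact: mom_cst.
    by move=> w; have /andP[] := bnd W w WL.
  by move=> w; have /andP[] := bnd W w WL.
have mz2 : mom P (fun w => 2 * L ^+ 2 * z w) by exact: momZ.
have d1 : Ex P (fun w => (V w ^+ 2 + e) * ln (V w ^+ 2 + e)) -
    Ex P (fun w => (U w ^+ 2 + e) * ln (U w ^+ 2 + e)) <= c * (2 * L ^+ 2 * Ex P z).
  rewrite -(ExB mV2 mU2) -ExZ // -ExZ //; apply: Ex_le; [exact: momB|exact: momZ|].
  move=> w; apply: (le_trans (ler_norm _)).
  apply: (le_trans (xlnx_lipschitz e0 (bnd V w VL) (bnd U w UL))).
  by rewrite ler_wpM2l // distrC.
have d2 : `|Ex P (fun w => U w ^+ 2 + e) - Ex P (fun w => V w ^+ 2 + e)| <=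
    2 * L ^+ 2 * Ex P z.
  rewrite -(ExB mU1 mV1) -ExZ // ler_norml; apply/andP; split.
    rewrite -ExN //; apply: Ex_le; [exact: momN|exact: momB|move=> w].
    by have := dist w; rewrite ler_norml => /andP[].
  apply: Ex_le; [exact: momB|by []|move=> w].
  by have := dist w; rewrite ler_norml => /andP[].
have := xlnx_lipschitz e0 (mean U mU1 UL) (mean V mV1 VL); rewrite -/c => d3.
have {}d3 := le_trans d3 (ler_wpM2l c0 d2).
move: d3; rewrite ler_norml => /andP[_ d3].
rewrite /real_entropy; move: d1 d3.
have -> : 4 * L ^+ 2 * c * Ex P z = 2 * (c * (2 * L ^+ 2 * Ex P z)) by ring.
set K := c * _; set a1 := Ex _ _; set a2 := Ex _ _; set b1 := _ * ln _; set b2 := _ * ln _.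
by lra.
Qed.

End entropy_continuity.

(** * The inequality for the regularised square at the endpoint *)

Section regularised_entropy.
Context disp (T : measurableType disp) (R : realType) (P : probability T R).
Context (d m : nat) (X : R -> 'I_d -> {RV P >-> R}) (B : 'I_m -> 'M[R]_d).
Hypothesis Bskew : forall l, (B l)^T = - B l.
Hypothesis hX : standard_brownian_motion X.
Variable J : 'I_d -> 'I_d -> R -> {RV P >-> R}.
Hypothesis hJ : forall p q, is_ito_integral (natural_filtration X)
  (fun s => X s p) (fun s => X s q) 1 (J p q 1).
Variables (f : 'rV[R]_(d + m) -> R) (L : R).
Hypothesis L0 : 0 < L.
Hypothesis hf : schwartz f.
Hypothesis f0 : forall x, `|f x| <= L.
Hypothesis f1 : forall i x, `|partial i f x| <= L.
Hypothesis f2 : forall i j x, `|partial i (partial j f) x| <= L.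

Local Notation increments N := (@grid_increments _ T R P d X N (grid R N)).

Let g p s := Ex P (fun w => limit_derivative X B J f p s w ^+ 2).

(** The integrals on the right-hand side are taken finite here; the infinite case is settled in the
    theorem. *)
Variable I : 'I_d -> R.
Hypothesis hI : forall p,
  (\int[lebesgue_measure]_(s in `[0%R, 1%R]) (g p s)%:E = (I p)%:E)%E.

Let measurable_grid_point N i :
  measurable_fun setT (fun w => area_point B (increments N w) 0 i).
Proof.
apply: (measurableT_comp (measurable_area_point B i)).
by apply: measurable_coords => k; case: (mom_grid_increments hX k).
Qed.

Let measurable_f_grid N : measurable_fun setT (fun w => f (area_point B (increments N w))).
Proof.
apply: (measurableT_comp (schwartz_measurable hf)).
by apply: measurable_fun_rV => i.
Qed.

Let measurable_f_end : measurable_fun setT (fun w => f (endpoint X B J w)).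
Proof. exact: (measurableT_comp (schwartz_measurable hf) (measurable_endpoint X B J)). Qed.

Let f_gap N w :
  `|f (area_point B (increments N w)) - f (endpoint X B J w)| <= L * zeta X B J N w.
Proof.
rewrite /zeta; case: (leP 2 (rho X B J N w)) => hr.
  rewrite (le_trans (ler_normB _ _)) //.
  by have := f0 (area_point B (increments N w)); have := f0 (endpoint X B J w); lra.
exact: (lip_f hf f1).
Qed.

Lemma Ex_zeta_small (t : R) : 0 < t -> exists N0 : nat, forall N, (N0 < N)%N ->
  Ex P (zeta X B J N) <= t.
Proof.
move=> t0; pose r := t / 2.
have r0 : 0 < r by rewrite divr_gt0.
have [N0 hN] := zeta_cvg Bskew hX hJ (exprn_gt0 2 r0).
exists N0 => N {}/hN hN.
have mz := mom_zeta B hX J N; have mz2 := momZ r^-1 (momX 2 mz).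
apply: (@le_trans _ _ (Ex P (fun w => r + r^-1 * zeta X B J N w ^+ 2))).
  apply: Ex_le => [//||w]; first by apply: momD => //; exact: mom_cst.
  have ri : 0 < r^-1 by rewrite invr_gt0.
  have : 0 <= r^-1 * (zeta X B J N w / 2 - r) ^+ 2 by rewrite mulr_ge0 ?sqr_ge0 // ltW.
  have : 0 <= r^-1 * zeta X B J N w ^+ 2 by rewrite mulr_ge0 ?sqr_ge0 // ltW.
  have -> : r^-1 * (zeta X B J N w / 2 - r) ^+ 2 =
     r^-1 * zeta X B J N w ^+ 2 / 4 - zeta X B J N w + r by field; rewrite gt_eqF.
  by set u := r^-1 * _; lra.
rewrite (ExD (mom_cst P r) mz2) Ex_cst (ExZ _ (momX 2 mz)).
have : r^-1 * Ex P (fun w => zeta X B J N w ^+ 2) <= r.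
  by rewrite ler_pdivrMl // -expr2.
by rewrite /r; lra.
Qed.

(** On each cell Young's inequality exchanges the grid derivative for the limiting one at any [s] of
    the cell, and [riemann_lower_bound] turns the sum into an integral. *)
Lemma dirichlet_sum (del tau : R) : 0 < del -> 0 < tau -> exists N0 : nat,
  forall N, (N0 < N)%N ->
  \sum_(k : 'I_N * 'I_d)
     N%:R^-1 * Ex P (fun w => grid_derivative X B f k w ^+ 2) <=
  (1 + del) * \sum_p I p + d%:R * ((1 + del^-1) * tau).
Proof.
move=> d0 tau0; have di0 : 0 < del^-1 by rewrite invr_gt0.
have [N0 hN0] := derivative_gap Bskew hX hJ L0 hf f1 f2 tau0.
exists N0 => N hN; have Npos : (0 < N)%N by exact: leq_ltn_trans hN.
have -> : d%:R * ((1 + del^-1) * tau) = \sum_(p < d) (1 + del^-1) * tau.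
  by rewrite sumr_const card_ord mulr_natl.
rewrite -(pair_bigA _ (fun i p => N%:R^-1 *
  Ex P (fun w => grid_derivative X B f (i, p) w ^+ 2))) /= exchange_big /=.
rewrite mulr_sumr -big_split /=; apply: ler_sum => p _.
rewrite -mulr_sumr -lee_fin.
apply: le_trans (@riemann_lower_bound R N (g p)
  (fun i => Ex P (fun w => grid_derivative X B f (i, p) w ^+ 2)) (1 + del)
  ((1 + del^-1) * tau) Npos _ _ _) _.
- by rewrite addr_gt0.
- by move=> s s0; apply: Ex_ge0 => w; exact: sqr_ge0.
- move=> i s hs; have {}hN0 := hN0 N i p s hN hs.
  have s0 : 0 <= s by case/andP: hs => h _; have := grid_ge0 R N i; lra.
  have mG := mom_grid_derivative B hX hf f1 (i, p).
  have mL := mom_limit_derivative B hX J hf f1 p s0.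
  have mL2 := momZ (1 + del) (momX 2 mL).
  have mD2 := momZ (1 + del^-1) (momX 2 (momB mG mL)).
  apply: (@le_trans _ _ (Ex P (fun w => (1 + del) * limit_derivative X B J f p s w ^+ 2
    + (1 + del^-1) * (grid_derivative X B f (i, p) w - limit_derivative X B J f p s w) ^+ 2))).
    apply: Ex_le; [exact: momX|exact: momD mL2 mD2|move=> w].
    exact: sqr_split.
  rewrite (ExD mL2 mD2) (ExZ _ (momX 2 mL)) (ExZ _ (momX 2 (momB mG mL))).
  by rewrite lerD2l ler_wpM2l // addr_ge0 // ltW.
by rewrite hI -EFinM -EFinD lee_fin.
Qed.

(** The parameters come first because the error constants depend on [del] and [eps]; [N] is then so
    large that the endpoint error, the derivative gap and the quartic remainder cost [eta / 3]
    each. *)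
Lemma regularised_entropy_le (del eps eta : R) : 0 < del <= 1 -> 0 < eps -> 0 < eta ->
  real_entropy P (fun w => f (endpoint X B J w) ^+ 2 + eps) <=
  (2 + 8 * del) * ((1 + del) * \sum_p I p) + eta.
Proof.
move=> del01 eps0 eta0; have /andP[d0 d1] := del01.
have di0 : 0 < del^-1 by rewrite invr_gt0.
pose Lam := 4 * L ^+ 2 * (1 + (`|ln eps| + `|ln (L ^+ 2 + eps)|)).
have Lam0 : 0 < Lam by rewrite !mulr_gt0 ?exprn_gt0 // ltr_pwDl // addr_ge0.
have [C1 C10 hC1] := ent_fun_sqr_le d0 eps0 L0.
have [CV CV0 hCV] := norm1_area_dir4 Bskew hX.
have c40 := c4_ge0 R.
pose C := (2 + 3 * del) * (1 + del^-1) * L ^+ 2 + C1 * L ^+ 4.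
have C0 : 0 <= C.
  rewrite addr_ge0 // mulr_ge0 ?exprn_ge0 ?(ltW L0) // mulr_ge0 // addr_ge0 ?mulr_ge0 ?(ltW d0) //.
  by rewrite ltW.
pose kap := (2 + 8 * del) * (d%:R + 1) * (1 + del^-1).
have kap0 : 0 < kap by rewrite !mulr_gt0 // ?addr_gt0 ?mulr_gt0 // ltr_wpDl.
have tau0 : 0 < eta / (3 * kap) by rewrite divr_gt0 // mulr_gt0.
have z0 : 0 < eta / (3 * Lam) by rewrite divr_gt0 // mulr_gt0.
have [N1 hN1] := Ex_zeta_small z0.
have [N2 hN2] := dirichlet_sum d0 tau0.
(* The quartic errors add up to [Q / N]: there are N d coordinates, each contributing at most
   [C c4 CV / N^2]. *)
pose Q := C * c4 R * d%:R * CV.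
pose N := (maxn (maxn N1 N2) (Num.truncn (3 * Q / eta))).+1.
have Npos : (0 < N)%N by [].
have {}hN1 : Ex P (zeta X B J N) <= eta / (3 * Lam).
  by apply: hN1; rewrite ltnS -maxnA leq_maxl.
have {}hN2 := hN2 N; have {}hN2 := hN2 _.
have /hN2{}hN2 : (N2 < N)%N by rewrite ltnS leq_max leq_maxr.
have hQ : Q / N%:R <= eta / 3.
  have h : 3 * Q / eta <= N%:R.
    by rewrite (le_trans (ltW (truncnS_gt _))) // ler_nat ltnS leq_maxr.
  by rewrite ler_pdivrMr ?ltr0n //; move: h; rewrite ler_pdivrMr //; lra.
have close := real_entropy_close L0 eps0 (@measurable_f_grid N) measurable_f_end
  (mom_zeta B hX J N) (fun w => f0 _) (fun w => f0 _) (f_gap N).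
have disc := discrete_entropy_bound (fun k => mom_grid_increments hX k)
  (indep_increments hX Npos) (fun k => mom_law hX k) L0 hf f0 f1 f2
  (measurable_area_point B) (measurable_area_dir B)
  (fun k i => mom_area_dir B hX k i)
  (area_point_upd B) (area_dir_upd B)
  (fun k => law_second_moment hX k Npos) (fun k => law_fourth_moment hX k Npos)
  del01 eps0 C10 hC1.
apply: (le_trans close); rewrite -/Lam.
have k1 : Lam * Ex P (zeta X B J N) <= eta / 3.
  apply: (@le_trans _ _ (Lam * (eta / (3 * Lam)))); first by rewrite ler_pM2l.
  by rewrite le_eqVlt; apply/orP; left; apply/eqP; field; rewrite gt_eqF.
have k2 : (2 + 8 * del) * \sum_(k : 'I_N * 'I_d)
     N%:R^-1 * Ex P (fun w => grid_derivative X B f k w ^+ 2) <=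
    (2 + 8 * del) * ((1 + del) * \sum_p I p) + eta / 3.
  have a0 : 0 < 2 + 8 * del by rewrite addr_gt0 ?mulr_gt0.
  have h := hN2; rewrite -(ler_pM2l a0) in h; apply: (le_trans h).
  rewrite mulrDr lerD2l.
  apply: (@le_trans _ _ (kap * (eta / (3 * kap)))); last first.
    by rewrite le_eqVlt; apply/orP; left; apply/eqP; field; rewrite gt_eqF.
  rewrite [leRHS](_ : _ = (2 + 8 * del) * ((d%:R + 1) * ((1 + del^-1) * (eta / (3 * kap))))).
    rewrite ler_pM2l // ler_wpM2r ?lerDl //.
    by rewrite mulr_ge0 ?addr_ge0 ?(ltW di0) ?(ltW tau0).
  by rewrite {1}/kap; ring.
have k3 : \sum_(k : 'I_N * 'I_d) C * c4 R * (N%:R^-1 ^+ 2 *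
    Ex P (fun w => norm1 (area_dir B k (increments N w)) ^+ 4)) <= eta / 3.
  apply: le_trans hQ.
  apply: (@le_trans _ _ (\sum_(k : 'I_N * 'I_d) C * c4 R * (N%:R^-1 ^+ 2 * CV))).
    apply: ler_sum => k _; rewrite ler_wpM2l ?mulr_ge0 // ler_wpM2l ?sqr_ge0 //.
    exact: hCV.
  rewrite sumr_const card_prod !card_ord -[X in X <= _]mulr_natl natrM.
  by rewrite le_eqVlt; apply/orP; left; apply/eqP; rewrite /Q; field; rewrite pnatr_eq0.
move: disc; rewrite -/C big_split /= -mulr_sumr => disc.
have {}disc := le_trans disc (lerD k2 k3).
apply: (le_trans (lerD disc k1)).
by lra.
Qed.

End regularised_entropy.

(** * Removal of the regularisation and transfer to the law *)

Section real_entropy_limit.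
Context disp (T : measurableType disp) (R : realType) (P : probability T R).

Lemma mom_xlnx (u : T -> R) (M : R) : measurable_fun setT u -> (forall w, 0 <= u w <= M) ->
  mom P (fun w => u w * ln (u w)).
Proof.
move=> mu uM; apply: (mom_bounded P (M := 1 + M ^+ 2)).
  by apply: measurable_funM => //; apply: measurableT_comp => //; exact: measurable_ln.
by move=> w; exact: xlnx_bound.
Qed.

Lemma real_entropy_le_limit (u : T -> R) (M S : R) : measurable_fun setT u ->
  (forall w, 0 <= u w <= M) ->
  (forall eps, 0 < eps -> real_entropy P (fun w => u w + eps) <= S) ->
  real_entropy P u <= S.
Proof.
move=> mu uM hS.
have mU : mom P u.
  apply: (mom_bounded P mu (M := M)) => w; have /andP[h1 h2] := uM w.
  by rewrite ger0_norm.
have mUl := mom_xlnx mu uM.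
have E0 : 0 <= Ex P u by apply: Ex_ge0 => w; have /andP[] := uM w.
apply/ler_addgt0Pr => e e0.
have a0 : 0 < 4 + Ex P u by rewrite ltr_wpDr.
(* Regularising by [r^2] costs [2 r] from the term [r^2 ln (r^2)] and at most [r (2 + E u)] from the
   term of the mean, in total [r (4 + E u) <= e]. *)
pose r := Num.min 1 (e / (4 + Ex P u)).
have r0 : 0 < r by rewrite lt_min ltr01 divr_gt0.
have r1 : r <= 1 by rewrite ge_min lexx.
have re : r * (4 + Ex P u) <= e by rewrite -ler_pdivlMr // ge_min lexx orbT.
have r20 : 0 < r ^+ 2 by rewrite exprn_gt0.
have r21 : r ^+ 2 <= r by rewrite expr2 ger_pMl.
have h1 : Ex P (fun w => u w * ln (u w)) + r ^+ 2 * ln (r ^+ 2) <=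
    Ex P (fun w => (u w + r ^+ 2) * ln (u w + r ^+ 2)).
  rewrite -(Ex_cst P (r ^+ 2 * ln (r ^+ 2))) -(ExD mUl (mom_cst P _)).
  apply: Ex_le; first exact: momD mUl (mom_cst P _).
    apply: (@mom_xlnx _ (M + r ^+ 2)); first by apply: measurable_funD.
    move=> w; have /andP[h1 h2] := uM w.
    by rewrite addr_ge0 ?sqr_ge0 // lerD2r.
  by move=> w; have /andP[h1 h2] := uM w; exact: xlnx_add_ge.
have h2 : (Ex P u + r ^+ 2) * ln (Ex P u + r ^+ 2) <=
    Ex P u * ln (Ex P u) + r ^+ 2 * (2 + Ex P u).
  by apply: xlnx_add_le => //; rewrite r20 (le_trans r21).
have h3 := sqr_xlnx_ge r0.
have := hS _ r20; rewrite /real_entropy (ExD mU (mom_cst P (r ^+ 2))) (Ex_cst P (r ^+ 2)).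
have h4 : r ^+ 2 * (2 + Ex P u) <= r * (2 + Ex P u).
  by rewrite ler_wpM2r // addr_ge0.
by move: h1 h2 h3 h4 re; lra.
Qed.

Lemma entropy_distribution dU (U : measurableType dU) (Y : {RV P >-> U}) (u : U -> R) (M : R) :
  measurable_fun setT u -> (forall y, 0 <= u y <= M) ->
  entropy (distribution P Y) u = (real_entropy P (u \o Y))%:E.
Proof.
move=> mu uM.
have mUY : measurable_fun setT (u \o Y) by exact: measurableT_comp.
have mU : mom P (u \o Y).
  apply: (mom_bounded P mUY (M := M)) => w; have /andP[h1 h2] := uM (Y w).
  by rewrite ger0_norm.
have mUl : mom P (fun w => (u \o Y) w * ln ((u \o Y) w)) by exact: (mom_xlnx mUY (fun w => uM (Y w))).
rewrite /entropy (integral_distribution (f := fun y => (u y)%:E)); last 2 first.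
- exact/measurable_EFinP.
- exact: mom_integrable mU.
rewrite (integral_distribution (f := fun y => (u y * ln (u y))%:E)); last 2 first.
- apply/measurable_EFinP; apply: measurable_funM => //.
  by apply: measurableT_comp => //; exact: measurable_ln.
- exact: mom_integrable mUl.
have -> : (\int[P]_x ((fun y => (u y)%:E) \o Y) x = (Ex P (u \o Y))%:E)%E.
  by rewrite -ExE.
have -> : (\int[P]_x ((fun y => (u y * ln (u y))%:E) \o Y) x =
    (Ex P (fun w => (u \o Y) w * ln ((u \o Y) w)))%:E)%E.
  by rewrite -ExE.
have : 0 <= Ex P (u \o Y) by apply: Ex_ge0 => w; have /andP[] := uM (Y w).
(* If the mean is 0 its [lne] is -oo, but the factor 0 in front gives 0, in agreement with the real
   expression. *)
rewrite /real_entropy; move: (Ex P (u \o Y)) => e; rewrite le_eqVlt => /predU1P[<-|e0].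
  by rewrite mul0e mul0r.
by rewrite lne_EFin // -EFinM -EFinB.
Qed.

End real_entropy_limit.

Theorem theorem6p1 (R : realType) (d m : nat) (hd : (0 < d)%N) (hm : (0 < m)%N)
    (B : 'I_m -> 'M[R]_d)
    (Bskew : forall l, (B l)^T = - B l)
    (Bfree : free [seq B l | l <- enum 'I_m])
    (disp : measure_display) (T : measurableType disp) (P : probability T R)
    (X : R -> 'I_d -> {RV P >-> R})
    (hX : standard_brownian_motion X)
    (J : 'I_d -> 'I_d -> R -> {RV P >-> R})
    (hJ : forall p q t, 0 <= t ->
      is_ito_integral (natural_filtration X)
        (fun s => X s p) (fun s => X s q) t (J p q t))
    (f : 'rV[R]_(d + m) -> R) (hf : schwartz f) :
  (entropy (distribution P (bm_levy_area X B J 1)) (fun x => (f x ^+ 2)%R)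
   <= 2%:E * \sum_(p < d) \int[lebesgue_measure]_(s in `[0%R, 1%R])
        'E_P[fun w =>
          ((partial (lshift m p) f (bm_levy_area X B J 1 w)
           + \sum_(l < m) (\sum_(q < d) B l p q * (X 1 q w - 2 * X s q w))
               * partial (rshift d l) f (bm_levy_area X B J 1 w)) ^+ 2)%R])%E.
Proof.
have [L L1 [f0 f1 f2]] := schwartz_bounds hf.
have L0 : 0 < L by exact: lt_le_trans L1.
have {}hJ p q : is_ito_integral (natural_filtration X)
    (fun s => X s p) (fun s => X s q) 1 (J p q 1) by exact: hJ.
have u_bd (y : 'rV[R]_(d + m)) : 0 <= f y ^+ 2 <= L ^+ 2.
  rewrite sqr_ge0 -[f y ^+ 2]real_normK ?num_real //.
  by rewrite lerXn2r ?nnegrE // ltW.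
have mu : measurable_fun setT (fun y : borel_rV R (d + m) => f y ^+ 2).
  by apply: measurable_funX; exact: schwartz_measurable.
rewrite (entropy_distribution _ mu u_bd).
pose g p s := Ex P (fun w => limit_derivative X B J f p s w ^+ 2).
have g0 p s : 0 <= g p s by apply: Ex_ge0 => w; exact: sqr_ge0.
rewrite (eq_bigr (fun p => \int[lebesgue_measure]_(s in `[0%R, 1%R]) (g p s)%:E)%E); last first.
  move=> p _; apply: eq_integral => s; rewrite inE /= in_itv /= => /andP[s0 _].
  have mL := mom_limit_derivative B hX J hf f1 p s0.
  rewrite /g -ExE; last exact: momX.
  rewrite unlock; apply: eq_integral => w _; congr (_ ^+ 2)%:E.
  (* The first block of [direction] is the p-th basis vector and selects a single derivative; the
     second block gives the sum over [l]. *)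
  rewrite /limit_derivative /dirder big_split_ord /=; congr (_ + _).
    rewrite (bigD1 p) //= row_mxEl mxE eqxx mul1r big1 ?addr0 // => p' /negbTE pp'.
    by rewrite row_mxEl mxE pp' mul0r.
  by apply: eq_bigr => l _; rewrite row_mxEr mxE.
have I0 p : (0 <= \int[lebesgue_measure]_(s in `[0%R, 1%R]) (g p s)%:E)%E.
  by apply: integral_ge0 => s _; rewrite lee_fin.
(* One infinite integral makes the right-hand side [+oo], so all of them may be taken real
   afterwards. *)
have [fin|/existsNP[p hp]] := pselect (forall p,
    (\int[lebesgue_measure]_(s in `[0%R, 1%R]) (g p s)%:E)%E \is a fin_num); last first.
  move: hp; rewrite (ge0_fin_numE (I0 p)) => /negP; rewrite -leNgt leye_eq => /eqP hp.
  suff -> : (\sum_(p < d) \int[lebesgue_measure]_(s in `[0%R, 1%R]) (g p s)%:E = +oo)%E.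
    by rewrite gt0_muley ?lte_fin // leey.
  apply/esum_eqyP; last by exists p; rewrite mem_index_enum.
  by move=> q _; rewrite gt_eqF // (lt_le_trans _ (I0 q)).
pose I p := fine (\int[lebesgue_measure]_(s in `[0%R, 1%R]) (g p s)%:E)%E.
have hI p : (\int[lebesgue_measure]_(s in `[0%R, 1%R]) (g p s)%:E = (I p)%:E)%E.
  by rewrite /I fineK.
under eq_bigr do rewrite hI.
rewrite sumEFin -EFinM lee_fin.
apply: (real_entropy_le_limit (M := L ^+ 2)); [|by move=> w; exact: u_bd|].
  exact: (measurableT_comp mu (measurable_endpoint X B J)).
move=> eps eps0; apply/ler_addgt0Pr => e e0.
set S := \sum_p I p.
have S0 : 0 <= S by apply: sumr_ge0 => p _; rewrite fine_ge0.
(* The excess over [2 S] is [10 del S + 8 del^2 S + e / 2], at most [18 del S + e / 2]; the factor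
   36 makes [18 del S] at most [e / 2]. *)
pose del := Num.min 1 (e / (36 * (S + 1))).
have d0 : 0 < del by rewrite lt_min ltr01 divr_gt0 // mulr_gt0 // ltr_wpDl.
have d1 : del <= 1 by rewrite ge_min lexx.
have de : del * (36 * (S + 1)) <= e.
  by rewrite -ler_pdivlMr ?ge_min ?lexx ?orbT // mulr_gt0 // ltr_wpDl.
have d01 : 0 < del <= 1 by rewrite d0.
have e20 : 0 < e / 2 by rewrite divr_gt0.
have := regularised_entropy_le Bskew hX hJ L0 hf f0 f1 f2 hI d01 eps0 e20.
rewrite -/S => /le_trans; apply.
have : del ^+ 2 * S <= del * S by rewrite ler_wpM2r // expr2 ger_pMl.
have := mulr_ge0 (ltW d0) S0.
by move: de; lra.
Qed.
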